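(* Let $\mathbf Y$ be a finite dimensional Hilbert space, $g:\mathbf Y\to[-\infty,\infty]$ and $(\bar u,\bar y)\in\mathrm{gph}\,\partial g$. Assume that there is a neighborhood $U$ of $\bar u$ such that $g$ is reliably $\mathcal C^2$-decomposable at any $u\in U\cap\mathrm{dom}\,g$. If $g$ is prox-bounded, then the following properties are equivalent: (a) $\bar y\in\mathrm{ri}\,\partial g(\bar u)$; (b) there exists a positive constant $r$ such that for any $\gamma\in(0,1/r)$, the proximal mapping $\mathrm{prox}_{\gamma g}$ is $\mathcal C^1$ around $\bar u+\gamma\bar y$; (c) there exists a positive constant $r$ such that for any $\gamma\in(0,1/r)$, the envelope function $e_\gamma g$ is $\mathcal C^2$ around $\bar u+\gamma\bar y$. In addition, if $g$ is convex, the constant $r$ in (b) and (c) can be taken as $0$ with the convention $1/0=\infty$.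
   Context: For a set $\Omega$ and $x\in\Omega$, $T_\Omega(x)=\limsup_{t\searrow0}\frac{\Omega-x}{t}$ (Painlevé–Kuratowski outer limit) is the tangent cone, $\widehat N_\Omega(x)=T_\Omega(x)^*$ (polar) the regular normal cone, and $N_\Omega(\bar x)$, the limiting normal cone, consists of limits of $v^k\in\widehat N_\Omega(x^k)$ with $x^k\to\bar x$, $x^k\in\Omega$. For $f$ with $f(\bar x)$ finite, $\partial f(\bar x)=\{v\mid(v,-1)\in N_{\mathrm{epi}f}(\bar x,f(\bar x))\}$. $\mathrm{ri}$ denotes relative interior; $\mathrm{dom}\,g=\{u\mid g(u)<\infty\}$. $g$ is $\mathcal C^2$-decomposable at $u$ if $g(u)$ is finite and there are an open neighborhood $\mathcal O\subset\mathbf Y$ of $u$, a finite dimensional Hilbert space $\mathbf Z$, a proper, lower semicontinuous, sublinear function $\vartheta:\mathbf Z\to[-\infty,\infty]$ and a $\mathcal C^2$-smooth mapping $\Xi:\mathcal O\to\mathbf Z$ with $\Xi(u)=0$ such that $g(u')=g(u)+\vartheta(\Xi(u'))$ for all $u'\in\mathcal O$. It is reliably $\mathcal C^2$-decomposable at $u$ if, in addition, the nondegeneracy condition $\mathrm{par}\{\partial\vartheta(\Xi(u))\}\cap\ker\nabla\Xi(u)^*=\{0\}$ holds, where $\mathrm{par}\,C$ is the linear subspace parallel to the affine hull of $C$. $g$ is prox-bounded if $g+\alpha\|\cdot\|^2$ is bounded from below on $\mathbf Y$ for some $\alpha\in\mathbb R$. $\mathrm{prox}_{\gamma g}(x)=\mathrm{argmin}_{w\in\mathbf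 Y}\{g(w)+\frac1{2\gamma}\|w-x\|^2\}$ and $e_\gamma g(x)=\inf_{w\in\mathbf Y}\{g(w)+\frac1{2\gamma}\|w-x\|^2\}$. Saying that $\mathrm{prox}_{\gamma g}$ is $\mathcal C^1$ around a point means that it is single-valued and continuously differentiable on a neighborhood of that point. *)

(* Defs.v *)
From HB Require Import structures.
From mathcomp Require Import all_boot all_order all_algebra.
From mathcomp Require Import all_classical all_reals all_analysis.

Set Implicit Arguments.
Unset Strict Implicit.
Unset Printing Implicit Defensive.
Import Order.TTheory GRing.Theory Num.Theory.
Import numFieldNormedType.Exports.

Local Open Scope classical_set_scope.
Local Open Scope ring_scope.

(* The topology, the norm and the differential calculus of a Hilbert space are
   those of the underlying normed module; [normr_sqr_inner] forces the norm to
   be the one induced by the inner product. *)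
HB.mixin Record NormedModule_hasInner (R : realType) V
    & NormedModule R V & Vector R V := {
  inner : {dot V for (@idfun R)};
  normr_sqr_inner : forall x : V, `|x| ^+ 2 = inner x x
}.

#[short(type="finHilbertType")]
HB.structure Definition FinHilbert (R : realType) :=
  {V of NormedModule R V & Vector R V & NormedModule_hasInner R V}.

Section Adjoint.
Context {R : realType} {Y Z : finHilbertType R}.

(* The default value 0 is never used when A is linear: then the adjoint exists
   and is unique. *)
Definition adjoint (A : Y -> Z) (z : Z) : Y :=
  xget 0 [set y | forall x, inner (A x) z = inner x y].

End Adjoint.

Section Smooth.
Context {R : realType} {V W : normedModType R}.

(* These definitions are meant for finite dimensional V and W and open O. On the
   space of linear maps V -> W, a map is then continuous, resp. continuously
   differentiable, iff all its evaluations at vectors v are. *)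
Definition C1_on (O : set V) (f : V -> W) : Prop :=
  forall x, O x -> differentiable f x /\
    forall v, {for x, continuous (fun z => 'd f z v)}.

Definition C2_on (O : set V) (f : V -> W) : Prop :=
  C1_on O f /\ forall v, C1_on O (fun z => 'd f z v).

End Smooth.

Section AffineGeometry.
Context {R : realType} {V : normedModType R}.

Definition affine_set (A : set V) : Prop :=
  forall x y (t : R), A x -> A y -> A ((1 - t) *: x + t *: y).

Definition affine_hull (C : set V) : set V := smallest affine_set C.

Definition par (C : set V) : set V :=
  [set x - y | x in affine_hull C & y in affine_hull C].

Definition ri (C : set V) : set V :=
  [set x | affine_hull C x /\ \forall y \near x, affine_hull C y -> C y].

End AffineGeometry.

Section NormalCones.
Context {R : realType} {V : normedModType R}.

(* Painleve-Kuratowski outer limit of S t as t decreases to 0. *)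
Definition outer_limit0 (S : R -> set V) : set V :=
  [set w | exists t_ : nat -> R, exists w_ : nat -> V,
     [/\ forall n, 0 < t_ n, t_ n @[n --> \oo] --> (0 : R),
         forall n, S (t_ n) (w_ n) & w_ n @[n --> \oo] --> w]].

Definition tangent_cone (Om : set V) (x : V) : set V :=
  outer_limit0 (fun t => [set t^-1 *: (z - x) | z in Om]).

(* The pairing b is a parameter because epigraphs live in V * R, whose library
   norm is the max norm: it has the right topology, but it does not come from
   an inner product. *)
Variable b : V -> V -> R.

Definition polar (C : set V) : set V := [set v | forall w, C w -> b v w <= 0].

Definition regular_normal (Om : set V) (x : V) : set V :=
  polar (tangent_cone Om x).

Definition limiting_normal (Om : set V) (x : V) : set V :=
  [set v | exists x_ : nat -> V, exists v_ : nat -> V,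
     [/\ forall n, Om (x_ n), x_ n @[n --> \oo] --> x,
         forall n, regular_normal Om (x_ n) (v_ n)
       & v_ n @[n --> \oo] --> v]].

End NormalCones.

Section ExtendedFunctions.
Context {R : realType} {Y : finHilbertType R}.
Implicit Types (g : Y -> \bar R) (x u : Y) (gamma : R).
Local Open Scope ereal_scope.

Definition dom g : set Y := [set u | g u < +oo].

Definition epi g : set (Y * R^o) := [set p | g p.1 <= (p.2 : R)%:E].

Definition inner_epi (p q : Y * R^o) : R :=
  (inner p.1 q.1 + (p.2 : R) * (q.2 : R))%R.

Definition subdiff g x : set Y :=
  [set v | g x \is a fin_num /\
     limiting_normal inner_epi (epi g) (x, fine (g x) : R^o)
       (v, (-1)%R : R^o)].

Definition convex_ereal_fun g : Prop := @convex_set R (Y * R^o)%type (epi g).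

Definition proper_ereal_fun g : Prop :=
  (forall x, -oo < g x) /\ exists x, g x < +oo.

Definition sublinear g : Prop :=
  [/\ g 0%R < +oo,
      forall (t : R) x, (0 < t)%R -> g (t *: x)%R = t%:E * g x
    & forall x y, g (x + y)%R <= g x + g y].

Definition prox_bounded g : Prop :=
  exists alpha m : R, forall w, m%:E <= g w + (alpha * `|w| ^+ 2)%:E.

Definition argmin g : set Y :=
  [set w | g w < +oo /\ forall w', g w <= g w'].

Definition moreau_objective gamma g x : Y -> \bar R :=
  fun w => g w + ((2 * gamma)^-1 * `|(w - x)%R| ^+ 2)%:E.

Definition prox gamma g x : set Y := argmin (moreau_objective gamma g x).

Definition envelope gamma g x : \bar R :=
  ereal_inf (range (moreau_objective gamma g x)).

End ExtendedFunctions.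

Section Theorem_notions.
Context {R : realType} {Y : finHilbertType R}.
Implicit Types (g : Y -> \bar R) (u x : Y).

(* Xi is given on all of Y, but only its values on the open set O matter. *)
Definition C2_decomposition g u (Z : finHilbertType R) (O : set Y)
    (theta : Z -> \bar R) (Xi : Y -> Z) : Prop :=
  [/\ open O /\ O u,
      [/\ proper_ereal_fun theta, lower_semicontinuous theta & sublinear theta],
      C2_on O Xi, Xi u = 0
    & forall u', O u' -> g u' = (g u + theta (Xi u'))%E].

Definition C2_decomposable g u : Prop :=
  g u \is a fin_num /\
  exists (Z : finHilbertType R) (O : set Y) (theta : Z -> \bar R) (Xi : Y -> Z),
    C2_decomposition g u O theta Xi.

Definition reliably_C2_decomposable g u : Prop :=
  g u \is a fin_num /\
  exists (Z : finHilbertType R) (O : set Y) (theta : Z -> \bar R) (Xi : Y -> Z),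
    C2_decomposition g u O theta Xi /\
    par (subdiff theta (Xi u)) `&` [set z | adjoint ('d Xi u) z = 0]
      = [set 0].

Definition prox_C1_around (gamma : R) g x : Prop :=
  exists (W : set Y) (p : Y -> Y),
    [/\ open W /\ W x, forall z, W z -> prox gamma g z = [set p z]
      & C1_on W p].

Definition envelope_C2_around (gamma : R) g x : Prop :=
  exists (W : set Y),
    [/\ open W /\ W x, forall z, W z -> envelope gamma g z \is a fin_num
      & C2_on W (fun z => fine (envelope gamma g z) : R^o)].

End Theorem_notions.

(* Main.v *)
Require Import Defs.
From HB Require Import structures.
From mathcomp Require Import all_boot all_order all_algebra.
From mathcomp Require Import all_classical all_reals all_analysis.
From mathcomp Require Import ring lra.
Import Order.TTheory GRing.Theory Num.Theory.
Import numFieldNormedType.Exports.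
Local Open Scope classical_set_scope.
Local Open Scope ring_scope.

Set Implicit Arguments.
Unset Strict Implicit.
Unset Printing Implicit Defensive.

(** Nondegeneracy of the decomposition at [u] lets one replace [Xi] by a local
    diffeomorphism [Phi] of the space itself, tangent to the identity at [u],
    and subtracting the slope [y] turns [g] near [u] into
    [g u + Q w + h (Phi w)], where [grad Q u = y] and [h >= 0] is sublinear.
    Then [subdiff g u = y + K], with [K] the set of linear minorants of [h], and
    [y] is in the relative interior iff [K] contains a ball of [N = span K].

    If it does, a manifold point [p] with [Phi p] orthogonal to [N] and a small
    multiplier [k] in [N] define the smooth map
    [X = p + gamma (grad Q p + Phi'(p)^* k)]. Quadratic lower bounds on [g] make
    its differential injective, so [X] is a local diffeomorphism, and they show
    that [p] is the unique prox of [X]. Convexity removes the quadratic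
    defect of these bounds, hence the restriction on [gamma].

    Conversely, on [u + gamma (y + K)] the envelope coincides with the quadratic
    [k |-> g u + gamma/2 |y + k|^2], so if it is C2 its second derivative along
    any [n] in [N] is that of the quadratic. If [K] contained no ball of [N],
    some [n != 0] in [N] would satisfy [h n = 0], and the test points on the
    curve [Phi w = s n] make the envelope drop below the quadratic at second
    order along [n]. *)

(** * Finite dimensional Hilbert spaces *)

(** [Xi] takes values in another space [Z] and may be neither injective nor surjective to first
    order at [u]; nondegeneracy controls it only on the span S of the differences of subgradients of
    [theta]. This is enough: all these subgradients agree on the orthogonal of S, so [theta] is
    linear there and its contribution is a smooth function that can be moved into [Q]. Curvature
    enters only through Taylor remainders of [Q] and [Phi]. Injectivity of the differential of [X]
    follows from adding two lower bounds with exchanged base points. Prox-boundedness supplies the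
    lower bound away from [u], and [r] is the resulting quadratic defect. In the converse, [n] leads
    out of the set where the envelope is known, since h n = 0 with n != 0 excludes every positive
    multiple of [n] from K. The second derivative along [n] is still determined, because it is
    linear in its argument and K spans N. *)

Section Inner.
Context {R : realType} {Y : finHilbertType R}.
Implicit Types x y z : Y.

Lemma innerDl x y z : inner (x + y) z = inner x z + inner y z.
Proof. exact: linearDl. Qed.

Lemma innerDr x y z : inner x (y + z) = inner x y + inner x z.
Proof. exact: linearDr. Qed.

Lemma innerZl (a : R) x y : inner (a *: x) y = a * inner x y.
Proof. exact: linearZl_LR. Qed.

Lemma innerZr (a : R) x y : inner x (a *: y) = a * inner x y.
Proof. by have := linearZr_LR (@inner R Y) x a y. Qed.

Lemma innerC x y : inner x y = inner y x.
Proof. by rewrite hermC/= expr0 mul1r. Qed.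

Lemma inner0l x : inner (0 : Y) x = 0.
Proof. by rewrite -(scale0r (0 : Y)) innerZl mul0r. Qed.

Lemma inner0r x : inner x (0 : Y) = 0.
Proof. by rewrite innerC inner0l. Qed.

Lemma innerNl x y : inner (- x) y = - inner x y.
Proof. by rewrite -scaleN1r innerZl mulN1r. Qed.

Lemma innerNr x y : inner x (- y) = - inner x y.
Proof. by rewrite innerC innerNl innerC. Qed.

Lemma innerBl x y z : inner (x - y) z = inner x z - inner y z.
Proof. by rewrite innerDl innerNl. Qed.

Lemma innerBr x y z : inner x (y - z) = inner x y - inner x z.
Proof. by rewrite innerDr innerNr. Qed.

Definition innerE := (innerDl, innerDr, innerBl, innerBr, innerNl, innerNr,
  innerZl, innerZr, inner0l, inner0r).

Lemma inner_suml (I : Type) (r : seq I) (P : pred I) (F : I -> Y) y :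
  inner (\sum_(i <- r | P i) F i) y = \sum_(i <- r | P i) inner (F i) y.
Proof. exact: linear_sumlz. Qed.

Lemma innerxx x : inner x x = `|x| ^+ 2.
Proof. by rewrite normr_sqr_inner. Qed.

Lemma inner_eq0 x : inner x x = 0 -> x = 0.
Proof. by rewrite innerxx => /eqP; rewrite sqrf_eq0 normr_eq0 => /eqP. Qed.

Lemma inner_inj x y : (forall z, inner z x = inner z y) -> x = y.
Proof.
move=> xy; apply/eqP; rewrite -subr_eq0; apply/eqP/inner_eq0.
by rewrite innerBr xy subrr.
Qed.

End Inner.

Ltac hilbert_ring := apply: inner_inj => ?; rewrite !innerE; ring.

Section Norm.
Context {R : realType} {Y : finHilbertType R}.
Implicit Types x y z : Y.

Lemma normD_sqr x y : `|x + y| ^+ 2 = `|x| ^+ 2 + 2 * inner x y + `|y| ^+ 2.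
Proof. rewrite -!innerxx !innerE (innerC y x); ring. Qed.

Lemma normB_sqr x y : `|x - y| ^+ 2 = `|x| ^+ 2 - 2 * inner x y + `|y| ^+ 2.
Proof. by rewrite normD_sqr innerNr normrN mulrN. Qed.

Lemma le_inner_norm x y : inner x y <= `|x| * `|y|.
Proof.
have [->|x0] := eqVneq x 0; first by rewrite inner0l normr0 mul0r.
have [->|y0] := eqVneq y 0; first by rewrite inner0r normr0 mulr0.
have : 0 <= `| `|y| *: x - `|x| *: y| ^+ 2 by rewrite sqr_ge0.
rewrite normB_sqr !innerE !normrZ !normr_id.
have xp : 0 < `|x| by rewrite normr_gt0.
have yp : 0 < `|y| by rewrite normr_gt0.
move=> H; rewrite -subr_ge0 -(pmulr_lge0 _ (mulr_gt0 xp yp)).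
by rewrite -(pmulr_lge0 _ (ltr0n _ 2)); apply: le_trans H _; rewrite le_eqVlt;
  apply/orP; left; apply/eqP; ring.
Qed.

Lemma norm_inner_le x y : `|inner x y| <= `|x| * `|y|.
Proof.
by rewrite ler_norml lerNl -innerNl -{1}(normrN x) !le_inner_norm.
Qed.

End Norm.

Section Riesz.
Context {R : realType} {Y : finHilbertType R}.
Implicit Types (x y z : Y) (U : {vspace Y}).

(** The Gram matrix of a basis of [U] is invertible, since a combination in its kernel is orthogonal
    to itself; solving the Gram system for the values of [f] gives [y]. The version relative to [U]
    also yields orthogonal projections. *)
Lemma riesz_vspace U (f : {linear Y -> R^o}) :
  exists2 y, y \in U & forall x, x \in U -> f x = inner x y.
Proof.
pose n := \dim U; pose b i := (vbasis U)`_i : Y.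
pose G := \matrix_(i < n, j < n) inner (b i) (b j).
have comb (c : 'rV[R]_n) i :
    inner (\sum_(j < n) c 0 j *: b j) (b i) = \sum_(j < n) c 0 j * inner (b j) (b i).
  by rewrite inner_suml; apply: eq_bigr => j _; rewrite innerZl.
have freeb : free (vbasis U) := basis_free (vbasisP U).
have bU (i : 'I_n) : b i \in U by rewrite vbasis_mem// mem_nth// size_tuple.
have Gfree : row_free G.
  apply/inj_row_free => c /rowP cG0.
  have inn0 i : inner (\sum_(j < n) c 0 j *: b j) (b i) = 0 \/ (n <= i)%N.
    have [ni|ni] := leqP n i; first by right.
    left; rewrite comb; have := cG0 (Ordinal ni); rewrite !mxE => cGi.
    by rewrite -[RHS]cGi; apply: eq_bigr => j _; rewrite mxE.
  have : \sum_(j < n) c 0 j *: b j = 0.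
    apply: inner_eq0; rewrite {1}inner_suml big1// => i _.
    by rewrite innerZl innerC; case: (inn0 i) => [->|]; rewrite ?mulr0// leqNgt ltn_ord.
  move/freeP: freeb => freeb; move=> /(freeb (fun j => c 0 j)) c0; apply/rowP => j; rewrite mxE; exact: c0.
have Gu : G \in unitmx by rewrite -row_free_unit.
pose c := (\row_j f (b j)) *m invmx G.
have cG : c *m G = \row_j f (b j) by rewrite mulmxKV.
exists (\sum_(j < n) c 0 j *: b j).
  by apply: memv_suml => j _; apply: memvZ.
have fb (i : 'I_n) : f (b i) = inner (b i) (\sum_(j < n) c 0 j *: b j).
  have /rowP/(_ i) := cG; rewrite [RHS]mxE => <-.
  rewrite innerC comb; clearbody c; rewrite mxE.
  by apply: eq_bigr => j _; rewrite mxE.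
move=> x /(coord_vbasis (U:=U)) ->.
rewrite linear_sum inner_suml; apply: eq_bigr => i _.
by rewrite linearZ innerZl -fb.
Qed.

Lemma riesz (f : {linear Y -> R^o}) : exists y, forall x, f x = inner x y.
Proof.
have [y _ fy] := riesz_vspace {:Y}%VS f; exists y => x.
by apply: fy; rewrite memvf.
Qed.

Section Proj.
Variable U : {vspace Y}.

Lemma inner_linear z : linear_for ( *:%R) ((fun x => inner x z) : Y -> R^o).
Proof. by move=> a x y; rewrite innerDl innerZl. Qed.

Lemma orthproj_ex z : exists p, p \in U /\ forall x, x \in U -> inner x (z - p) = 0.
Proof.
pose f : {linear Y -> R^o} := HB.pack ((fun x => inner x z) : Y -> R^o)
  (GRing.isLinear.Build _ _ _ _ _ (inner_linear z)).
have [p pU fp] := riesz_vspace U f.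
by exists p; split=> // x xU; rewrite innerBr -fp// subrr.
Qed.

Definition orthproj z : Y := xget 0 [set p | p \in U /\
  forall x, x \in U -> inner x (z - p) = 0].

Lemma orthprojP z : orthproj z \in U /\
  forall x, x \in U -> inner x (z - orthproj z) = 0.
Proof. by rewrite /orthproj; case: xgetP => [p _ //|] /=; have [p pP /(_ p)] := orthproj_ex z. Qed.

Lemma orthproj_in z : orthproj z \in U. Proof. by have [] := orthprojP z. Qed.

Lemma orthproj_orth z x : x \in U -> inner x (z - orthproj z) = 0.
Proof. by have [_] := orthprojP z; apply. Qed.

Lemma orthproj_uniq z p : p \in U -> (forall x, x \in U -> inner x (z - p) = 0) ->
  orthproj z = p.
Proof.
move=> pU zp; apply/eqP; rewrite -subr_eq0; apply/eqP/inner_eq0.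
have dU : orthproj z - p \in U by rewrite memvB// orthproj_in.
have E : orthproj z - p = (z - p) - (z - orthproj z).
  by rewrite opprB [RHS]addrC addrA subrK.
by rewrite {2}E innerBr zp// orthproj_orth// subrr.
Qed.

Lemma orthproj_linear : linear orthproj.
Proof.
move=> a x y; apply: orthproj_uniq; first by rewrite memvD ?memvZ ?orthproj_in.
move=> z zU; rewrite opprD addrACA -scalerBr innerDr innerZr.
by rewrite !orthproj_orth// mulr0 addr0.
Qed.

HB.instance Definition _ := GRing.isLinear.Build R Y Y _ orthproj orthproj_linear.

Lemma orthproj_id x : x \in U -> orthproj x = x.
Proof. by move=> xU; apply: orthproj_uniq => // z _; rewrite subrr inner0r. Qed.

Lemma orthprojC x y : inner (orthproj x) y = inner x (orthproj y).
Proof.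
have h u v : inner (orthproj u) v = inner (orthproj u) (orthproj v).
  by apply/eqP; rewrite -subr_eq0 -innerBr orthproj_orth// orthproj_in.
by rewrite h innerC -h innerC.
Qed.

End Proj.

(** [K] may be infinite: [U] is the span of a finite family from [K] of largest possible dimension,
    so no element of [K] can enlarge it. The second clause is the induction principle of the
    span. *)
Lemma lin_span_ex (K : set Y) : exists U : {vspace Y},
  (forall k, K k -> k \in U) /\
  forall S : set Y, S 0 -> (forall (a : R) x y, S x -> S y -> S (a *: x + y)) ->
    K `<=` S -> forall u, u \in U -> S u.
Proof.
pose Pn n := exists2 X : seq Y, (forall x, x \in X -> K x) & \dim <<X>> = n.
have [n [X XK Xn] nmax] : exists2 n, Pn n & forall m, Pn m -> (m <= n)%N.
  have Pn0 : Pn 0%N by exists [::]; rewrite ?span_nil ?dimv0.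
  have Pb m : Pn m -> (m <= \dim {:Y})%N.
    by move=> [X _ <-]; rewrite dimvS// subvf.
  pose Q m : bool := `[< Pn m >].
  have exQ : exists m, Q m by exists 0%N; apply/asboolP.
  have Qb m : Q m -> (m <= \dim {:Y})%N by move=> /asboolP/Pb.
  case: (ex_maxnP exQ Qb) => n /asboolP Pnn nm; exists n => // m Pm.
  by apply: nm; apply/asboolP.
exists <<X>>%VS; split=> [k Kk|S S0 Slin KS u].
  have : (\dim <<k :: X>> <= n)%N.
    apply: nmax; exists (k :: X) => // x.
    by rewrite inE => /orP[/eqP->//|/XK].
  rewrite -Xn => dle.
  have sub : (<<X>> <= <<k :: X>>)%VS.
    by apply: sub_span => x xX; rewrite inE xX orbT.
  have /eqP -> : <<X>>%VS == <<k :: X>>%VS by rewrite eqEdim sub.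
  by rewrite memv_span// mem_head.
have : forall x, x \in X -> S x by move=> x /XK /KS.
elim: X u {XK Xn} => [|x X IH] u XS.
  by rewrite span_nil memv0 => /eqP->.
rewrite span_cons => /memv_addP[v /vlineP[a ->]] [w wX ->].
by apply: Slin; [apply: XS; rewrite mem_head|apply: IH => // z zX; apply: XS; rewrite inE zX orbT].
Qed.

Definition lin_span (K : set Y) : {vspace Y} := xget 0%VS [set U : {vspace Y} |
  (forall k, K k -> k \in U) /\
  forall S : set Y, S 0 -> (forall (a : R) x y, S x -> S y -> S (a *: x + y)) ->
    K `<=` S -> forall u, u \in U -> S u].

Lemma lin_spanP (K : set Y) : (forall k, K k -> k \in lin_span K) /\
  forall S : set Y, S 0 -> (forall (a : R) x y, S x -> S y -> S (a *: x + y)) ->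
    K `<=` S -> forall u, u \in lin_span K -> S u.
Proof. by rewrite /lin_span; case: xgetP => [p _ //|]; have [p pP /(_ p)] := lin_span_ex K. Qed.

Lemma mem_lin_span (K : set Y) k : K k -> k \in lin_span K.
Proof. by case: (lin_spanP K) => + _; apply. Qed.

Lemma lin_span_ind (K S : set Y) : S 0 ->
  (forall (a : R) x y, S x -> S y -> S (a *: x + y)) ->
  K `<=` S -> forall u, u \in lin_span K -> S u.
Proof. by case: (lin_spanP K) => _; apply. Qed.

End Riesz.

Section FiniteDim.
Context {R : realType} {Y : finHilbertType R}.
Implicit Types x y z : Y.

Lemma cvg_inner (T : Type) (F : set_system T) (FF : Filter F) (f g : T -> Y) a b :
  f @ F --> a -> g @ F --> b -> inner (f x) (g x) @[x --> F] --> inner a b.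
Proof.
have polar u v : inner u v = 2^-1 * (`|u + v| ^+ 2 - `|u| ^+ 2 - `|v| ^+ 2) :> R.
  by rewrite normD_sqr; field.
move=> fa gb; rewrite polar; under eq_fun do rewrite polar.
have sq (h : T -> Y) c : h @ F --> c -> `|h x| ^+ 2 @[x --> F] --> (`|c| ^+ 2 : R).
  by move=> hc; rewrite expr2; under eq_fun do rewrite expr2;
    apply: cvgM; apply: cvg_norm.
apply: cvgM; first exact: cvg_cst.
by apply: cvgB; [apply: cvgB|]; apply: sq => //; apply: cvgD.
Qed.

(** [d i] represents the [i]-th coordinate functional of the basis [b]. The expansion reduces
    statements on linear maps to finitely many values. *)
Lemma dual_bases : exists (n : nat) (b d : 'I_n -> Y),
  (forall x, x = \sum_i inner x (d i) *: b i) /\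
  (forall x, x = \sum_i inner x (b i) *: d i).
Proof.
pose n := \dim {:Y}.
pose B := vbasis {:Y}.
have ex (i : 'I_n) : exists y, forall x, coord B i x = inner x y.
  exact: (riesz (coord B i)).
have [d dP] := choice ex.
have bE x : x = \sum_(i < n) inner x (d i) *: B`_i.
  rewrite {1}(coord_vbasis (memvf x)); apply: eq_bigr => i _.
  by rewrite dP.
exists n, (fun i => B`_i), d; split => // x.
apply: inner_inj => z; rewrite {1}(bE z) innerC [RHS]innerC.
rewrite [LHS]innerC !inner_suml; apply: eq_bigr => i _.
by rewrite !innerZl mulrC (innerC x) (innerC (d i)).
Qed.

Lemma linear_bound (W : normedModType R) (f : {linear Y -> W}) :
  exists2 M : R, 0 < M & forall x, `|f x| <= M * `|x|.
Proof.
have [n [b [d [bE _]]]] := dual_bases.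
exists (1 + \sum_(i < n) `|d i| * `|f (b i)|) => [|x].
  by apply: ltr_pwDl => //; apply: sumr_ge0 => i _; rewrite mulr_ge0.
rewrite {1}(bE x) linear_sum mulrDl mul1r mulr_suml.
apply: (le_trans (ler_norm_sum _ _ _)); apply: ler_wpDl => //.
apply: ler_sum => i _; rewrite linearZ normrZ mulrAC ler_wpM2r//.
by rewrite mulrC norm_inner_le.
Qed.

Lemma linear_continuous_fin (W : normedModType R) (f : {linear Y -> W}) :
  continuous f.
Proof.
have [M M0 fM] := linear_bound f.
move=> x; apply/cvgrPdist_le => e e0.
near=> y; rewrite -linearB; apply: (le_trans (fM _)).
rewrite -ler_pdivlMl//; near: y.
by apply: (cvgrPdist_le _ _).1; [exact: cvg_id|rewrite mulr_gt0 ?invr_gt0].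
Unshelve. all: by end_near. Qed.

(** The ball is a closed subset of the continuous image of a box of coordinates, whose sides come
    from Cauchy-Schwarz applied to inner (x - a) (d i). *)
Lemma compact_normball (a : Y) (r : R) : compact [set x | `|x - a| <= r].
Proof.
have [n [b [d [bE _]]]] := dual_bases.
pose phi (c : 'rV[R]_n) : Y := a + \sum_(i < n) c 0 i *: b i.
have cphi : continuous phi.
  move=> c; rewrite /continuous_at /phi.
  have h i : (fun c : 'rV[R]_n => c 0 i *: b i) @ c --> c 0 i *: b i.
    by apply: (@cvgZr_tmp _ _ _ (nbhs c)); exact: coord_continuous.
  apply: (@cvgD _ _ _ (nbhs c)); first exact: cvg_cst.
  by apply: (@cvg_big _ _ _ _ _ _ _ (nbhs c)) => //; exact: add_continuous.
pose D : set 'rV[R]_n := [set c | forall i, `[- (r * `|d i|), r * `|d i|]%classic (c ord0 i)].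
have cD : compact D.
  apply: (@rV_compact _ _ (fun i => `[- (r * `|d i|), r * `|d i|]%classic)).
  by move=> i; apply: segment_compact.
have cI : compact (phi @` D).
  by apply: continuous_compact => //; apply: continuous_subspaceT.
apply: subclosed_compact cI _.
  have -> : [set x | `|x - a| <= r] = (fun x => `|x - a|) @^-1` [set t | t <= r] by [].
  apply: closed_comp; last exact: closed_le.
  by move=> x _; apply: cvg_norm; apply: cvgB; [exact: cvg_id|exact: cvg_cst].
move=> x /= xr; exists (\row_i inner (x - a) (d i)).
  move=> i; rewrite /= mxE in_itv/= -ler_norml.
  by apply: (le_trans (norm_inner_le _ _)); rewrite ler_wpM2r.
rewrite /phi (eq_bigr (fun i => inner (x - a) (d i) *: b i)) => [|i _]; last by rewrite mxE.
by rewrite -bE addrC subrK.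
Qed.

Lemma seq_min (T : eqType) (s : seq T) (F : T -> \bar R) (t0 : T) : t0 \in s ->
  exists2 q, q \in s & forall p, p \in s -> (F q <= F p)%E.
Proof.
elim: s t0 => // t s IH t0 _; case: s IH => [|t' s] IH.
  by exists t => [|p]; rewrite ?mem_head// inE => /eqP->.
have [q qs qm] := IH t' (mem_head _ _).
have [tq|qt] := leP (F t) (F q).
  exists t => [|p]; first exact: mem_head.
  by rewrite inE => /orP[/eqP->//|/qm]; apply: le_trans.
exists q => [|p]; first by rewrite inE qs orbT.
by rewrite inE => /orP[/eqP->|/qm//]; apply: ltW.
Qed.

(** Without a minimizer each [p] has a better point [w p] and a real [a p] strictly between f (w p)
    and f p. The open sets where [f] exceeds [a p] cover [A]; in a finite subcover, the best point
    [w q] would be beaten by [w p] for the set that contains it. *)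
Lemma lsc_min (A : set Y) (f : Y -> \bar R) : compact A -> A !=set0 ->
  (forall x, -oo < f x)%E -> lower_semicontinuous f ->
  exists2 p, A p & forall w, A w -> (f p <= f w)%E.
Proof.
move=> cA [a0 Aa0] fNy flsc; apply: contrapT => nomin.
have ex p : A p -> exists w, exists2 a : R, A w & (f w < a%:E < f p)%E.
  move=> Ap; apply: contrapT => H; apply: nomin; exists p => // w Aw.
  rewrite leNgt; apply/negP => wp; apply: H; exists w.
  have := fNy w; case fw : (f w) wp => [s| |]// wp _; last by rewrite ltNge leey in wp.
  case fp : (f p) wp => [t| |]// wp.
    exists ((s + t) / 2) => //; rewrite !lte_fin midf_lt// ?midf_lt//.
  by exists (s + 1) => //; rewrite lte_fin ltrDl ltr01 ltry.
have exw p : exists w, A p -> exists2 a : R, A w & (f w < a%:E < f p)%E.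
  have [Ap|nAp] := pselect (A p); last by exists 0.
  by have [w wP] := ex p Ap; exists w.
have [w wP] := choice exw.
have exa p : exists a : R, A p -> A (w p) /\ (f (w p) < a%:E < f p)%E.
  have [Ap|nAp] := pselect (A p); last by exists 0.
  by have [a ? ?] := wP p Ap; exists a.
have [a aP] := choice exa.
have := cA; rewrite compact_cover => /(_ _ A (fun p => [set y | (a p)%:E < f y]%E)).
case=> [p Ap|p Ap|D DA cov].
- exact: ((lower_semicontinuousP f).1 flsc).
- by exists p => //=; have [_ /andP[]] := aP p Ap.
have [p0 p0D _] := cov a0 Aa0.
have [q qD qmin] := @seq_min _ _ (fun q => f (w q)) _ p0D.
have Aq : A q by apply: set_mem; apply: DA.
have [Awq _] := aP q Aq.
have [p pD /= pq] := cov _ Awq.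
have Ap : A p by apply: set_mem; apply: DA.
have [_ /andP[wpa _]] := aP p Ap.
by have := lt_le_trans (lt_trans wpa pq) (qmin p pD); rewrite ltxx.
Qed.

End FiniteDim.

Lemma le_of_le_add_small {R : realType} (A B C : R) :
  (forall t, 0 < t < 1 -> A <= B + t * C) -> A <= B.
Proof.
move=> H; rewrite leNgt; apply/negP => BA.
pose d := A - B; have d0 : 0 < d by rewrite subr_gt0.
pose t := d / (2 * (d + `|C| + 1)).
have p0 : 0 < 2 * (d + `|C| + 1) by rewrite mulr_gt0// ltr_wpDl// addr_ge0// ltW.
have t01 : 0 < t < 1.
  rewrite divr_gt0//= ltr_pdivrMr// mul1r.
  by have := normr_ge0 C; lra.
have := H t t01; have : t * C <= d / 2.
  rewrite /t mulrAC ler_pdivrMr// (_ : d / 2 * _ = d * (d + `|C| + 1)); last by field.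
  by rewrite ler_pM2l// (le_trans (ler_norm C))//; lra.
by rewrite /d; lra.
Qed.

(** * Sublinear functions *)

Section Sublinear.
Context {R : realType} {Y : finHilbertType R}.
Implicit Types (x y z w k l : Y) (h : Y -> \bar R).

(** For a proper lower semicontinuous sublinear [h] this is the subdifferential at 0, and [h] is its
    support function. *)
Definition linear_minorants h : set Y := [set k | forall w, ((inner k w)%:E <= h w)%E].

Lemma sublinear0 h : (forall x, -oo < h x)%E -> sublinear h -> h 0 = 0%E.
Proof.
move=> hNy [h0 hZ _]; have := hZ 2 0 (ltr0n _ 2); rewrite scaler0.
have := hNy 0; case: (h 0) h0 => [r| |]// _ _; rewrite -EFinM => -[] H.
by congr EFin; lra.
Qed.

(** Lower semicontinuity keeps [h] above -1 on a ball of radius [d] around 0; rescaling a vector to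
    norm d / 2 gives the constant 2 / d. *)
Lemma sublinear_lower_bound h : (forall x, -oo < h x)%E ->
  lower_semicontinuous h -> sublinear h ->
  exists2 c : R, 0 < c & forall w, ((- c * `|w|)%:E <= h w)%E.
Proof.
move=> hNy hl hs; have h0 := sublinear0 hNy hs; case: hs => _ hZ _.
have [|V /nbhs_ballP[d /= d0 dV] Vh] := hl 0 (-1).
  by rewrite h0 lte_fin ltrN10.
exists (2 / d) => [|w]; first by rewrite divr_gt0.
have [->|w0] := eqVneq w 0; first by rewrite normr0 mulr0 h0.
have wp : 0 < `|w| by rewrite normr_gt0.
pose t := d / 2 / `|w|; have t0 : 0 < t by rewrite !divr_gt0.
have : ((-1)%:E < h (t *: w))%E.
  apply/Vh/dV; rewrite -ball_normE /ball_/= sub0r normrN normrZ gtr0_norm//.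
  by rewrite /t divfK ?gt_eqF// ltr_pdivrMr// ltr_pMr// ltr1n.
rewrite hZ//; have := hNy w; case: (h w) => [r| |]// _; last by rewrite leey.
rewrite -EFinM lte_fin lee_fin => H; rewrite -(ler_pM2l t0).
by rewrite (_ : t * _ = -1) ?ltW// /t; field; rewrite !gt_eqF.
Qed.

Lemma lscDfin h (q : Y -> R) : lower_semicontinuous h -> continuous q ->
  (forall x, -oo < h x)%E -> lower_semicontinuous (fun w => h w + (q w)%:E)%E.
Proof.
move=> hl qc hNy x a axh.
have [b ab bh] : exists2 b : R, a < b + q x & (b%:E < h x)%E.
  have := hNy x; case E : (h x) axh => [r| |]// axh _.
    exists ((r + (a - q x)) / 2); rewrite -?EFinD ?lte_fin in axh *; lra.
  by exists (a - q x + 1); rewrite ?ltry//; lra.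
have [V Vx Vb] := hl x b bh.
have qV : \forall y \near x, a - b < q y.
  by apply: (cvgr_gt (q x)); [exact: qc|lra].
exists (V `&` [set y | a - b < q y]); first by apply: filterI.
move=> y [/Vb byh /= qy]; have := hNy y; case: (h y) byh => [r| |]// + _.
  by rewrite -EFinD !lte_fin; lra.
by move=> _; rewrite addye ?ltry.
Qed.

(* The minorant is the gradient of a Moreau regularization of [h] at [z]. *)
Lemma support_sublinear h : (forall x, -oo < h x)%E ->
  lower_semicontinuous h -> sublinear h -> forall z (a : R), (a%:E < h z)%E ->
  exists2 k, linear_minorants h k & a < inner k z.
Proof.
move=> hNy hl hs z a az.
have [c c0 hc] := sublinear_lower_bound hNy hl hs.
have h0 := sublinear0 hNy hs; have [_ hZ hD] := hs.
have [V /nbhs_ballP[e /= e0 eV] Va] := hl z a az.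
(* If the minimizer [p] found below is at distance at least [e] from [z], this [s] makes s |z - p|^2
   outweigh the possible loss c |p| by more than [a]; if it is closer, a < h p by the choice of
   [e]. *)
pose s := (c + (`|a| + c * `|z| + 1) / e) / e.
have cz0 : 0 <= c * `|z| by rewrite mulr_ge0// ltW.
have M0 : 0 < `|a| + c * `|z| + 1 by rewrite ltr_wpDl// addr_ge0.
have s0 : 0 < s by rewrite divr_gt0// addr_gt0// divr_gt0.
pose f w := (h w + (s / 2 * `|w - z| ^+ 2)%:E)%E.
have fNy w : (-oo < f w)%E.
  by rewrite /f; have := hNy w; case: (h w) => // r _; rewrite -EFinD ltNyr.
have fl : lower_semicontinuous f.
  apply: lscDfin => // x; apply: cvgM; first exact: cvg_cst.
  rewrite expr2; under eq_fun do rewrite expr2.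
  by apply: cvgM; apply: cvg_norm; apply: cvgB; [exact: cvg_id|exact: cvg_cst|exact: cvg_id|exact: cvg_cst].
have f0 : f 0 = (s / 2 * `|z| ^+ 2)%:E by rewrite /f h0 add0e sub0r normrN.
pose K := c * `|z| + s / 2 * `|z| ^+ 2.
have K0 : 0 <= K by rewrite addr_ge0// mulr_ge0// ?sqr_ge0// ltW// divr_gt0.
(* Beyond this radius the penalty outweighs the bound -c |w|, so a minimum over the ball is
   global. *)
pose r := 1 + 2 / s * (c + K).
have out w : r < `|w - z| -> (f 0%R < f w)%E.
  move=> rw; rewrite f0 /f; have := hc w; have := hNy w; case: (h w) => [t| |]// _.
    rewrite -EFinD lte_fin lee_fin => ct.
    have dr : 1 <= `|w - z|.
      apply: le_trans (ltW rw); rewrite lerDl mulr_ge0//; last by rewrite addr_ge0// ltW.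
      by rewrite ltW// divr_gt0.
    have wz : `|w| <= `|z| + `|w - z| by rewrite -{1}(subrK z w) addrC ler_normD.
    have cw : c * `|w| <= c * (`|z| + `|w - z|) by rewrite ler_pM2l.
    have sd : c + K < s / 2 * `|w - z|.
      have : s / 2 * r < s / 2 * `|w - z| by rewrite ltr_pM2l// divr_gt0.
      apply: lt_trans; rewrite /r mulrDr mulr1 (_ : s / 2 * (2 / s * _) = c + K).
        by rewrite ltrDr divr_gt0.
      by field; rewrite gt_eqF.
    have : K < `|w - z| * (s / 2 * `|w - z| - c).
      have p : K < s / 2 * `|w - z| - c by lra.
      by apply: (lt_le_trans p); rewrite ler_peMl// ltW// (le_lt_trans _ p).
    by rewrite /K; nra.
  by move=> _; rewrite ltry.
have in0 : `|0 - z| <= r by rewrite leNgt; apply/negP => /out; rewrite ltxx.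
have [p _ pmin0] := lsc_min (@compact_normball R Y z r) (ex_intro _ 0 in0) fNy fl.
have pmin w : (f p <= f w)%E.
  have [|/out/ltW] := leP `|w - z| r; first exact: pmin0.
  by apply: le_trans; exact: pmin0.
have [hp hpE] : exists hp : R, h p = hp%:E.
  have := pmin 0; rewrite f0 /f; have := hNy p; case: (h p) => [t| |]// _ _.
  by exists t.
(* Perturbing the minimizer to p + u v and using subadditivity shows that [mu] is a minorant;
   perturbing it to (1 - u) p and using homogeneity shows h p <= <mu, p>. *)
pose mu := s *: (z - p).
have muh : linear_minorants h mu.
  move=> v; have := hNy v; case hv : (h v) => [t| |]// _; last by rewrite leey.
  rewrite lee_fin; apply: (@le_of_le_add_small _ _ _ (s / 2 * `|v| ^+ 2)) => u /andP[u0 _].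
  have : (f p <= (hp + u * t + s / 2 * `|p - z + u *: v| ^+ 2)%:E)%E.
    apply: (le_trans (pmin (p + u *: v))); rewrite /f addrAC EFinD leeD2r//.
    by apply: (le_trans (hD _ _)); rewrite hpE hZ// hv.
  rewrite /f hpE -EFinD lee_fin (normD_sqr (p - z)) normrZ exprMn gtr0_norm// innerZr.
  rewrite /mu innerZl -(opprB p z) innerNl => H.
  rewrite -(ler_pM2l u0); nra.
have mup : hp <= inner mu p.
  apply: (@le_of_le_add_small _ _ _ (s / 2 * `|p| ^+ 2)) => u /andP[u0 u1].
  have : (f p <= ((1 - u) * hp + s / 2 * `|p - z + u *: - p| ^+ 2)%:E)%E.
    apply: (le_trans (pmin ((1 - u) *: p))); rewrite /f hZ ?subr_gt0// hpE -EFinM -EFinD.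
    by rewrite scalerBl scale1r scalerN addrAC.
  rewrite /f hpE -EFinD lee_fin (normD_sqr (p - z)) normrZ normrN exprMn gtr0_norm// innerZr innerNr.
  rewrite /mu innerZl -(opprB p z) innerNl => H.
  rewrite -(ler_pM2l u0); nra.
exists mu => //.
have -> : inner mu z = inner mu p + s * `|z - p| ^+ 2.
  by rewrite -innerxx -innerZl -innerDr addrC subrK.
have [zpe|ezp] := ltP `|z - p| e.
  have : (a%:E < h p)%E by apply/Va/eV; rewrite -ball_normE.
  rewrite hpE lte_fin => /lt_le_trans; apply; apply: le_trans mup _.
  by rewrite lerDl mulr_ge0// ?sqr_ge0// ltW.
have := hc p; rewrite hpE lee_fin => chp.
have wz : `|p| <= `|z| + `|z - p|.
  by rewrite -{1}(subrK z p) addrC -(normrN (z - p)) opprB ler_normD.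
have cw : c * `|p| <= c * (`|z| + `|z - p|) by rewrite ler_pM2l.
have se : s * e = c + (`|a| + c * `|z| + 1) / e by rewrite /s divfK// gt_eqF.
have sd : c + (`|a| + c * `|z| + 1) / e <= s * `|z - p| by rewrite -se ler_pM2l.
have : (`|a| + c * `|z| + 1) <= `|z - p| * (s * `|z - p| - c).
  rewrite -lerBrDl in sd; rewrite -{1}(divfK (lt0r_neq0 e0) (_ + 1)) mulrC.
  by apply: ler_pM => //; [exact: ltW|rewrite divr_ge0// ltW].
by have := ler_norm a; nra.
Qed.

Lemma linear_minorants_ex h : (forall x, -oo < h x)%E ->
  lower_semicontinuous h -> sublinear h -> exists k, linear_minorants h k.
Proof.
move=> hNy hl hs; have [|k hk _] := @support_sublinear h hNy hl hs 0 (-1).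
  by rewrite sublinear0// lte_fin ltrN10.
by exists k.
Qed.

(** The support property at [l] and at [- l] forces h l = a and h (- l) = - a. Subadditivity for z +
    l and for z = (z + l) - l then leaves no slack. *)
Lemma sublinear_on_constancy_line h l (a : R) : (forall x, -oo < h x)%E ->
  lower_semicontinuous h -> sublinear h ->
  (forall k, linear_minorants h k -> inner k l = a) ->
  h l = a%:E /\ forall z, h (z + l) = (h z + a%:E)%E.
Proof.
move=> hNy hl hs kl; have [k0 hk0] := linear_minorants_ex hNy hl hs.
have one l' b : (forall k, linear_minorants h k -> inner k l' = b) -> h l' = b%:E.
  move=> kl'; apply/eqP; rewrite eq_le; apply/andP; split; last first.
    by rewrite -(kl' k0)//; exact: hk0.
  rewrite leNgt; apply/negP => /(support_sublinear hNy hl hs)[k hk].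
  by rewrite kl'// ltxx.
have hla := one l a kl.
have hnl : h (- l) = (- a)%:E by apply: one => k hk; rewrite innerNr kl.
split=> // z; apply/eqP; rewrite eq_le; apply/andP; split.
  by rewrite -hla; case: hs => _ _; apply.
rewrite -leeBrDr// -EFinN -hnl.
by rewrite -{1}(addrK l z); case: hs => _ _; apply.
Qed.

End Sublinear.

(** * Differential calculus *)

Lemma nbhs_normP {R : realType} {V : normedModType R} (a : V) (P : set V) :
  nbhs a P <-> exists2 d : R, 0 < d & forall z, `|z - a| < d -> P z.
Proof.
split=> [/nbhs_ballP[d /= d0 dP]|[d d0 dP]].
  by exists d => // z za; apply: dP; rewrite -ball_normE /ball_/= distrC.
apply/nbhs_ballP; exists d => //= z; rewrite -ball_normE /ball_/= distrC; exact: dP.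
Qed.

Section Differential.
Context {R : realType} {V W : normedModType R}.
Implicit Types (f g : V -> W) (x : V).

Lemma diff_remainder f x : differentiable f x -> forall e : R, 0 < e ->
  exists2 d : R, 0 < d & forall h, `|h| < d -> `|f (x + h) - f x - 'd f x h| <= e * `|h|.
Proof.
move=> /diff_locallyP[_ /eqaddoP dfx] e e0.
have /nbhs_normP[d d0 dP] := dfx _ e0; exists d => // h hd.
by have := dP h; rewrite subr0 => /(_ hd); rewrite /= !fctE /= (addrC h) opprD addrA.
Qed.

Lemma remainder_diff f x (L : {linear V -> W}) : continuous L ->
  (forall e : R, 0 < e ->
    exists2 d : R, 0 < d & forall h, `|h| < d -> `|f (x + h) - f x - L h| <= e * `|h|) ->
  differentiable f x /\ 'd f x = L :> (V -> W).
Proof.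
move=> cL H.
have E : f \o shift x = cst (f x) + L +o_ (0 : V) id.
  apply/eqaddoP => e e0; have [d d0 dP] := H e e0.
  apply/nbhs_normP; exists d => // h; rewrite subr0 => /dP.
  by rewrite /= !fctE /= (addrC h) opprD addrA.
have dE := diff_unique cL E.
by split=> //; apply/diff_locallyP; rewrite dE.
Qed.

Lemma near_eq_diff f g x : (\forall y \near x, f y = g y) -> differentiable f x ->
  differentiable g x /\ 'd g x = 'd f x :> (V -> W).
Proof.
move=> fg dfx; apply: remainder_diff => [|e e0]; first exact: diff_continuous.
have [d d0 dP] := diff_remainder dfx e0.
have /nbhs_normP[d' d'0 d'P] := fg.
exists (Num.min d d') => [|h]; first by rewrite lt_min d0.
rewrite lt_min => /andP[hd hd'].
have <- : f (x + h) = g (x + h) by apply: d'P; rewrite (addrC x) addrK.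
have <- : f x = g x by apply: d'P; rewrite subrr normr0.
exact: dP.
Qed.

End Differential.

(** * Mean value inequalities *)

Section MeanValue.
Context {R : realType} {V : normedModType R}.

Lemma mean_value_scalar (f : V -> R^o) (x y : V) (c M : R) :
  (forall t : R, 0 <= t <= 1 -> differentiable f (y + t *: (x - y)) /\
     `|('d f (y + t *: (x - y)) (x - y) : R) - c| <= M) ->
  `|(f x : R) - f y - c| <= M.
Proof.
move=> H.
pose p (t : R) := y + t *: (x - y).
pose phi (t : R) : R := f (p t).
have dp (t : R) : is_diff t p (fun s : R => s *: (x - y)).
  apply: is_diff_eq.
  by apply/funext => s; rewrite /= !fctE add0r.
have dphi (t : R) : 0 <= t <= 1 -> is_derive t (1 : R) phi ('d f (p t) (x - y)).
  move=> /H[df _].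
  have dfp : differentiable (f \o p) t by apply: differentiable_comp.
  apply: DeriveDef; first exact: diff_derivable.
  rewrite deriveE// diff_comp//=.
  by rewrite [X in 'd f _ X](_ : _ = x - y)// diff_val scale1r.
have [t t01 E] : exists2 t : R, t \in `]0, 1[ & phi 1 - phi 0 = 'd f (p t) (x - y) * (1 - 0).
  apply: MVT => // [t|].
    by rewrite in_itv/= => /andP[t0 t1]; apply: dphi; rewrite !ltW.
  apply: derivable_within_continuous => t; rewrite in_itv/= => t01.
  by have [] := dphi t t01.
move: E; rewrite subr0 mulr1 /phi /p scale1r scale0r addr0 (addrC y (x - y)) subrK => ->.
by move: t01; rewrite in_itv/= => /andP[t0 t1]; have [|_] := H t; rewrite ?(ltW t0) ?(ltW t1).
Qed.

(** The conclusion of Hahn-Banach, made a property of the space so that one vector mean value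
    inequality covers both [R^o] and Hilbert spaces. *)
Definition norming (W : normedModType R) : Prop := forall w : W,
  exists L : {linear W -> R^o},
    [/\ continuous L, forall u, `|L u : R| <= `|u| & (L w : R) = `|w|].

Lemma norming_real : norming R^o.
Proof.
move=> w; pose f (x : R^o) : R^o := x * Num.sg w.
have lf : linear f by move=> a x y; rewrite /f mulrDl scalerAl.
pose L : {linear R^o -> R^o} := HB.pack f (GRing.isLinear.Build _ _ _ _ _ lf).
exists L; split=> [x|u|].
- by apply: cvgM; [exact: cvg_id|exact: cvg_cst].
- rewrite /L/= /f normrM normr_sg; case: eqP => _; rewrite ?mulr1 ?mulr0//.
- by rewrite /L/= /f normrEsg mulrC.
Qed.

Lemma norming_hilbert (W : finHilbertType R) : norming W.
Proof.
move=> w; have [->|w0] := eqVneq w 0.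
  exists \0; split=> [|u|]; first exact: cst_continuous.
    by rewrite normr0.
  by rewrite normr0.
have wp : 0 < `|w| by rewrite normr_gt0.
pose L : {linear W -> R^o} := HB.pack ((fun u => inner u (`|w|^-1 *: w)) : W -> R^o)
  (GRing.isLinear.Build _ _ _ _ _ (inner_linear (`|w|^-1 *: w))).
exists L; split; first exact: linear_continuous_fin.
  move=> u; apply: le_trans (norm_inner_le _ _) _.
  by rewrite normrZ normfV normr_id mulVf ?mulr1// gt_eqF.
by rewrite /L/= innerZr innerxx expr2 mulKf// gt_eqF.
Qed.

(** The scalar inequality is applied to [f] followed by a functional norming f x - f y - w. Taking w
    = 0 yields Lipschitz bounds, and a value of the differential yields Taylor remainders. *)
Lemma mean_value_bound (W : normedModType R) (f : V -> W) (x y : V) (w : W) (M : R) :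
  norming W ->
  (forall t : R, 0 <= t <= 1 -> differentiable f (y + t *: (x - y)) /\
     `|'d f (y + t *: (x - y)) (x - y) - w| <= M) ->
  `|f x - f y - w| <= M.
Proof.
move=> nW H; set v := f x - f y - w.
have [L [cL Lle Lv]] := nW v.
have := @mean_value_scalar (fun z => L (f z)) x y (L w) M.
rewrite -!linearB -/v Lv normr_id; apply => t t01; have [df dM] := H t t01.
have dL z : differentiable L z by exact: linear_differentiable.
split; first exact: differentiable_comp.
rewrite (_ : 'd _ _ (x - y) = L ('d f (y + t *: (x - y)) (x - y))).
  by rewrite -linearB; apply: le_trans (Lle _) _.
by rewrite (diff_comp (f := f) (g := L))//= diff_lin.
Qed.

End MeanValue.

(** * Calculus of C1 maps *)

Section ContinuousDifferentiability.
Context {R : realType}.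

(** Pointwise convergence of the maps suffices in finite dimension: in a fixed basis the value is a
    finite sum of products of convergent factors. *)
Lemma cvg_linear_app {V : finHilbertType R} {W : normedModType R} (T : Type)
    (F : set_system T) (FF : Filter F) (L : T -> {linear V -> W}) (l : {linear V -> W})
    (v : T -> V) (v0 : V) :
  (forall u, L t u @[t --> F] --> l u) -> v @ F --> v0 ->
  L t (v t) @[t --> F] --> l v0.
Proof.
move=> Ll vv0; have [n [b [d [bE _]]]] := @dual_bases R V.
have E (M : {linear V -> W}) u : M u = \sum_i inner u (d i) *: M (b i).
  by rewrite {1}(bE u) linear_sum; apply: eq_bigr => i _; rewrite linearZ.
rewrite E; under eq_fun do rewrite E.
apply: (@cvg_big _ _ _ _ _ _ _ F) => //; first exact: add_continuous.
by move=> i _; apply: cvgZ => //; apply: cvg_inner => //; exact: cvg_cst.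
Qed.

Section Rules.
Context {V : finHilbertType R}.

Lemma C1_on_intro {W : normedModType R} (O : set V) (f : V -> W) (D : V -> V -> W) :
  open O -> (forall x, O x -> differentiable f x /\ forall v, 'd f x v = D x v) ->
  (forall x v, O x -> D z v @[z --> x] --> D x v) ->
  C1_on O f /\ forall x v, O x -> 'd f x v = D x v.
Proof.
move=> oO dfD cD; split=> [x Ox|x v /dfD[_ ->]]; last by [].
have [df dE] := dfD x Ox; split; first exact: df.
move=> v; rewrite /prop_for /continuous_at dE.
apply: cvg_trans (cD x v Ox); apply: near_eq_cvg.
have nO : \forall y \near x, O y by exact: open_nbhs_nbhs.
by apply: filterS nO => y /dfD[_ ->].
Qed.

Lemma C1_on_eq {W : normedModType R} (O : set V) (f g : V -> W) : open O ->
  (forall x, O x -> f x = g x) -> C1_on O f ->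
  C1_on O g /\ forall x v, O x -> 'd g x v = 'd f x v.
Proof.
move=> oO fg cf; apply: C1_on_intro; first exact: oO.
  move=> x Ox; have [df _] := cf x Ox.
  have nO : \forall y \near x, O y by exact: open_nbhs_nbhs.
  have [dg dE] := near_eq_diff (filterS fg nO) df.
  split; first exact: dg.
  by move=> v; rewrite dE.
by move=> x v Ox; have [_ /(_ v)] := cf x Ox.
Qed.

Lemma C1_on_sub {W : normedModType R} (O O' : set V) (f : V -> W) :
  O' `<=` O -> C1_on O f -> C1_on O' f.
Proof. by move=> sO cf x /sO/cf. Qed.

Lemma C1_on_continuous {W : normedModType R} (O : set V) (f : V -> W) x :
  C1_on O f -> O x -> {for x, continuous f}.
Proof. by move=> cf /cf[df _]; exact: differentiable_continuous. Qed.

Lemma C1_on_cst {W : normedModType R} (O : set V) (w : W) : C1_on O (fun _ : V => w).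
Proof.
move=> x _; split; first exact: differentiable_cst.
move=> v; rewrite (_ : (fun _ => _) = cst 0); first exact: cst_continuous.
by apply/funext => z; have /= -> := congr1 (fun h => h v) (diff_cst w z).
Qed.

Lemma diff_linear_fin {W : normedModType R} (L : {linear V -> W}) x v :
  'd L x v = L v.
Proof.
have cL : continuous L by exact: linear_continuous_fin.
exact: (congr1 (fun h => h v) (diff_lin x cL)).
Qed.

Lemma C1_on_linear {W : normedModType R} (O : set V) (L : {linear V -> W}) : C1_on O L.
Proof.
have cL : continuous L by exact: linear_continuous_fin.
move=> x _; split; first exact: linear_differentiable.
move=> v; rewrite (_ : (fun _ => _) = cst (L v)); first exact: cst_continuous.
by apply/funext => z; exact: diff_linear_fin.
Qed.

Lemma C1_on_comp {V' : finHilbertType R} {W : normedModType R} (O : set V) (O' : set V')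
    (f : V -> V') (g : V' -> W) : C1_on O f -> C1_on O' g ->
  (forall x, O x -> O' (f x)) -> open O ->
  C1_on O (fun x => g (f x)) /\
  forall x v, O x -> 'd (fun x => g (f x)) x v = 'd g (f x) ('d f x v).
Proof.
move=> cf cg fO oO; apply: C1_on_intro; first exact: oO.
  move=> x Ox; have [df _] := cf x Ox; have [dg _] := cg _ (fO x Ox).
  split; first exact: differentiable_comp.
  by move=> v; exact: (congr1 (fun h => h v) (diff_comp df dg)).
move=> x v Ox; have [df cdf] := cf x Ox; have [dg cdg] := cg _ (fO x Ox).
apply: (@cvg_linear_app _ _ _ (nbhs x) _ (fun z => 'd g (f z)) ('d g (f x))); last exact: cdf.
move=> u; apply: (@continuous_cvg _ _ _ _ _ f (fun w => 'd g w u)).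
  exact: cdg.
exact: differentiable_continuous.
Qed.

Lemma C1_on_add {W : normedModType R} (O : set V) (f g : V -> W) :
  C1_on O f -> C1_on O g -> open O ->
  C1_on O (fun x => f x + g x) /\
  forall x v, O x -> 'd (fun x => f x + g x) x v = 'd f x v + 'd g x v.
Proof.
move=> cf cg oO; apply: C1_on_intro; first exact: oO.
  move=> x Ox; have [df _] := cf x Ox; have [dg _] := cg x Ox.
  split; first exact: differentiableD.
  by move=> v; exact: (congr1 (fun h : V -> W => h v) (diffD df dg)).
move=> x v Ox; have [_ cdf] := cf x Ox; have [_ cdg] := cg x Ox.
by apply: cvgD; [exact: cdf|exact: cdg].
Qed.

Lemma C1_on_sum {W : normedModType R} (O : set V) n (f : 'I_n -> V -> W) :
  (forall i, C1_on O (f i)) -> open O ->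
  C1_on O (fun x => \sum_i f i x) /\
  forall x v, O x -> 'd (fun x => \sum_i f i x) x v = \sum_i 'd (f i) x v.
Proof.
elim: n f => [|n IH] f cf oO.
  have -> : (fun x => \sum_(i < 0) f i x) = fun=> 0.
    by apply/funext => x; rewrite big_ord0.
  split=> [|x v _]; first exact: C1_on_cst.
  by rewrite big_ord0; exact: (congr1 (fun h => h v) (diff_cst 0 x)).
have -> : (fun x => \sum_(i < n.+1) f i x) = fun x => f ord0 x + \sum_(i < n) f (lift ord0 i) x.
  by apply/funext => x; rewrite big_ord_recl.
have [cs ds] := IH (fun i => f (lift ord0 i)) (fun i => cf _) oO.
have [ca da] := C1_on_add (cf ord0) cs oO.
split; first exact: ca.
by move=> x v Ox; rewrite big_ord_recl -(ds x v Ox); exact: da.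
Qed.

Lemma C1_on_mul (O : set V) (f g : V -> R^o) :
  C1_on O f -> C1_on O g -> open O ->
  C1_on O (fun x => (f x : R) * (g x : R) : R^o) /\
  forall x v, O x -> 'd (fun x => (f x : R) * (g x : R) : R^o) x v =
    (f x : R) * ('d g x v : R) + (g x : R) * ('d f x v : R) :> R.
Proof.
move=> cf cg oO.
apply: (@C1_on_intro R^o O _ (fun x v => (f x : R) * ('d g x v : R) + (g x : R) * ('d f x v : R))).
- exact: oO.
- move=> x Ox; have [df _] := cf x Ox; have [dg _] := cg x Ox.
  split; first exact: differentiableM.
  by move=> v; exact: (congr1 (fun h => h v) (diffM df dg)).
- move=> x v Ox; have [df cdf] := cf x Ox; have [dg cdg] := cg x Ox.
  apply: cvgD; apply: cvgM.
  + exact: differentiable_continuous.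
  + exact: cdg.
  + exact: differentiable_continuous.
  + exact: cdf.
Qed.

End Rules.
End ContinuousDifferentiability.

(** * Local estimates for C1 and C2 maps *)

Section Estimates.
Context {R : realType} {V : finHilbertType R}.

Lemma segment_norm_ball (a x y : V) (d t : R) : `|x - a| < d -> `|y - a| < d ->
  0 <= t <= 1 -> `|y + t *: (x - y) - a| < d.
Proof.
move=> xd yd /andP[t0 t1].
have -> : y + t *: (x - y) - a = (1 - t) *: (y - a) + t *: (x - a).
  by hilbert_ring.
apply: le_lt_trans (ler_normD _ _) _; rewrite !normrZ (ger0_norm t0) ger0_norm ?subr_ge0//.
have [->|t0'] := eqVneq t 0; first by rewrite subr0 mul1r mul0r addr0.
have tp : 0 < t by rewrite lt0r t0'.
have h1 : (1 - t) * `|y - a| <= (1 - t) * d by rewrite ler_wpM2l ?subr_ge0// ltW.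
have h2 : t * `|x - a| < t * d by rewrite ltr_pM2l.
by lra.
Qed.

(** [S] depends on [V] alone, so closeness of two linear maps on a basis becomes an operator norm
    bound. This is how continuity of the evaluations of a differential is exploited. *)
Lemma linear_bound_basis : exists (n : nat) (b : 'I_n -> V) (S : R), 0 < S /\
  forall (W : normedModType R) (L l : {linear V -> W}) (c : R), 0 <= c ->
  (forall i, `|L (b i) - l (b i)| <= c) -> forall h, `|L h - l h| <= c * S * `|h|.
Proof.
have [n [b [d [bE _]]]] := @dual_bases R V.
exists n, b, (1 + \sum_i `|d i|); split.
  by rewrite ltr_pwDl// sumr_ge0.
move=> W L l c c0 Ll h.
have E (M : {linear V -> W}) u : M u = \sum_i inner u (d i) *: M (b i).
  by rewrite {1}(bE u) linear_sum; apply: eq_bigr => i _; rewrite linearZ.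
rewrite (E L h) (E l h) -sumrB; apply: le_trans (ler_norm_sum _ _ _) _.
rewrite mulrDr mulr1 mulrDl mulr_sumr mulr_suml.
apply: ler_wpDl; first by rewrite mulr_ge0.
apply: ler_sum => i _; rewrite -scalerBr normrZ -mulrA mulrC.
apply: ler_pM => //; rewrite mulrC; exact: norm_inner_le.
Qed.

Lemma C1_on_near {W : normedModType R} (O : set V) (f : V -> W) a : C1_on O f -> O a ->
  forall e : R, 0 < e -> exists2 d : R, 0 < d &
    forall z, `|z - a| < d -> forall h, `|'d f z h - 'd f a h| <= e * `|h|.
Proof.
move=> cf Oa e e0; have [n [b [S [S0 bS]]]] := linear_bound_basis.
have eS0 : 0 < e / S by rewrite divr_gt0.
have : \forall z \near a, forall i, `|'d f z (b i) - 'd f a (b i)| <= e / S.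
  apply: filter_forall => i; have [_ /(_ (b i))] := cf a Oa.
  move=> /cvgrPdist_le/(_ _ eS0); apply: filterS => z; by rewrite distrC.
move=> /nbhs_normP[d d0 dP]; exists d => // z /dP zb h.
have := bS W ('d f z) ('d f a) _ (ltW eS0) zb h.
by rewrite divfK// gt_eqF.
Qed.

Lemma open_norm_ball (O : set V) a : open O -> O a ->
  exists2 d : R, 0 < d & forall z, `|z - a| < d -> O z.
Proof. by move=> oO Oa; apply/nbhs_normP; exact: open_nbhs_nbhs. Qed.

Lemma C1_on_lipschitz {W : normedModType R} (O : set V) (f : V -> W) a : norming W ->
  open O -> O a -> C1_on O f -> exists (d M : R), [/\ 0 < d, 0 < M &
    forall x y, `|x - a| < d -> `|y - a| < d -> `|f x - f y| <= M * `|x - y|].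
Proof.
move=> nW oO Oa cf; have [d1 d10 d1P] := C1_on_near cf Oa ltr01.
have [d2 d20 d2P] := open_norm_ball oO Oa.
have [M M0 MP] := linear_bound ('d f a).
exists (Num.min d1 d2), (M + 1); split; first by rewrite lt_min d10.
  by rewrite addr_gt0.
move=> x y xd yd; rewrite -[f x - f y]subr0; apply: mean_value_bound; first exact: nW.
move=> t t01; have := segment_norm_ball xd yd t01.
set z := y + _; rewrite lt_min => /andP[z1 z2].
have [dfz _] := cf z (d2P _ z2); split; first exact: dfz.
rewrite subr0 -(subrK ('d f a (x - y)) ('d f z (x - y))).
apply: le_trans (ler_normD _ _) _; rewrite mulrDl addrC.
by apply: lerD; [exact: MP|exact: d1P].
Qed.

(** The evaluations of the differential at basis vectors are C1, hence locally Lipschitz, so the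
    differential is Lipschitz in operator norm; the mean value inequality with reference vector 'd f
    y (x - y) concludes. *)
Lemma C2_on_remainder {W : normedModType R} (O : set V) (f : V -> W) a : norming W ->
  open O -> O a -> C2_on O f -> exists (d M : R), [/\ 0 < d, 0 < M &
    forall x y, `|x - a| < d -> `|y - a| < d ->
      `|f x - f y - 'd f y (x - y)| <= M * `|x - y| ^+ 2].
Proof.
move=> nW oO Oa [cf c2]; have [n [b [S [S0 bS]]]] := linear_bound_basis.
have [d2 d20 d2P] := open_norm_ball oO Oa.
have ex (i : 'I_n) : exists dM : R * R, [/\ 0 < dM.1, 0 < dM.2 &
    forall x y, `|x - a| < dM.1 -> `|y - a| < dM.1 ->
    `|'d f x (b i) - 'd f y (b i)| <= dM.2 * `|x - y|].
  by have [d [M dM]] := C1_on_lipschitz nW oO Oa (c2 (b i)); exists (d, M).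
have [dM dMP] := choice ex.
pose M := \sum_i (dM i).2.
have M0 : 0 <= M by apply: sumr_ge0 => i _; have [_ /ltW] := dMP i.
have [d d0 dP] : exists2 d : R, 0 < d & forall i, d <= (dM i).1.
  have : \forall d \near (0 : R)^'+, forall i, d <= (dM i).1.
    by apply: filter_forall => i; apply: nbhs_right_le; have [] := dMP i.
  move=> H; have /filter_ex[d [/= dle d0]] : \forall d \near (0 : R)^'+,
      (forall i, d <= (dM i).1) /\ 0 < d.
    by apply: filterI => //; exact: nbhs_right_gt.
  by exists d.
exists (Num.min d d2), (M * S + 1); split; first by rewrite lt_min d0.
  by rewrite ltr_wpDl// mulr_ge0// ltW.
move=> x y xd yd; apply: mean_value_bound; first exact: nW.
move=> t t01; have := segment_norm_ball xd yd t01.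
move: xd yd; rewrite !lt_min => /andP[x1 x2] /andP[y1 y2].
set z := y + _ => /andP[z1 z2].
have [dfz _] := cf z (d2P _ z2); split; first exact: dfz.
have zy : `|z - y| <= `|x - y|.
  rewrite /z addrC addKr normrZ; have /andP[t0 t1] := t01.
  by rewrite ger0_norm// ler_piMl.
have Mz : 0 <= M * `|z - y| by rewrite mulr_ge0.
have := bS W ('d f z) ('d f y) _ Mz _ (x - y).
move=> H; apply: le_trans (H _) _.
  move=> i; have [_ _ dMi] := dMP i.
  apply: le_trans (dMi _ _ (lt_le_trans z1 (dP i)) (lt_le_trans y1 (dP i))) _.
  rewrite ler_wpM2r// /M (bigD1 i)//= lerDl.
  by apply: sumr_ge0 => j _; have [_ /ltW] := dMP j.
rewrite expr2 mulrA ler_wpM2r//.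
have : M * S * `|z - y| <= M * S * `|x - y| by rewrite ler_wpM2l// mulr_ge0// ltW.
by have := normr_ge0 (x - y); nra.
Qed.

End Estimates.

(** * The inverse function theorem *)

Section InverseFunction.
Context {R : realType} {V : finHilbertType R}.

Lemma injective_endo_inverse (L : {linear V -> V}) : (forall h, L h = 0 -> h = 0) ->
  exists M : {linear V -> V}, forall h, M (L h) = h /\ L (M h) = h.
Proof.
move=> Linj; pose f : 'End(V) := linfun L.
have kf : lker f == 0%VS.
  rewrite -subv0; apply/subvP => v; rewrite memv_ker memv0 lfunE/= => /eqP/Linj->.
  by rewrite eqxx.
exists (f^-1)%VF => h; split.
  by have := lker0_lfunK kf h; rewrite (lfunE L).
by have := lker0_lfunVK kf h; rewrite (lfunE L).
Qed.

Lemma injective_lower_bound (L : {linear V -> V}) : (forall h, L h = 0 -> h = 0) ->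
  exists2 c : R, 0 < c & forall h, c * `|h| <= `|L h|.
Proof.
move=> /injective_endo_inverse[N NP]; have [M M0 MP] := linear_bound N.
exists M^-1 => [|h]; first by rewrite invr_gt0.
by have := MP (L h); have [-> _] := NP h; rewrite ler_pdivrMl.
Qed.

(* Surjectivity near [f a] comes from minimizing [`|f x - y|] over a closed
   ball: by injectivity estimates the minimum is interior, and there the
   surjective differential would allow a strict decrease unless [f x = y]. *)
Lemma inverse_function (O : set V) (f : V -> V) (a : V) : open O -> O a ->
  C1_on O f -> (forall h, 'd f a h = 0 -> h = 0) ->
  exists (A B : set V) (psi : V -> V),
    [/\ [/\ open A, A a & A `<=` O], open B /\ B (f a), C1_on B psi,
        forall y, B y -> A (psi y) /\ f (psi y) = y
      & forall x, A x -> [/\ B (f x), psi (f x) = x &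
          forall h, 'd psi (f x) ('d f x h) = h]].
Proof.
move=> oO Oa cf dinj.
have [c2 c20 c2P] := injective_lower_bound dinj.
(* Half of the injectivity constant at [a] is spent on the variation of the differential; the other
   half survives as a lower bound at nearby points. *)
pose c := c2 / 2; have c0 : 0 < c by rewrite divr_gt0.
have c2E : c2 = c + c by rewrite /c -splitr.
have [d1 d10 d1P] := C1_on_near cf Oa c0.
have [d2 d20 d2P] := open_norm_ball oO Oa.
pose d := Num.min d1 d2; have d0 : 0 < d by rewrite lt_min d10.
have dO z : `|z - a| < d -> O z by rewrite lt_min => /andP[_ /d2P].
have dlow z h : `|z - a| < d -> c * `|h| <= `|'d f z h|.
  rewrite lt_min => /andP[/d1P/(_ h) H _].
  have := c2P h; rewrite c2E mulrDl.
  have : `|'d f a h| <= `|'d f z h| + `|'d f z h - 'd f a h|.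
    rewrite -{1}(subrK ('d f z h) ('d f a h)) addrC (distrC ('d f z h)).
    exact: ler_normD.
  by lra.
have dzinj z : `|z - a| < d -> forall h, 'd f z h = 0 -> h = 0.
  move=> zd h dz0; have := dlow z h zd; rewrite dz0 normr0.
  by rewrite pmulr_rle0// normr_le0 => /eqP.
have flow x y : `|x - a| < d -> `|y - a| < d -> c * `|x - y| <= `|f x - f y|.
  move=> xd yd.
  have : `|f x - f y - 'd f a (x - y)| <= c * `|x - y|.
    apply: mean_value_bound; first exact: norming_hilbert.
    move=> t t01; have zd := segment_norm_ball xd yd t01.
    have [dfz _] := cf _ (dO _ zd); split; first exact: dfz.
    by apply: d1P; move: zd; rewrite lt_min => /andP[].
  have := c2P (x - y); rewrite c2E mulrDl.
  have : `|'d f a (x - y)| <= `|f x - f y| + `|f x - f y - 'd f a (x - y)|.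
    rewrite -{1}(subrK (f x - f y) ('d f a (x - y))) addrC (distrC (f x - f y)).
    exact: ler_normD.
  by lra.
have fcont x : `|x - a| < d -> {for x, continuous f}.
  by move=> /dO; exact: C1_on_continuous.
pose r := d / 2; have r0 : 0 < r by rewrite divr_gt0.
have rd : r < d by rewrite ltr_pdivrMr// ltr_pMr// ltr1n.
(* With this radius, a minimizer [p] at distance [r] from [a] would give c r <= |f p - f a| <= 2 |f
   a - y| < c r. *)
pose B := [set y | `|y - f a| < c * r / 2].
have crp : 0 < c * r / 2 by rewrite divr_gt0// mulr_gt0.
have surj y : B y -> exists2 x, `|x - a| < r & f x = y.
  rewrite /B/= => yB; pose D := [set x | `|x - a| <= r].
  have Dc : compact D by exact: compact_normball.
  have Da : D a by rewrite /D/= subrr normr0 ltW.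
  have [|p /set_mem/= Dp pmin] := compact_EVT_min (f := fun x => `|f x - y|) (ex_intro _ a Da) Dc.
    apply: continuous_in_subspaceT => x /set_mem/= xr.
    apply: cvg_norm; apply: cvgB; last exact: cvg_cst.
    exact: fcont (le_lt_trans xr rd).
  have pa : `|f p - y| <= `|f a - y| by apply: pmin; exact/mem_set.
  have pd : `|p - a| < d := le_lt_trans Dp rd.
  have pr : `|p - a| < r.
    rewrite lt_neqAle Dp andbT; apply/eqP => E.
    have := flow p a pd; rewrite subrr normr0 d0 E => /(_ isT).
    have := ler_distD y (f p) (f a); rewrite (distrC y).
    move: pa yB; rewrite (distrC y); lra.
  exists p => //; apply/eqP; rewrite -subr_eq0; apply/eqP.
  apply: contrapT => /eqP rho0; set rho := f p - y in rho0.
  have rp : 0 < `|rho| by rewrite normr_gt0.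
  have [N NP] := injective_endo_inverse (dzinj p pd).
  (* The Newton direction: moving by t h turns the residual [rho] into (1 - t) rho up to an error of
     t |rho| / 2, a strict decrease. *)
  pose h := N (- rho); have [_ hE] := NP (- rho).
  have h0 : 0 < `|h|.
    rewrite normr_gt0; apply/eqP => h0; move: hE; rewrite -/h h0 linear0 => /esym/eqP.
    by rewrite oppr_eq0 (negPf rho0).
  have [dfp _] := cf p (dO p pd).
  have e0 : 0 < `|rho| / `|h| / 2 by rewrite !divr_gt0.
  have [d' d'0 d'P] := diff_remainder dfp e0.
  pose t := Num.min 1 (Num.min (d' / `|h| / 2) ((r - `|p - a|) / `|h| / 2)).
  have t0 : 0 < t by rewrite !lt_min ltr01/= !divr_gt0// subr_gt0.
  have t1 : t <= 1 by rewrite ge_min lexx.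
  have td' : `|t *: h| < d'.
    rewrite normrZ gtr0_norm// -ltr_pdivlMr//.
    have : t <= d' / `|h| / 2 by rewrite !ge_min lexx orbT.
    by move=> /le_lt_trans; apply; rewrite ltr_pdivrMr// ltr_pMr ?divr_gt0// ltr1n.
  have tr : `|t *: h| <= r - `|p - a|.
    rewrite normrZ gtr0_norm// -ler_pdivlMr//.
    have : t <= (r - `|p - a|) / `|h| / 2 by rewrite !ge_min lexx !orbT.
    by move=> /le_trans; apply; rewrite ler_pdivrMr// ler_peMr ?ler1n// ltW// divr_gt0// subr_gt0.
  have Dpt : D (p + t *: h).
    rewrite /D/= addrAC; apply: le_trans (ler_normD _ _) _; lra.
  have := pmin _ (mem_set Dpt); apply/negP; rewrite -ltNge.
  have := d'P _ td'; rewrite linearZ hE.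
  have -> : f (p + t *: h) - y = (f (p + t *: h) - f p - t *: (- rho)) + (1 - t) *: rho.
    by rewrite /rho; hilbert_ring.
  move=> H; apply: le_lt_trans (ler_normD _ _) _.
  rewrite [`|(1 - t) *: rho|]normrZ (ger0_norm (_ : 0 <= 1 - t)) ?subr_ge0//.
  move: H; rewrite normrZ (gtr0_norm t0).
  have -> : `|rho| / `|h| / 2 * (t * `|h|) = t * `|rho| / 2 by field; rewrite gt_eqF.
  have := mulr_gt0 t0 rp; rewrite -/rho; lra.
have [psi psiP] : exists psi : V -> V, forall y, B y -> `|psi y - a| < r /\ f (psi y) = y.
  have ex y : exists x, B y -> `|x - a| < r /\ f x = y.
    have [By|nBy] := pselect (B y); last by exists a.
    by have [x ? ?] := surj y By; exists x.
  by have [psi ?] := choice ex; exists psi.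
have psid y : B y -> `|psi y - a| < d.
  by move=> /psiP[+ _]; move=> /lt_trans; apply.
pose A := [set x | `|x - a| < r] `&` f @^-1` B.
have oB : open B.
  have -> : B = (fun y => `|y - f a|) @^-1` [set s | s < c * r / 2] by [].
  apply: open_comp; last exact: open_lt.
  by move=> y _; apply: cvg_norm; apply: cvgB; [exact: cvg_id|exact: cvg_cst].
have oA : open A.
  rewrite openE => x [/= xr Bfx]; apply: filterI.
    have : open [set z : V | `|z - a| < r].
      have -> : [set z : V | `|z - a| < r] = (fun y => `|y - a|) @^-1` [set s | s < r] by [].
      apply: open_comp; last exact: open_lt.
      by move=> y _; apply: cvg_norm; apply: cvgB; [exact: cvg_id|exact: cvg_cst].
    by move=> ob; apply: open_nbhs_nbhs; split.
  by apply: (fcont x (lt_trans xr rd)); apply: open_nbhs_nbhs; split.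
have Bfa : B (f a) by rewrite /B/= subrr normr0.
have Aa : A a by split=> //=; rewrite subrr normr0.
have psif x : A x -> psi (f x) = x.
  move=> [/= xr Bfx]; have [pr pf] := psiP _ Bfx.
  have := flow _ _ (lt_trans pr rd) (lt_trans xr rd).
  rewrite pf subrr normr0 pmulr_rle0// normr_le0 subr_eq0 => /eqP; exact.
have psilip y y' : B y -> B y' -> c * `|psi y - psi y'| <= `|y - y'|.
  move=> By By'; have := flow _ _ (psid y By) (psid y' By').
  by have [_ ->] := psiP y By; have [_ ->] := psiP y' By'.
have invL x : `|x - a| < d -> exists L : {linear V -> V}, forall h, L ('d f x h) = h /\ 'd f x (L h) = h.
  by move=> /dzinj/injective_endo_inverse.
have ex y : exists L : {linear V -> V}, B y -> forall h, L ('d f (psi y) h) = h /\ 'd f (psi y) (L h) = h.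
  have [By|nBy] := pselect (B y); last by exists idfun.
  by have [L LP] := invL _ (psid y By); exists L.
have [L LP] := choice ex.
have [C1psi dpsi] : C1_on B psi /\ forall y v, B y -> 'd psi y v = L y v.
  apply: C1_on_intro; first exact: oB.
    move=> y By.
    have cL : continuous (L y) by exact: linear_continuous_fin.
    have [d' d'0 d'P] := open_norm_ball oB By.
    have xd := psid y By; have [_ fx] := psiP y By; have LPy := LP y By.
    set x := psi y in xd fx LPy.
    have [dfx _] := cf x (dO x xd).
    have [|dd dE] := @remainder_diff R V V psi y (L y) cL.
    (* One factor [c] pays for inverting the differential, the other for the Lipschitz bound c |u|
       <= |k|. *)
    - move=> e e0; pose e' := e * c * c.
      have e'0 : 0 < e' by rewrite !mulr_gt0.
      have [d'' d''0 d''P] := diff_remainder dfx e'0.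
      exists (Num.min d' (c * d'')) => [|k]; first by rewrite lt_min d'0 mulr_gt0.
      rewrite lt_min => /andP[kd' kd''].
      have Byk : B (y + k) by apply: d'P; rewrite addrC addKr.
      pose u := psi (y + k) - x.
      have uk : c * `|u| <= `|k|.
        by have := psilip _ _ Byk By; rewrite -/x -/u addrC addKr.
      have ud : `|u| < d'' by rewrite -(ltr_pM2l c0); exact: le_lt_trans uk kd''.
      have := d''P _ ud.
      have -> : x + u = psi (y + k) by rewrite /u addrC subrK.
      have [_ ->] := psiP _ Byk; rewrite fx.
      have -> : y + k - y = k by rewrite addrC addKr.
      rewrite -/x -/u; set w := k - 'd f x u => wle.
      have -> : u - L y k = - L y w.
        rewrite /w linearB opprB; congr (_ - _).
        by have [->] := LPy u.
      rewrite normrN.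
      have := dlow x (L y w) xd; have [_ ->] := LPy w => lw.
      rewrite -(ler_pM2l c0); apply: le_trans lw _; apply: le_trans wle _.
      rewrite (_ : e' * `|u| = c * (e * (c * `|u|))); last by rewrite /e'; ring.
      by rewrite ler_pM2l// ler_pM2l.
    - by split; [exact: dd|move=> v; rewrite dE].
  move=> y v By.
  have cpsi : psi @ y --> psi y.
    apply/cvgrPdist_le => e e0.
    have [d' d'0 d'P] := open_norm_ball oB By.
    apply/nbhs_normP; exists (Num.min d' (c * e)); first by rewrite lt_min d'0 mulr_gt0.
    move=> z; rewrite lt_min => /andP[/d'P Bz zy].
    by rewrite -(ler_pM2l c0); apply: le_trans (psilip _ _ By Bz) _; rewrite distrC ltW.
  have [_ cdf] := cf _ (dO _ (psid y By)).
  have : 'd f (psi z) (L y v) @[z --> y] --> v.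
    have -> : nbhs v = nbhs ('d f (psi y) (L y v)) by have [_ ->] := LP y By v.
    apply: (@continuous_cvg _ _ _ _ _ psi (fun w => 'd f w (L y v))); first exact: cdf.
    exact: cpsi.
  (* Since v = 'd f (psi z) (L z v), the lower bound on 'd f (psi z) turns the convergence of 'd f
     (psi z) (L y v) to [v] into that of L z v to L y v. *)
  move=> /cvgrPdist_le H; apply/cvgrPdist_le => e e0.
  have := H _ (mulr_gt0 c0 e0).
  have nB : \forall z \near y, B z by exact: open_nbhs_nbhs.
  apply: filter_app; apply: filterS nB => z Bz.
  have [_ zE] := LP z Bz v.
  rewrite -{1}zE -linearB => H1; rewrite -(ler_pM2l c0); apply: le_trans H1.
  by rewrite distrC; apply: dlow; exact: psid.
exists A, B, psi; split=> //.
- by split=> // x [/= xr _]; apply: dO; exact: lt_trans xr rd.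
- move=> y By; have [pr pf] := psiP y By; split=> //; split=> //=.
  by rewrite /preimage/= pf.
- move=> x Ax; have [_ Bfx] := Ax; split=> //; first exact: psif.
  move=> h; rewrite dpsi//; have := LP _ Bfx h; rewrite psif//.
  by case.
Qed.

End InverseFunction.

Section SmoothRules.
Context {R : realType} {V : finHilbertType R}.

Lemma C1_on_id (O : set V) : C1_on O (fun x : V => x).
Proof. exact: (@C1_on_linear R V V O (idfun : {linear V -> V})). Qed.

Lemma diff_id_fin (x v : V) : 'd (fun x : V => x) x v = v.
Proof. exact: (diff_linear_fin (idfun : {linear V -> V})). Qed.

Lemma C1_on_linear_comp {V' : finHilbertType R} {W : normedModType R} (O : set V)
    (f : V -> V') (L : {linear V' -> W}) : open O -> C1_on O f ->
  C1_on O (fun x => L (f x)) /\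
  forall x v, O x -> 'd (fun x => L (f x)) x v = L ('d f x v).
Proof.
move=> oO cf.
have [c dE] := C1_on_comp cf (@C1_on_linear R V' W setT L) (fun _ _ => I) oO.
by split; [exact: c|move=> x v Ox; rewrite dE// diff_linear_fin].
Qed.

Definition innerl (y : V) : {linear V -> R^o} := HB.pack ((fun x => inner x y) : V -> R^o)
  (GRing.isLinear.Build _ _ _ _ _ (inner_linear y)).

Lemma innerlE y x : innerl y x = inner x y.
Proof. by []. Qed.

(** The direction may vary with the step, because tangent vectors of an epigraph are limits of such
    moving directions. *)
Lemma cvg_diff_quotient {W : normedModType R} (f : V -> W) (u : V)
    (t : nat -> R) (d : nat -> V) (d0 : V) :
  differentiable f u -> (forall s, 0 < t s) -> t @ \oo --> 0 -> d @ \oo --> d0 ->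
  (t s)^-1 *: (f (u + t s *: d s) - f u) @[s --> \oo] --> 'd f u d0.
Proof.
move=> df t0 tF dF.
have cd : 'd f u (d s) @[s --> \oo] --> 'd f u d0.
  by apply: (@continuous_cvg _ _ _ _ _ d ('d f u)); [exact: diff_continuous|exact: dF].
pose M := `|d0| + 1; have M0 : 0 < M by rewrite ltr_wpDl.
have dM : \forall s \near \oo, `|d s| < M.
  have nd : `|d s| @[s --> \oo] --> `|d0| by exact: cvg_norm.
  by apply: (cvgr_lt _ nd); rewrite ltrDl.
have td : t s *: d s @[s --> \oo] --> (0 : V) by rewrite -(scale0r d0); exact: cvgZ.
have small e : 0 < e -> \forall s \near \oo,
    `|(t s)^-1 *: (f (u + t s *: d s) - f u) - 'd f u (d s)| <= e.
  move=> e0; have eM : 0 < e / M by rewrite divr_gt0.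
  have [r r0 rP] := diff_remainder df eM.
  have tr : \forall s \near \oo, `|t s *: d s| < r.
    by move/cvgrPdist_lt: td => /(_ _ r0); apply: filterS => s; rewrite sub0r normrN.
  apply: filterS2 dM tr => s ds /rP; rewrite linearZ/= => H.
  rewrite -(ler_pM2l (t0 s)) -{1}(gtr0_norm (t0 s)) -normrZ scalerBr scalerA.
  rewrite mulfV ?gt_eqF// scale1r; apply: le_trans H _.
  rewrite normrZ gtr0_norm// mulrCA ler_pM2l// mulrAC ler_pdivrMr//.
  by rewrite ler_pM2l// ltW.
apply/cvgrPdist_le => e e0; have e20 : 0 < e / 2 by rewrite divr_gt0.
move/cvgrPdist_le: cd => /(_ _ e20) cd.
apply: filterS2 (small _ e20) cd => s s1 s2.
rewrite -(subrK ('d f u (d s)) ('d f u d0)) -addrA [e]splitr.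
apply: le_trans (ler_normD _ _) _; apply: lerD => //.
by rewrite distrC.
Qed.

End SmoothRules.

(** * Smoothness of the envelope from that of the prox *)

Section Envelope.
Context {R : realType} {Y : finHilbertType R}.

(** The gradient of the envelope is (z - p z) / gamma. Differentiability comes from two one-sided
    comparisons, each testing the objective at one point with the prox of the other, and from
    continuity of [p]; the formula then makes the gradient as smooth as [p]. *)
Lemma prox_C1_envelope_C2 (g : Y -> \bar R) (gamma : R) (x : Y) : 0 < gamma ->
  (forall w, -oo < g w)%E -> prox_C1_around gamma g x -> envelope_C2_around gamma g x.
Proof.
move=> g0 gNy [W [p [[oW Wx] proxE cp]]].
pose s := (2 * gamma)^-1; have s0 : 0 < s by rewrite invr_gt0 mulr_gt0.
have pP z : W z -> (exists r, g (p z) = r%:E) /\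
    forall w, (moreau_objective gamma g z (p z) <= moreau_objective gamma g z w)%E.
  move=> Wz; have : prox gamma g z (p z) by rewrite proxE.
  case; rewrite /moreau_objective => fin H; split; last exact: H.
  have := gNy (p z); move: fin; case: (g (p z)) => [r| |]// _ _; first by exists r.
have envE z : W z -> envelope gamma g z = moreau_objective gamma g z (p z).
  move=> Wz; apply/eqP; rewrite eq_le; apply/andP; split.
    by apply: ereal_inf_lbound; exists (p z).
  by apply: le_ereal_inf_tmp => _ [w _ <-]; have [_] := pP z Wz; apply.
have gpE z : W z -> g (p z) = (fine (g (p z)))%:E.
  by move=> /pP[[r ->] _].
pose E z : R^o := fine (envelope gamma g z).
have EE z : W z -> E z = fine (g (p z)) + s * `|p z - z| ^+ 2.
  by move=> Wz; rewrite /E envE// /moreau_objective gpE.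
have Ele z z' : W z -> W z' -> E z' <= fine (g (p z)) + s * `|p z - z'| ^+ 2.
  move=> Wz Wz'; have [_ /(_ (p z))] := pP z' Wz'.
  rewrite -envE// /moreau_objective gpE// -EFinD -lee_fin; apply: le_trans.
  by rewrite /E envE// /moreau_objective (gpE z').
pose D z : {linear Y -> R^o} := innerl (gamma^-1 *: (z - p z)).
have pc z : W z -> {for z, continuous p} by exact: C1_on_continuous.
have cD z v : W z -> D y v @[y --> z] --> D z v.
  move=> Wz; apply: cvg_inner; first exact: cvg_cst.
  by apply: cvgZl_tmp; apply: cvgB; [exact: cvg_id|exact: pc].
have [c1 dE] : C1_on W E /\ forall z v, W z -> 'd E z v = D z v.
  apply: C1_on_intro; [exact: oW| |exact: cD].
  move=> z Wz; have cl : continuous (D z) by exact: linear_continuous_fin.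
  have [|dfE dEE] := @remainder_diff R Y R^o E z (D z) cl; last by split=> // v; rewrite dEE.
  move=> e e0.
  have [d1 d10 d1P] := open_norm_ball oW Wz.
  have ge0 : 0 < gamma * (e / 2) by rewrite mulr_gt0// divr_gt0.
  have /nbhs_normP[d2 d20 d2P] : \forall y \near z, `|p z - p y| <= gamma * (e / 2).
    by have /cvgrPdist_le/(_ _ ge0) := pc z Wz.
  exists (Num.min d1 (Num.min d2 (e / 2 / s))).
    by rewrite !lt_min d10 d20 !divr_gt0.
  move=> h; rewrite !lt_min => /and3P[h1 h2 h3].
  have Wh : W (z + h) by apply: d1P; rewrite addrC addKr.
  have ph : `|p z - p (z + h)| <= gamma * (e / 2) by apply: d2P; rewrite addrC addKr.
  have up := Ele z (z + h) Wz Wh; have lo := Ele (z + h) z Wh Wz.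
  have E1 := EE z Wz; have E2 := EE (z + h) Wh.
  have n1 : `|p z - (z + h)| ^+ 2 = `|p z - z| ^+ 2 - 2 * inner (p z - z) h + `|h| ^+ 2.
    by rewrite -normB_sqr opprD addrA.
  have n2 : `|p (z + h) - z| ^+ 2 =
      `|p (z + h) - (z + h)| ^+ 2 + 2 * inner (p (z + h) - (z + h)) h + `|h| ^+ 2.
    by rewrite -normD_sqr; congr (`|_| ^+ 2); hilbert_ring.
  have ip : `|inner (p z - p (z + h)) h| <= gamma * (e / 2) * `|h|.
    by apply: le_trans (norm_inner_le _ _) _; rewrite ler_wpM2r.
  have hs : s * `|h| ^+ 2 <= e / 2 * `|h|.
    by rewrite expr2 mulrA ler_wpM2r// mulrC -ler_pdivlMr// ltW.
  have sg : s * 2 * gamma = 1 by rewrite /s; field; rewrite gt_eqF.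
  have DE : D z h = s * 2 * inner (z - p z) h.
    rewrite /D innerlE innerZr innerC; congr (_ * _).
    by rewrite /s; field; rewrite gt_eqF.
  rewrite [leLHS](_ : _ = `|(E (z + h) : R) - E z - D z h|)//.
  move: ip; rewrite !innerE in up lo n1 n2 DE *.
  rewrite ler_norml => /andP[ip1 ip2].
  have s2 : 0 < s * 2 by rewrite mulr_gt0.
  have k1 : s * 2 * (inner (p z) h - inner (p (z + h)) h) <= e / 2 * `|h|.
    rewrite (_ : e / 2 * `|h| = s * 2 * (gamma * (e / 2) * `|h|)).
      by rewrite ler_pM2l.
    by rewrite !mulrA sg mul1r.
  have k2 : - (e / 2 * `|h|) <= s * 2 * (inner (p z) h - inner (p (z + h)) h).
    rewrite (_ : - (e / 2 * `|h|) = s * 2 * - (gamma * (e / 2) * `|h|)).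
      by rewrite ler_pM2l.
    by rewrite mulrN !mulrA sg mul1r.
  have hh : inner h h = `|h| ^+ 2 by exact: innerxx.
  have sh : 0 <= s * `|h| ^+ 2 by rewrite mulr_ge0 ?sqr_ge0// ltW.
  rewrite n1 in up; rewrite n2 in lo.
  by rewrite DE ler_norml; apply/andP; split; nra.
exists W; split; first by split.
  by move=> z Wz; rewrite envE// /moreau_objective gpE.
split; first exact: c1.
move=> v.
have cid : C1_on W (fun z : Y => z) by exact: C1_on_id.
have [cn _] := C1_on_linear_comp ( *:%R (-1) : {linear Y -> Y}) oW cp.
have [cf _] := C1_on_add cid cn oW.
have [cg _] := C1_on_linear_comp (innerl (gamma^-1 *: v)) oW cf.
have [] // := C1_on_eq (g := fun z => 'd E z v) oW _ cg => z Wz; rewrite dE// /D !innerlE !innerZr.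
by rewrite (innerC v) !innerE mulN1r.
Qed.

End Envelope.

(** * The chain rule for limiting subgradients *)

Section SubdifferentialChain.
Context {R : realType} {Y : finHilbertType R}.
Variables (g : Y -> \bar R) (u : Y) (O : set Y) (q : Y -> R^o) (Phi : Y -> Y)
  (h : Y -> \bar R).
Hypotheses (oO : open O) (Ou : O u) (cq : C1_on O q) (cPhi : C1_on O Phi)
  (Phiu : Phi u = 0) (dPhi : forall v, 'd Phi u v = v)
  (hNy : forall z, (-oo < h z)%E) (hs : sublinear h)
  (gu : g u \is a fin_num)
  (gE : forall w, O w -> g w = (g u + (q w : R)%:E + h (Phi w))%E).

Let q0 : (q u : R) = 0.
Proof.
have := gE Ou; rewrite Phiu (sublinear0 hNy hs) adde0 -(fineK gu) -EFinD => -[] H.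
by rewrite -(addrK (fine (g u)) (q u)) [X in X - _]addrC -H subrr.
Qed.

(** [v] even gives a regular normal at the point itself, so constant sequences do. The C1 function
    [F] has F u = 0 and differential <v, .> at [u], and it lies below g - g u near [u] because [v]
    is a minorant. *)
Lemma minorant_subdiff (v : Y) :
  linear_minorants (fun z => h z + ('d q u z : R)%:E)%E v -> subdiff g u v.
Proof.
move=> vP; split; first exact: gu.
exists (fun=> (u, fine (g u) : R^o)), (fun=> (v, -1 : R^o)); split.
- by move=> n; rewrite /epi/= fineK.
- exact: cvg_cst.
- move=> _ w [t [w_ [t0 tcvg wS wcvg]]].
  pose d_ n : Y := (w_ n).1; pose e_ n : R := (w_ n).2; pose w1 : Y := w.1.
  have c1 : d_ @ \oo --> w1 by exact: (cvg_comp _ _ wcvg cvg_fst).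
  have c2 : e_ @ \oo --> (w.2 : R) by exact: (cvg_comp _ _ wcvg cvg_snd).
  pose l : {linear Y -> R^o} := innerl v.
  pose F (a : Y) : R^o := q a + (l (Phi a) - 'd q u (Phi a)).
  have l0 : l 0 = 0 by exact: linear0.
  have dq0 : 'd q u (0 : Y) = 0 by exact: linear0.
  have Fu : F u = 0 by rewrite /F Phiu l0 dq0 subr0 addr0; exact: q0.
  pose m : {linear Y -> R^o} := (l \- 'd q u).
  have [cm dm] := C1_on_linear_comp m oO cPhi.
  have [cF dF] := C1_on_add cq cm oO.
  have Fw : 'd F u w1 = inner v w1.
    rewrite /F (dF u w1 Ou) (dm u w1 Ou) dPhi /m /= innerC.
    by rewrite addrC subrK.
  have [dFu _] := cF u Ou.
  have Fc := cvg_diff_quotient dFu t0 tcvg c1.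
  have le : \forall n \near \oo, ((t n)^-1 *: (F (u + t n *: (d_ n)) - F u) : R) <= e_ n.
    have ac : u + t n *: (d_ n) @[n --> \oo] --> u.
      rewrite -[X in _ --> X]addr0 -(scale0r w1).
      by apply: cvgD; [exact: cvg_cst|exact: cvgZ].
    have nO : \forall n \near \oo, O (u + t n *: (d_ n)).
      by apply: ac; exact: open_nbhs_nbhs.
    apply: filterS nO => n On.
    have [z zepi zE] := wS n; have tn := t0 n.
    have z1 : z.1 = u + t n *: (d_ n).
      by rewrite /d_ /e_ -zE/= scalerA mulfV ?gt_eqF// scale1r addrC subrK.
    have z2 : (z.2 : R) = fine (g u) + t n * e_ n.
      rewrite /d_ /e_ -zE/= -[(t n)^-1 *: _]/((t n)^-1 * _) mulrA mulfV ?gt_eqF// mul1r.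
      by rewrite addrC subrK.
    move: zepi; rewrite /epi/= z1 z2 gE// => zepi.
    set a := u + _ in zepi On *.
    have := vP (Phi a); have := hNy (Phi a); move: zepi.
    case: (h (Phi a)) => [s| |]// zepi _ vs; last first.
      by move: zepi; rewrite -(fineK gu) -EFinD.
    move: zepi vs; rewrite -(fineK gu) -!EFinD !lee_fin/= => zepi vs.
    rewrite Fu subr0 -[_ *: _]/((t n)^-1 * _) ler_pdivrMl//.
    rewrite /F /l innerlE innerC; lra.
  rewrite /inner_epi/= mulN1r -/w1 -Fw subr_le0.
  exact: (ler_cvg_to Fc c2 le).
- exact: cvg_cst.
Qed.

(** Moving [Phi] in direction [z] raises [h] at rate at most r = h z, by subadditivity and
    homogeneity. This gives a tangent vector of the epigraph at every [x_ n] close enough to the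
    limit, and the inequalities of normality pass to the limit. *)
Lemma subdiff_minorant (v : Y) :
  subdiff g u v -> linear_minorants (fun z => h z + ('d q u z : R)%:E)%E v.
Proof.
move=> [_ [x_ [v_ [xepi xc vreg vc]]]] z.
have := hNy z; case hz : (h z) => [r| |]// _; last by rewrite leey.
rewrite -EFinD lee_fin.
have [h0 hZ hD] := hs.
have inj a : 'd Phi u a = 0 -> a = 0 by rewrite dPhi.
have [A [B [psi [[oA Au AO] [oB B0] cpsi psiP Apsi]]]] :=
  inverse_function oO Ou cPhi inj.
rewrite Phiu in B0.
pose xa n : Y := (x_ n).1; pose va n : Y := (v_ n).1; pose vb n : R := (v_ n).2.
have x1 : xa @ \oo --> u by exact: (cvg_comp _ _ xc cvg_fst).
have v1 : va @ \oo --> v by exact: (cvg_comp _ _ vc cvg_fst).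
have v2 : vb @ \oo --> (-1 : R) by exact: (cvg_comp _ _ vc cvg_snd).
pose w n : Y := 'd psi (Phi (xa n)) z.
have nA : \forall n \near \oo, A (xa n) by apply: x1; exact: open_nbhs_nbhs.
have key : \forall n \near \oo, inner (va n) (w n) +
    vb n * (('d q (xa n) (w n) : R) + r) <= 0.
  apply: filterS nA => n An; set a := xa n in An *; set y := Phi a.
  have [By psiy _] := Apsi a An.
  have Oa := AO a An.
  have := xepi n; rewrite /epi/= -/(xa n) -/a gE// -/y => epin.
  have [s hy] : exists s : R, h y = s%:E.
    have := hNy y; move: epin; case: (h y) => [s| |]// epin _; first by exists s.
    by move: epin; rewrite -(fineK gu) -EFinD.
  move: epin; rewrite hy -(fineK gu) -!EFinD lee_fin => epin.
  pose sn : R := (x_ n).2.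
  apply: (vreg n (w n, (('d q a (w n) : R) + r) : R^o)).
  have [d d0 dP] := open_norm_ball oB By.
  (* Scaled so that y + t m *: z lies in [B] for every index [m], as [outer_limit0] demands, and not
     just eventually. *)
  pose k := d / (`|z| + 1); have z1p : 0 < `|z| + 1 by rewrite ltr_wpDl.
  have k0 : 0 < k by rewrite divr_gt0.
  pose t (m : nat) : R := k * (m.+1%:R)^-1.
  have t0 m : 0 < t m by rewrite mulr_gt0// invr_gt0 ltr0n.
  have tc : t m @[m --> \oo] --> 0.
    by rewrite -(mulr0 k); apply: cvgM; [exact: cvg_cst|exact: cvg_harmonic].
  have Bt m : B (y + t m *: z).
    apply: dP; rewrite addrC addKr normrZ gtr0_norm//.
    have tk : t m <= k by apply: ler_piMr; [exact: ltW|rewrite invf_le1 ?ltr0n// ler1n].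
    apply: le_lt_trans (ler_wpM2r (normr_ge0 z) tk) _.
    by rewrite /k mulrAC ltr_pdivrMr// ltr_pM2l// ltrDl.
  pose X m := psi (y + t m *: z).
  (* The heights start from [sn], since the epigraph point may lie strictly above the graph. *)
  pose S m : R := sn + ((q (X m) : R) - q a) + t m * r.
  exists t, (fun m => (t m)^-1 *: ((X m, S m : R^o) - x_ n)); split.
  - exact: t0.
  - exact: tc.
  - move=> m; exists (X m, S m : R^o) => //=.
    have [AX PX] := psiP _ (Bt m).
    rewrite /epi/= gE; last exact: AO.
    rewrite -/(X m) in PX; rewrite PX.
    apply: (@le_trans _ _ (g u + ((q (X m) : R)%:E) + (s%:E + (t m * r)%:E))%E).
      by rewrite leeD2l// (le_trans (hD _ _))// hZ// hz hy.
    by rewrite -(fineK gu) -!EFinD lee_fin /S /sn; lra.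
  - have cz : (fun _ : nat => z) @ \oo --> z by exact: cvg_cst.
    have dpsi := (cpsi y By).1.
    have cX := cvg_diff_quotient dpsi t0 tc cz.
    have Bsub b : B b -> O (psi b) by move=> /psiP[/AO].
    have [cqp dqp] := C1_on_comp cpsi cq Bsub oB.
    have cqX := cvg_diff_quotient (cqp y By).1 t0 tc cz.
    rewrite (dqp y z By) psiy in cqX.
    have H1 : (t m)^-1 *: (X m - a) @[m --> \oo] --> w n by move: cX; rewrite psiy.
    have H2 : ((t m)^-1 *: (S m - sn : R^o) : R^o) @[m --> \oo] --> ('d q a (w n) + r : R^o).
      have : ((t m)^-1 *: ((q (X m) : R^o) - q a) : R^o) + (r : R^o) @[m --> \oo] -->
        ('d q a (w n) + r : R^o) by apply: cvgD; [exact: cqX|exact: cvg_cst].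
      apply: cvg_trans; apply: near_eq_cvg; apply: nearW => m.
      rewrite /= /S -![_ *: _]/(_ * _); field.
      by rewrite gt_eqF// invr_gt0 ltr0n.
    exact: (cvg_pair H1 H2).
have yc : Phi (xa n) @[n --> \oo] --> (0 : Y).
  rewrite -Phiu; apply: (@continuous_cvg _ _ _ _ _ xa Phi); last exact: x1.
  by apply: C1_on_continuous; [exact: cPhi|].
have dpsi0 : 'd psi 0 z = z.
  by have [_ _ /(_ z)] := Apsi u Au; rewrite Phiu dPhi.
have wc : w n @[n --> \oo] --> z.
  rewrite -[X in _ --> X]dpsi0.
  apply: (@continuous_cvg _ _ _ _ _ (fun n => Phi (xa n)) (fun y => 'd psi y z)); last exact: yc.
  by have [_] := cpsi 0 B0; apply.
have qc : 'd q (xa n) (w n) @[n --> \oo] --> 'd q u z.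
  apply: (@cvg_linear_app _ _ _ _ \oo _ (fun n => 'd q (xa n)) ('d q u)); last exact: wc.
  move=> b; apply: (@continuous_cvg _ _ _ _ _ xa (fun y => 'd q y b)); last exact: x1.
  by have [_] := cq Ou; apply.
have lim : inner (va n) (w n) + vb n * (('d q (xa n) (w n) : R) + r) @[n --> \oo]
    --> inner v z + (-1) * (('d q u z : R) + r).
  apply: cvgD; first exact: cvg_inner.
  apply: cvgM; first exact: v2.
  by apply: cvgD; [exact: qc|exact: cvg_cst].
suff : inner v z + (-1) * (('d q u z : R) + r) <= 0 by lra.
have c0 : (fun _ : nat => 0 : R) @ \oo --> (0 : R) by exact: cvg_cst.
exact: (ler_cvg_to lim c0 key).
Qed.

Lemma subdiff_chain : subdiff g u = linear_minorants (fun z => h z + ('d q u z : R)%:E)%E.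
Proof. by apply/seteqP; split=> v; [exact: subdiff_minorant|exact: minorant_subdiff]. Qed.

End SubdifferentialChain.

(** * Calculus of C2 maps *)

Section SecondOrderRules.
Context {R : realType} {V : finHilbertType R}.

Lemma C2_on_add {W : normedModType R} (O : set V) (f g : V -> W) : open O ->
  C2_on O f -> C2_on O g -> C2_on O (fun x => f x + g x).
Proof.
move=> oO [cf c2f] [cg c2g]; have [c d] := C1_on_add cf cg oO.
split; first exact: c.
move=> v; have [c' _] := C1_on_add (c2f v) (c2g v) oO.
by have [] := C1_on_eq (g := fun z => 'd (fun x => f x + g x) z v) oO
  (fun z Oz => esym (d z v Oz)) c'.
Qed.

Lemma C2_on_linear_comp {V' : finHilbertType R} {W : normedModType R} (O : set V)
    (f : V -> V') (L : {linear V' -> W}) : open O -> C2_on O f ->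
  C2_on O (fun x => L (f x)).
Proof.
move=> oO [cf c2f]; have [c d] := C1_on_linear_comp L oO cf.
split; first exact: c.
move=> v; have [c' _] := C1_on_linear_comp L oO (c2f v).
by have [] := C1_on_eq (g := fun z => 'd (fun x => L (f x)) z v) oO
  (fun z Oz => esym (d z v Oz)) c'.
Qed.

Lemma C2_on_linear {W : normedModType R} (O : set V) (L : {linear V -> W}) : C2_on O L.
Proof.
split; first exact: C1_on_linear.
move=> v; rewrite (_ : (fun z => 'd L z v) = fun=> L v); first exact: C1_on_cst.
by apply/funext => z; rewrite diff_linear_fin.
Qed.

Lemma C2_on_cst {W : normedModType R} (O : set V) (w : W) : C2_on O (fun _ : V => w).
Proof.
split; first exact: C1_on_cst.
move=> v; rewrite (_ : (fun z => 'd _ z v) = fun=> 0); first exact: C1_on_cst.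
by apply/funext => z; exact: (congr1 (fun h => h v) (diff_cst w z)).
Qed.

End SecondOrderRules.

(** * The normal form of a decomposable function *)

Section AffineHull.
Context {R : realType} {V : finHilbertType R}.
Implicit Types C A : set V.

Lemma sub_affine_hull C : C `<=` affine_hull C.
Proof. exact: sub_gen_smallest. Qed.

Lemma affine_hull_affine C : affine_set (affine_hull C).
Proof.
move=> x y t xC yC M MC; have [aM _] := MC.
by apply: aM; [exact: xC M MC|exact: yC M MC].
Qed.

Lemma affine_hull_min C A : affine_set A -> C `<=` A -> affine_hull C `<=` A.
Proof. by move=> aA CA; exact: smallest_sub. Qed.

Lemma affine_set_translate A : affine_set A -> forall a x y, A a -> A x -> A y -> A (a + x - y).
Proof.
move=> aA a x y Aa Ax Ay.
(* The reflection of [y] through the midpoint of [a] and [x]. *)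
have -> : a + x - y = (1 - 2) *: y + 2 *: ((1 - 2^-1) *: a + 2^-1 *: x).
  by apply: inner_inj => z; rewrite !innerE; field.
exact: aA _ _ _ Ay (aA _ _ _ Aa Ax).
Qed.

Lemma par_subspace C c : C c -> par C 0 /\
  forall (a : R) x y, par C x -> par C y -> par C (a *: x + y).
Proof.
move=> Cc; have Ac := sub_affine_hull Cc; have aA := @affine_hull_affine C.
split; first by exists c => //; exists c => //; rewrite subrr.
move=> a _ _ [x Ax [x' Ax' <-]] [y Ay [y' Ay' <-]].
exists ((1 - a) *: x' + a *: x + y - x').
  exact: affine_set_translate (aA x' x a Ax' Ax) Ay Ax'.
by exists y' => //; hilbert_ring.
Qed.

Lemma par_sub C c c' : C c -> C c' -> par C (c - c').
Proof. by move=> Cc Cc'; exists c; [exact: sub_affine_hull|exists c' => //; exact: sub_affine_hull]. Qed.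

End AffineHull.

(** * Adjoints and right inverses *)

Section Adjoint.
Context {R : realType} {Y Z : finHilbertType R}.
Variable A : {linear Y -> Z}.

Lemma adjointP z x : inner (A x) z = inner x (adjoint A z).
Proof.
have [y yP] := riesz (innerl z \o A : {linear Y -> R^o}).
rewrite /adjoint; case: xgetP => [w _ /= ->//|/(_ y) []].
by move=> x'; rewrite /= -yP.
Qed.

Lemma adjoint_linear : linear (adjoint A).
Proof.
move=> a x y; apply: inner_inj => z.
by rewrite innerDr innerZr -!adjointP innerDr innerZr.
Qed.

Definition adjoint_lin : {linear Z -> Y} :=
  HB.pack (adjoint A) (GRing.isLinear.Build _ _ _ _ _ adjoint_linear).

(* [B = A^* P T^-1], with [T] the injective operator
   [P A A^* P + (1 - P)] and [P] the projection onto [S]. *)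
Lemma right_inverse_on (S : {vspace Z}) :
  (forall z, z \in S -> adjoint A z = 0 -> z = 0) ->
  exists B : {linear Z -> Y}, forall z, orthproj S (A (B z)) = orthproj S z.
Proof.
move=> Sker; pose P : {linear Z -> Z} := orthproj S.
have PP z : P (P z) = P z by apply: orthproj_id; exact: orthproj_in.
pose T : {linear Z -> Z} := (P \o A \o adjoint_lin \o P) \+ (idfun \- P).
have TE z : T z = P (A (adjoint A (P z))) + (z - P z) by [].
have Tinj z : T z = 0 -> z = 0.
  (* Here <T z, z> is the sum of the squared norms of adjoint A (P z) and of z - P z; the hypothesis
     on [S] turns vanishing of the first into P z = 0. *)
  move=> Tz0; have : inner (T z) z = 0 by rewrite Tz0 inner0l.
  rewrite TE innerDl orthprojC adjointP innerxx.
  have -> : inner (z - P z) z = `|z - P z| ^+ 2.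
    have o : inner (P z) (z - P z) = 0 by apply: orthproj_orth; exact: orthproj_in.
    by rewrite -innerxx [RHS]innerBr (innerC _ (P z)) o subr0.
  move=> /eqP; rewrite paddr_eq0 ?sqr_ge0// !sqrf_eq0 !normr_eq0.
  move=> /andP[/eqP k0 /eqP zP].
  have P0 : P z = 0 by apply: Sker => //; exact: orthproj_in.
  by rewrite -(subrK (P z) z) zP P0 addr0.
have [M MP] := injective_endo_inverse Tinj.
exists (adjoint_lin \o P \o M : {linear Z -> Y}) => z /=.
have PT w : P (T w) = P (A (adjoint A (P w))).
  by rewrite TE (linearD P) PP (linearB P) PP subrr addr0.
by have [_ TM] := MP z; rewrite -[in RHS]TM -/(P _) -/(P (T _)) PT.
Qed.

End Adjoint.

Section NormalForm.
Context {R : realType} {Y : finHilbertType R}.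

(** The slope [y] sits entirely in [Q], so that [y] being a subgradient is expressed by [nf_ge0]: 0
    is a linear minorant of [h]. *)
Record normal_form (g : Y -> \bar R) (u y : Y) (O : set Y) (Q : Y -> R^o) (Phi : Y -> Y)
    (h : Y -> \bar R) : Prop := NormalForm {
  nf_open : open O;
  nf_in : O u;
  nf_fin : g u \is a fin_num;
  nf_C2Q : C2_on O Q;
  nf_C2Phi : C2_on O Phi;
  nf_Q : (Q u : R) = 0;
  nf_dQ : forall v, ('d Q u v : R) = inner y v;
  nf_Phi : Phi u = 0;
  nf_dPhi : forall v, 'd Phi u v = v;
  nf_lsc : lower_semicontinuous h;
  nf_sublinear : sublinear h;
  nf_ge0 : forall z, (0 <= h z)%E;
  nf_eq : forall w, O w -> g w = (g u + (Q w : R)%:E + h (Phi w))%E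
}.

Lemma normal_form_subdiff g u y O Q Phi h : normal_form g u y O Q Phi h ->
  forall v, subdiff g u v <-> linear_minorants h (v - y).
Proof.
case=> oO Ou gu [cQ _] [cPhi _] Q0 dQ Phi0 dPhi hl hs h0 gE v.
have hNy z : (-oo < h z)%E by exact: lt_le_trans (h0 z).
rewrite (subdiff_chain oO Ou cQ cPhi Phi0 dPhi hNy hs gu gE).
split=> H z; have := H z; rewrite dQ innerBl; have := hNy z.
  by case: (h z) => [r| |]//; rewrite -?EFinD ?lee_fin ?leey//; lra.
by case: (h z) => [r| |]//; rewrite -?EFinD ?lee_fin ?leey//; lra.
Qed.

(** The chain rule for the trivial decomposition, with zero smooth part and the identity as inner
    map. *)
Lemma subdiff_sublinear (Z : finHilbertType R) (theta : Z -> \bar R) :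
  (forall z, -oo < theta z)%E -> sublinear theta ->
  subdiff theta 0 = linear_minorants theta.
Proof.
move=> tNy ts; have t0 := sublinear0 tNy ts.
have tE : forall w : Z, setT w -> theta w = (theta 0%R + (0 : R)%:E + theta (idfun w))%E.
  by move=> w _; rewrite t0 !add0e.
have c0 : C1_on setT (fun _ : Z => 0 : R^o) by exact: C1_on_cst.
have cid : C1_on setT (idfun : Z -> Z) by exact: C1_on_id.
rewrite (subdiff_chain (@openT Z) I c0 cid erefl (diff_id_fin 0) tNy ts _ tE); last first.
  by rewrite t0.
congr linear_minorants; apply/funext => z.
have -> : 'd (fun _ : Z => 0 : R^o) 0 z = 0.
  exact: (congr1 (fun h => h z) (diff_cst (0 : R^o) (0 : Z))).
by rewrite adde0.
Qed.

(** Nondegeneracy provides a right inverse [B] of [A] modulo the projection [P] onto [S]. Through it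
    [P] composed with [Xi] is written as P A Phi with [Phi] a map of [Y] into itself, so that
    [theta] composed with [P] and [A] becomes the sublinear part, up to a linear tilt. *)
Lemma normal_form_ex (g : Y -> \bar R) (u y : Y) :
  reliably_C2_decomposable g u -> subdiff g u y ->
  exists O Q Phi h, normal_form g u y O Q Phi h.
Proof.
case=> gu [Z] [ O] [theta] [Xi] [dec nd] gy.
have [[oO Ou] [[tNy _] tl ts] C2Xi Xi0 gE] := dec.
pose A : {linear Y -> Z} := 'd Xi u.
rewrite Xi0 subdiff_sublinear// in nd.
pose C := linear_minorants theta; rewrite -/C in nd.
have [mu muC] := linear_minorants_ex tNy tl ts.
pose S := lin_span [set c - mu | c in C]; pose P : {linear Z -> Z} := orthproj S.
have Spar s : s \in S -> par C s.
  have [p0 pl] := par_subspace muC.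
  apply: lin_span_ind => // _ [c Cc <-]; exact: par_sub.
have [B BP] : exists B : {linear Z -> Y}, forall z, orthproj S (A (B z)) = orthproj S z.
  apply: right_inverse_on => z /Spar zC Az.
  have : (par C `&` [set z | adjoint A z = 0]) z by [].
  by rewrite nd.
have PP z : P (P z) = P z by apply: orthproj_id; exact: orthproj_in.
have PAB z : P (A (B z)) = P z by exact: BP.
(* Two identities dictate this choice: P A L1 = 0 gives P A Phi = P Xi, and L1 + L2 A = 1 makes the
   differential of [Phi] at [u] the identity. *)
pose L1 : {linear Y -> Y} := idfun \- (B \o P \o A).
pose L2 : {linear Z -> Y} := B \o P.
pose Phi x := (L1 x + - L1 u) + L2 (Xi x).
have C2Phi : C2_on O Phi.
  apply: C2_on_add => //; last exact: C2_on_linear_comp.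
  by apply: C2_on_add => //; [exact: C2_on_linear|exact: C2_on_cst].
have PAPhi x : P (A (Phi x)) = P (Xi x).
  have PAL1 v : P (A (L1 v)) = 0 by rewrite /L1/= !linearB/= PAB PP subrr.
  have PAD v w : P (A (v + w)) = P (A v) + P (A w) by rewrite (linearD A) (linearD P).
  have PAN v : P (A (- v)) = - P (A v) by rewrite (linearN A) (linearN P).
  by rewrite /Phi (PAD (L1 x - L1 u)) (PAD (L1 x)) PAN !PAL1 oppr0 !add0r PAB PP.
have Phi0 : Phi u = 0 by rewrite /Phi Xi0 linear0 addr0 subrr.
have [C1Xi _] := C2Xi.
have dPhi v : 'd Phi u v = v.
  have c1 : C1_on O L1 by exact: C1_on_linear.
  have c2 : C1_on O (fun _ : Y => - L1 u) by exact: C1_on_cst.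
  have [c12 d12] := C1_on_add c1 c2 oO.
  have [c3 d3] := C1_on_linear_comp L2 oO C1Xi.
  have [_ d] := C1_on_add c12 c3 oO.
  have e12 : 'd (fun x => L1 x + - L1 u) u v = L1 v.
    apply: (etrans (d12 u v Ou)); rewrite -[RHS]addr0; congr (_ + _).
      exact: diff_linear_fin.
    exact: (congr1 (fun h => h v) (diff_cst (- L1 u) u)).
  apply: (etrans (d u v Ou)); rewrite e12; apply: (etrans (congr1 _ (d3 u v Ou))).
  by rewrite /L1 /L2/= subrK.
(* All minorants of [theta] agree with [mu] on the orthogonal of [S], so [theta] splits into the
   linear [M] and its restriction to [S]. *)
pose M : {linear Z -> R^o} := innerl mu \o (idfun \- P).
pose q x : R^o := M (Xi x).
have thetaE z : theta z = ((M z : R)%:E + theta (P z))%E.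
  have [|_ tadd] := @sublinear_on_constancy_line R Z theta (z - P z) (M z) tNy tl ts.
    move=> k kC; rewrite -(subrK mu k) innerDl (_ : inner (k - mu) _ = 0).
      by rewrite add0r innerC.
    by apply: orthproj_orth; apply: mem_lin_span; exists k.
  by rewrite -[in LHS](subrK (P z) z) [X in theta X]addrC tadd addeC.
have C2q : C2_on O q by exact: C2_on_linear_comp.
have [C1q _] := C2q.
have [C1Phi _] := C2Phi.
pose h0 z := theta (P (A z)).
have h0Ny z : (-oo < h0 z)%E by exact: tNy.
have h0s : sublinear h0.
  case: ts => t0 tZ tD; split; first by rewrite /h0 !linear0.
    by move=> t x t_gt0; rewrite /h0 !linearZ/= tZ.
  by move=> x x'; rewrite /h0 !linearD/= tD.
have gE0 w : O w -> g w = (g u + (q w : R)%:E + h0 (Phi w))%E.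
  by move=> Ow; rewrite gE// thetaE addeA /h0 PAPhi.
move: gy; rewrite (subdiff_chain oO Ou C1q C1Phi Phi0 dPhi h0Ny h0s gu gE0) => ymin.
(* The tilt: adding [m] to [h0] and subtracting m (Phi x) from [q] leaves the sum unchanged, gives
   [Q] the slope [y] at [u], and turns [ymin] into h >= 0. *)
pose m : {linear Y -> R^o} := 'd q u \- innerl y.
pose h z := (h0 z + (m z : R)%:E)%E.
pose Q x : R^o := q x + - (m (Phi x)).
have cm : continuous m by exact: linear_continuous_fin.
have cPA : continuous (P \o A : {linear Y -> Z}) by exact: linear_continuous_fin.
exists O, Q, Phi, h; split.
- exact: oO.
- exact: Ou.
- exact: gu.
- apply: C2_on_add; [exact: oO|exact: C2q|].
  exact: (C2_on_linear_comp (\- m : {linear Y -> R^o})).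
- exact: C2Phi.
- by rewrite /Q Phi0 /q Xi0 (linear0 M) (linear0 m) subr0.
- move=> v; have [cmP dmP] := C1_on_linear_comp (\- m : {linear Y -> R^o}) oO C1Phi.
  have [_ d] := C1_on_add C1q cmP oO.
  apply: (etrans (d u v Ou)); apply: (etrans (congr1 _ (dmP u v Ou))).
  by rewrite dPhi /m/= opprB addrC subrK innerC.
- exact: Phi0.
- exact: dPhi.
- apply: lscDfin; [|exact: cm|exact: h0Ny].
  move=> x a ax.
  have [V Vx Va] := tl _ _ ax.
  by exists ((P \o A) @^-1` V); [exact: cPA|move=> z /Va].
- case: h0s => t0 tZ tD; split.
  + by rewrite /h linear0 adde0.
  + move=> t x t_gt0; rewrite /h tZ// linearZ/= -[t *: _]/(t * _) EFinM.
    by rewrite muleDr// fin_num_adde_defl.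
  + move=> x x'; rewrite /h linearD EFinD addeACA; apply: leeD2r.
    exact: tD.
- move=> z; have := ymin z; have := h0Ny z; rewrite /h /m/= innerC.
  by case: (h0 z) => [r| |]// _; rewrite ?addye// ?leey// -!EFinD !lee_fin; lra.
- move=> w Ow; rewrite gE0// /h /Q /= EFinB.
  rewrite -(fineK gu); have := h0Ny (Phi w); case: (h0 (Phi w)) => [r| |]// _.
  by rewrite -!EFinD; congr EFin; lra.
Qed.

End NormalForm.

(** * Relative interior *)

Section RelativeInterior.
Context {R : realType} {Y : finHilbertType R}.

Lemma closed_norm_le (f : Y -> Y) (r : R) : continuous f -> closed [set x | `|f x| <= r].
Proof.
move=> cf; have -> : [set x | `|f x| <= r] = (fun x => `|f x|) @^-1` [set t | t <= r] by [].
by apply: closed_comp; [move=> x _; apply: cvg_norm; exact: cf|exact: closed_le].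
Qed.

Lemma compact_vspace_sphere (N : {vspace Y}) : compact [set z : Y | z \in N /\ `|z| = 1].
Proof.
have cP : continuous (orthproj N) by exact: linear_continuous_fin.
have -> : [set z : Y | z \in N /\ `|z| = 1] =
    [set z | `|orthproj N z - z| <= 0] `&` ([set z | `|z - 0| <= 1] `&` (fun z => `|z|) @^-1` [set t : R | 1 <= t]).
  apply/seteqP; split=> z /=.
    by move=> [zN z1]; rewrite orthproj_id// subrr normr0 subr0 z1.
  rewrite normr_le0 subr_eq0 subr0 => -[/eqP zN [z1 z2]]; split.
    by rewrite -zN orthproj_in.
  by apply/eqP; rewrite eq_le z1 z2.
apply: (subclosed_compact _ (@compact_normball R Y 0 1)); last by move=> z [_ []].
apply: closedI; last apply: closedI.
- by apply: closed_norm_le => z; apply: cvgB; [exact: cP|exact: cvg_id].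
- by apply: closed_norm_le => z; apply: cvgB; [exact: cvg_id|exact: cvg_cst].
- by apply: closed_comp; [move=> x _; apply: cvg_norm; exact: cvg_id|exact: closed_ge].
Qed.

Section Cone.
Variable h : Y -> \bar R.
Hypotheses (hl : lower_semicontinuous h) (hs : sublinear h) (h0 : forall z, (0 <= h z)%E).

Let hNy z : (-oo < h z)%E. Proof. exact: lt_le_trans (h0 z). Qed.

Lemma minorant0 : linear_minorants h 0.
Proof. by move=> z; rewrite inner0l. Qed.

Lemma minorant_span_orth z : (forall n, n \in lin_span (linear_minorants h) -> inner n z = 0) ->
  h z = 0%E /\ forall w, h (w + z) = h w.
Proof.
move=> zN; have [|hz hw] := @sublinear_on_constancy_line R Y h z 0 hNy hl hs.
  by move=> k /mem_lin_span /zN.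
by split=> // w; rewrite hw adde0.
Qed.

Lemma orthproj_minorant_span z : h (orthproj (lin_span (linear_minorants h)) z) = h z.
Proof.
set N := lin_span _; have [|_ hw] := @minorant_span_orth (z - orthproj N z).
  by move=> n nN; exact: orthproj_orth.
by rewrite -[in RHS](subrK (orthproj N z) z) [X in _ = h X]addrC hw.
Qed.

(** On the unit sphere of N the minimum of [h] is attained and positive; homogeneity turns it into h
    z >= r |z| on N, and [h] does not see components orthogonal to N. *)
Lemma minorants_ball : (forall n, n \in lin_span (linear_minorants h) -> h n = 0%E -> n = 0) ->
  exists2 r : R, 0 < r & forall k, k \in lin_span (linear_minorants h) -> `|k| < r ->
    linear_minorants h k.
Proof.
set N := lin_span _ => hN.
pose D := [set z : Y | z \in N /\ `|z| = 1].
(* An empty sphere means N = 0, where any radius works. *)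
have [[z0 Dz0]|D0] := pselect (D !=set0); last first.
  exists 1 => // k kN _; have [->|k0] := eqVneq k 0; first exact: minorant0.
  exfalso; apply: D0; exists (`|k|^-1 *: k); split; first exact: memvZ.
  by rewrite normrZ normfV normr_id mulVf// normr_eq0.
have [p [pN p1] pmin] := lsc_min (@compact_vspace_sphere N) (ex_intro _ z0 Dz0) hNy hl.
have [r r0 rp] : exists2 r : R, 0 < r & (r%:E <= h p)%E.
  have := h0 p; case hp : (h p) => [s| |]//; last by exists 1 => //; exact: leey.
  rewrite lee_fin le_eqVlt => /orP[/eqP s0|s0]; last by exists s.
  have : p = 0 by apply: hN => //; rewrite hp -s0.
  by move=> pz; move: p1; rewrite pz normr0 => /esym/eqP; rewrite oner_eq0.
exists r => // k kN kr w; rewrite -(orthproj_minorant_span w) -/N.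
have -> : inner k w = inner k (orthproj N w).
  by rewrite -orthprojC orthproj_id.
have wN := orthproj_in N w; set z := orthproj N w in wN *.
have [->|zn0] := eqVneq z 0; first by rewrite inner0r.
have zp : 0 < `|z| by rewrite normr_gt0.
case: hs => _ hZ _.
have -> : h z = ((`|z|)%:E * h (`|z|^-1 *: z))%E.
  by rewrite -hZ// scalerA mulfV ?gt_eqF// scale1r.
apply: (@le_trans _ _ ((`|z|)%:E * r%:E)%E).
  rewrite -EFinM lee_fin mulrC; apply: le_trans (le_inner_norm _ _) _.
  by rewrite ler_wpM2r// ltW.
rewrite lee_pmul2l//; apply: le_trans rp _; apply: pmin; split; first exact: memvZ.
by rewrite normrZ normfV normr_id mulVf// gt_eqF.
Qed.

End Cone.

(** The affine hull of the subdifferential is [y] plus the span of the minorants. One direction uses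
    the inclusion obtained by induction on the span, the other the inclusion given by minimality of
    the hull. *)
Lemma normal_form_ri (g : Y -> \bar R) u y O Q Phi h : normal_form g u y O Q Phi h ->
  ri (subdiff g u) y <-> exists2 r : R, 0 < r &
    forall k, k \in lin_span (linear_minorants h) -> `|k| < r -> linear_minorants h k.
Proof.
move=> nf; have Dv := normal_form_subdiff nf.
set D := subdiff g u in Dv *; set K := linear_minorants h in Dv *.
have K0 : K 0 by apply: minorant0; case: nf.
have Dy : D y by apply/Dv; rewrite subrr.
have aA := @affine_hull_affine R Y D.
split=> [[_ /nbhs_normP[r r0 rP]]|[r r0 rP]].
  exists r => // k kN kr.
  have : affine_hull D (y + k).
    apply: (@lin_span_ind R Y K [set k | affine_hull D (y + k)]) kN.
    - by rewrite /= addr0; exact: sub_affine_hull.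
    - move=> a x x' /= Ax Ax'.
      have -> : y + (a *: x + x') = ((1 - a) *: y + a *: (y + x)) + (y + x') - y by hilbert_ring.
      apply: affine_set_translate Ax' _ => //; last exact: sub_affine_hull.
      by apply: aA => //; exact: sub_affine_hull.
    - by move=> x Kx /=; apply: sub_affine_hull; apply/Dv; rewrite addrC addKr.
  have yk : y + k - y = k by rewrite addrC addKr.
  by move=> /rP; rewrite yk => /(_ kr)/Dv; rewrite yk.
split; first exact: sub_affine_hull.
apply/nbhs_normP; exists r => // z zr Az; apply/Dv; apply: rP => //.
move: z Az {zr}; apply: affine_hull_min.
  move=> x x' t /= xN x'N.
  have -> : (1 - t) *: x + t *: x' - y = (1 - t) *: (x - y) + t *: (x' - y) by hilbert_ring.
  by rewrite memvD ?memvZ.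
by move=> z /Dv; exact: mem_lin_span.
Qed.

End RelativeInterior.

(** * Quadratic lower bounds *)

Section LowerBounds.
Context {R : realType} {Y : finHilbertType R}.
Variables (g : Y -> \bar R) (u y : Y) (O : set Y) (Q : Y -> R^o) (Phi : Y -> Y)
  (h : Y -> \bar R).
Hypothesis nf : normal_form g u y O Q Phi h.

(* A quadratic minorization of [g] at the points [v] of the active manifold,
   with slope [grad Q v + Phi'(v)^* k]. *)
Definition local_lower_bound (d rho : R) : Prop := forall k v w,
  linear_minorants h k -> `|k| <= 1 -> `|v - u| < d -> `|w - u| < d ->
  h (Phi v) = 0%E -> inner k (Phi v) = 0 ->
  ((fine (g u) + (Q v : R) + ('d Q v (w - v) : R) + inner k ('d Phi v (w - v))
     - rho * `|w - v| ^+ 2)%:E <= g w)%E.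

Lemma normal_form_value v : O v -> h (Phi v) = 0%E -> g v = (fine (g u) + (Q v : R))%:E.
Proof. by move=> Ov hv; rewrite (nf_eq nf Ov) hv adde0 -(fineK (nf_fin nf)) -EFinD. Qed.

(** Taylor expansions of [Q] and [Phi] at [v] are combined with h (Phi w) >= <k, Phi w>. As |k| <= 1
    and <k, Phi v> = 0, the defect is the sum of the two remainder constants. *)
Lemma local_lower_bound_ex : exists d rho : R, [/\ 0 < d, 0 < rho,
  forall z, `|z - u| < d -> O z & local_lower_bound d rho].
Proof.
have oO := nf_open nf; have Ou := nf_in nf.
have [d1 [M1 [d10 M10 P1]]] := C2_on_remainder norming_real oO Ou (nf_C2Q nf).
have [d2 [M2 [d20 M20 P2]]] := C2_on_remainder (@norming_hilbert R Y) oO Ou (nf_C2Phi nf).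
have [d3 d30 P3] := open_norm_ball oO Ou.
exists (Num.min d1 (Num.min d2 d3)), (M1 + M2); split.
- by rewrite !lt_min d10 d20.
- exact: addr_gt0.
- by move=> z; rewrite !lt_min => /and3P[_ _ /P3].
move=> k v w Kk k1; rewrite !lt_min => /and3P[v1 v2 v3] /and3P[w1 w2 w3] hv kv.
rewrite (nf_eq nf (P3 _ w3)) -(fineK (nf_fin nf)).
have q1 : `|(Q w : R) - Q v - 'd Q v (w - v)| <= M1 * `|w - v| ^+ 2 := P1 w v w1 v1.
have q2 := P2 w v w2 v2.
have := Kk (Phi w); have := nf_ge0 nf (Phi w).
case: (h (Phi w)) => [s| |]// _; last first.
  by move=> _; rewrite -EFinD addey// leey.
rewrite -!EFinD !lee_fin => ks; rewrite [fine _%:E]/=.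
move: q1; rewrite ler_norml => /andP[q1 _].
have : - (M2 * `|w - v| ^+ 2) <= inner k (Phi w - Phi v - 'd Phi v (w - v)).
  rewrite lerNl; apply: le_trans (ler_norm _) _; rewrite normrN.
  apply: le_trans (norm_inner_le _ _) _.
  by apply: le_trans (ler_wpM2r (normr_ge0 _) k1) _; rewrite mul1r.
rewrite !innerBr kv subr0; lra.
Qed.

(** Within distance [d] of [u] the local bound applies. Farther away prox-boundedness gives a
    quadratic bound, and constants and linear terms are absorbed because |w - u| >= d. The clause 2
    rho <= r lets one condition on gamma serve the local bound too. *)
Lemma global_lower_bound (d rho : R) : 0 < d -> 0 < rho -> local_lower_bound d rho ->
  prox_bounded g ->
  exists2 r : R, 2 * rho <= r & forall k w, linear_minorants h k -> `|k| <= 1 ->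
    ((fine (g u) + inner (y + k) (w - u) - r / 2 * `|w - u| ^+ 2)%:E <= g w)%E.
Proof.
move=> d0 rho0 loc [al [m pb]].
pose C1 : R := `|fine (g u)| + `|m| + 2 * `|al| * `|u| ^+ 2.
pose C2 : R := `|y| + 1.
have C1E : C1 = `|fine (g u)| + `|m| + 2 * `|al| * `|u| ^+ 2 by [].
have d20 : 0 < d ^+ 2 by rewrite exprn_gt0.
have C10 : 0 <= C1 by rewrite !addr_ge0 ?mulr_ge0 ?sqr_ge0.
have C20 : 0 <= C2 by rewrite addr_ge0.
(* One summand per loss: the local defect, the quadratic of prox-boundedness through |w|^2 <= 2 |w -
   u|^2 + 2 |u|^2, the constants and the linear term. *)
clearbody C1; pose s : R := rho + 2 * `|al| + C1 / d ^+ 2 + C2 / d.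
have C1d : 0 <= C1 / d ^+ 2 by rewrite divr_ge0// ltW.
have C2d : 0 <= C2 / d by rewrite divr_ge0// ltW.
exists (2 * s); first by rewrite ler_pM2l// /s; have := normr_ge0 al; lra.
move=> k w Kk k1; rewrite (_ : 2 * s / 2 = s); last by field.
have [wd|dw] := ltP `|w - u| d.
  have ud : `|u - u| < d by rewrite subrr normr0.
  have hu : h (Phi u) = 0%E.
    by rewrite (nf_Phi nf) sublinear0//; [move=> z; exact: lt_le_trans (nf_ge0 nf z)|exact: nf_sublinear nf].
  have ku : inner k (Phi u) = 0 by rewrite (nf_Phi nf) inner0r.
  apply: le_trans (loc k u w Kk k1 ud wd hu ku); rewrite lee_fin.
  rewrite (nf_Q nf) (nf_dQ nf) (nf_dPhi nf) innerDl addr0 addrA lerD2l lerN2.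
  rewrite ler_wpM2r ?sqr_ge0// /s; have := normr_ge0 al; lra.
have := pb w; case: (g w) => [t| |]; [|by move=> _; rewrite leey|by rewrite addNye leeNy_eq => /eqP].
rewrite -EFinD !lee_fin => mt.
have w2 : `|w| ^+ 2 <= 2 * `|w - u| ^+ 2 + 2 * `|u| ^+ 2.
  rewrite -{1}(subrK u w) normD_sqr.
  have := sqr_ge0 `|w - u - u|; rewrite normB_sqr; lra.
have aw : al * `|w| ^+ 2 <= `|al| * (2 * `|w - u| ^+ 2 + 2 * `|u| ^+ 2).
  apply: le_trans (ler_wpM2r (sqr_ge0 _) (ler_norm al)) _.
  by rewrite ler_wpM2l.
have i1 : inner (y + k) (w - u) <= C2 * `|w - u|.
  apply: le_trans (le_inner_norm _ _) _; rewrite ler_wpM2r//.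
  by apply: le_trans (ler_normD _ _) _; rewrite lerD2l.
have i2 : C2 * `|w - u| <= C2 / d * `|w - u| ^+ 2.
  rewrite -mulrA ler_wpM2l// ler_pdivlMl// expr2 ler_wpM2r//.
have i3 : C1 <= C1 / d ^+ 2 * `|w - u| ^+ 2.
  rewrite -mulrA -[leLHS]mulr1 ler_wpM2l// ler_pdivlMl// mulr1.
  by rewrite ler_pXn2r// ?nnegrE// ltW.
have r0 : 0 <= rho * `|w - u| ^+ 2 by rewrite mulr_ge0 ?sqr_ge0// ltW.
have n1 := ler_norm (fine (g u)); have n2 : - m <= `|m| by rewrite -normrN ler_norm.
have aw2 : `|al| * (2 * `|w - u| ^+ 2 + 2 * `|u| ^+ 2) =
    2 * (`|al| * `|w - u| ^+ 2) + 2 * `|al| * `|u| ^+ 2 by ring.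
rewrite aw2 in aw.
have -> : s * `|w - u| ^+ 2 = rho * `|w - u| ^+ 2 + 2 * (`|al| * `|w - u| ^+ 2) +
    C1 / d ^+ 2 * `|w - u| ^+ 2 + C2 / d * `|w - u| ^+ 2 by rewrite /s; ring.
lra.
Qed.

(** The local bound is applied at z = v + t (w - v), and convexity bounds g z by the chord. After
    division by [t] the defect is rho t |w - v|^2, which vanishes with [t]. *)
Lemma convex_lower_bound (d rho : R) : 0 < d ->
  (forall z, `|z - u| < d -> O z) -> local_lower_bound d rho ->
  convex_ereal_fun g ->
  forall k v w, linear_minorants h k -> `|k| <= 1 -> `|v - u| < d ->
    h (Phi v) = 0%E -> inner k (Phi v) = 0 ->
    ((fine (g u) + (Q v : R) + ('d Q v (w - v) : R) + inner k ('d Phi v (w - v)))%:E <= g w)%E.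
Proof.
move=> d0 dO loc cg k v w Kk k1 vd hv kv.
have gv := normal_form_value (dO _ vd) hv.
(* Arguing with every real above g w covers the value -oo as well. *)
suff H (a : R) : (g w <= a%:E)%E -> fine (g u) + (Q v : R) + ('d Q v (w - v) : R) +
    inner k ('d Phi v (w - v)) <= a.
  case gw : (g w) => [a| |]; last 2 first.
  - by rewrite leey.
  - have := H (fine (g u) + (Q v : R) + ('d Q v (w - v) : R) +
      inner k ('d Phi v (w - v)) - 1); rewrite gw leNye => /(_ isT).
    by rewrite lerBrDr gerDl ler10.
  by rewrite lee_fin; apply: H; rewrite gw.
move=> gwa.
(* This cap on [t] keeps [z] within distance [d] of [u]. *)
pose t0 := Num.min 1 ((d - `|v - u|) / (`|w - v| + 1)).
have wv1 : 0 < `|w - v| + 1 by rewrite ltr_wpDl.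
have t00 : 0 < t0 by rewrite lt_min ltr01 divr_gt0// subr_gt0.
have t01 : t0 <= 1 by rewrite ge_min lexx.
have t0d : t0 * (`|w - v| + 1) <= d - `|v - u| by rewrite -ler_pdivlMr// ge_min lexx orbT.
apply: (@le_of_le_add_small _ _ _ (rho * t0 * `|w - v| ^+ 2)) => s /andP[s0 s1].
pose t := s * t0; have t_gt0 : 0 < t by rewrite mulr_gt0.
have tt0 : t < t0 by rewrite /t gtr_pMl.
have tlt1 : t < 1 by exact: lt_le_trans tt0 t01.
pose z := v + t *: (w - v).
have zd : `|z - u| < d.
  rewrite /z addrAC; apply: le_lt_trans (ler_normD _ _) _; rewrite normrZ gtr0_norm//.
  have : t * `|w - v| < t0 * (`|w - v| + 1).
    apply: le_lt_trans (_ : t * `|w - v| <= t * (`|w - v| + 1)) _.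
      by rewrite ler_pM2l// lerDl.
    by rewrite ltr_pM2r.
  lra.
have zv : z - v = t *: (w - v) by rewrite /z addrC addKr.
have lz := loc k v z Kk k1 vd zd hv kv.
have tI : 0 <= t <= 1 by rewrite !ltW.
have gz : (g z <= ((1 - t) * (fine (g u) + (Q v : R)) + t * a)%:E)%E.
  pose p1 : convex_lmodType (Y * R^o)%type := (w, a).
  pose p2 : convex_lmodType (Y * R^o)%type := (v, fine (g u) + (Q v : R)).
  have := cg p1 p2 (Itv01 (ltW t_gt0) (ltW tlt1)).
  rewrite !inE => /(_ gwa).
  rewrite /p2/= /epi/= gv lexx => /(_ isT) H.
  have <- : t *: w + (1 - t) *: v = z by rewrite /z; hilbert_ring.
  by apply: le_trans H _; rewrite lee_fin addrC.
move: (le_trans lz gz); rewrite lee_fin zv normrZ exprMn (gtr0_norm t_gt0).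
have -> : 'd Phi v (t *: (w - v)) = t *: 'd Phi v (w - v) by exact: linearZ.
have -> : 'd Q v (t *: (w - v)) = t * ('d Q v (w - v) : R) :> R by exact: linearZ.
rewrite innerZr.
set n := `|w - v| ^+ 2; set l1 : R := 'd Q v (w - v); set l2 := inner k _; set a0 : R := Q v.
move=> H; rewrite -(ler_pM2l t_gt0).
have -> : t * (a + s * (rho * t0 * n)) = t * a + rho * (t ^+ 2 * n) by rewrite /t; ring.
lra.
Qed.

End LowerBounds.

(** * Smoothness of the prox *)

Section ProxSmooth.
Context {R : realType} {Y : finHilbertType R}.

Lemma C1_on_inner {V W : finHilbertType R} (O : set V) (f f' : V -> W) : open O ->
  C1_on O f -> C1_on O f' -> C1_on O (fun x => inner (f x) (f' x) : R^o).
Proof.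
move=> oO cf cf'; have [n [b [d [bE _]]]] := @dual_bases R W.
have c i : C1_on O (fun x => (innerl (d i) (f x) : R) * (innerl (b i) (f' x) : R) : R^o).
  have [c1 _] := C1_on_linear_comp (innerl (d i)) oO cf.
  have [c2 _] := C1_on_linear_comp (innerl (b i)) oO cf'.
  by have [] := C1_on_mul c1 c2 oO.
have [cs _] := C1_on_sum c oO.
have [] // := C1_on_eq (g := fun x => inner (f x) (f' x) : R^o) oO _ cs => x Ox.
rewrite [in RHS](bE (f x)) inner_suml; apply: eq_bigr => i _.
by rewrite innerZl !innerlE (innerC (f' x)).
Qed.

Lemma C1_on_scaler {V : finHilbertType R} {W : normedModType R} (O : set V)
    (f : V -> R^o) (w : W) : open O -> C1_on O f -> C1_on O (fun x => (f x : R) *: w).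
Proof.
move=> oO cf; have lz : linear (fun t : R^o => (t : R) *: w).
  by move=> a s t; rewrite scalerDl scalerA.
pose L : {linear R^o -> W} := HB.pack (fun t : R^o => (t : R) *: w)
  (GRing.isLinear.Build _ _ _ _ _ lz).
have cL : continuous L by move=> t; apply: cvgZr_tmp; exact: cvg_id.
have dL z : differentiable L z by exact: linear_differentiable.
apply: (@C1_on_intro _ _ _ _ _ (fun x v => L ('d f x v)) oO _ _).1.
  move=> x Ox; have [df _] := cf x Ox.
  split; first exact: (differentiable_comp df (dL _)).
  move=> v; apply: (etrans (congr1 (fun h => h v) (diff_comp df (dL _)))).
  exact: (congr1 (fun h : R^o -> W => h ('d f x v)) (diff_lin (f x) cL)).
by move=> x v Ox; apply: cvgZr_tmp; have [_] := cf x Ox; apply.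
Qed.

Variables (g : Y -> \bar R) (u y : Y) (O : set Y) (Q : Y -> R^o) (Phi : Y -> Y)
  (h : Y -> \bar R).
Hypothesis nf : normal_form g u y O Q Phi h.

(* [xi] has its tangent part [xi - P xi] as a chart of the active manifold and
   its normal part [P xi] as a multiplier; [X xi] is the point whose prox is
   the corresponding point of the manifold. *)
Lemma stationary_chart (gamma d rho : R) : 0 < gamma -> 0 < d -> 0 <= rho ->
  2 * gamma * rho < 1 -> (forall z, `|z - u| < d -> O z) ->
  local_lower_bound g u Q Phi h d rho ->
  forall e : R, 0 < e ->
  exists (W : set Y) (p k : Y -> Y), [/\ open W, W (u + gamma *: y), C1_on W p,
    forall x, W x -> [/\ `|p x - u| < d, k x \in lin_span (linear_minorants h),
      `|k x| < e & h (Phi (p x)) = 0%E]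
    & forall x, W x -> inner (k x) (Phi (p x)) = 0 /\
      forall v, inner (x - p x) v = gamma * (('d Q (p x) v : R) + inner (k x) ('d Phi (p x) v))].
Proof.
move=> g0 d0 rho0 gr dO loc e e0.
have oO := nf_open nf; have Ou := nf_in nf.
have [cQ c2Q] := nf_C2Q nf; have [cPhi c2Phi] := nf_C2Phi nf.
pose N := lin_span (linear_minorants h).
pose P : {linear Y -> Y} := orthproj N.
pose P' : {linear Y -> Y} := idfun \- P.
have P'E z : P' z = z - P z by [].
have PP z : P (P z) = P z by apply: orthproj_id; exact: orthproj_in.
have hNy z : (-oo < h z)%E by exact: lt_le_trans (nf_ge0 nf z).
have orth n z : n \in N -> inner n (P' z) = 0 by exact: orthproj_orth.
have hP' z : h (P' z) = 0%E.
  by have [] := minorant_span_orth (nf_lsc nf) (nf_sublinear nf) (nf_ge0 nf) (z := P' z) (fun n => @orth n z).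
have inj a : 'd Phi u a = 0 -> a = 0 by rewrite (nf_dPhi nf).
have [A [B [psi [[oA Au AO] [oB B0] cpsi psiP Apsi]]]] := inverse_function oO Ou cPhi inj.
rewrite (nf_Phi nf) in B0.
have psi0 : psi 0 = u by have [_ + _] := Apsi u Au; rewrite (nf_Phi nf).
have dpsi0 v : 'd psi 0 v = v.
  by have [_ _ /(_ v)] := Apsi u Au; rewrite (nf_Phi nf) (nf_dPhi nf).
have cP' : continuous P' by exact: linear_continuous_fin.
pose U xi := psi (P' xi).
have U0 : U 0 = u by rewrite /U linear0.
pose BP := P' @^-1` B.
have oBP : open BP by apply: open_comp.
have cU : C1_on BP U.
  have cPB : C1_on BP P' by exact: C1_on_linear.
  by have [] := C1_on_comp cPB cpsi (fun _ H => H) oBP.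
have UO xi : BP xi -> O (U xi) by move=> /psiP[/AO].
have [n [b [dd [bE dE]]]] := @dual_bases R Y.
pose fi i xi : R^o := ('d Q (U xi) (b i) : R) + inner ('d Phi (U xi) (b i)) (P xi).
have cfi i : C1_on BP (fi i).
  have [c1 _] := C1_on_comp cU (c2Q (b i)) UO oBP.
  have [c2 _] := C1_on_comp cU (c2Phi (b i)) UO oBP.
  have c3 : C1_on BP P by exact: C1_on_linear.
  by have [] := C1_on_add c1 (C1_on_inner oBP c2 c3) oBP.
(* The gradient at U xi of Q + <k, Phi> with k = P xi held fixed, assembled from evaluations at
   basis vectors because those are known to be C1. *)
pose G xi := \sum_i (fi i xi : R) *: dd i.
have GE xi v : inner (G xi) v = ('d Q (U xi) v : R) + inner (P xi) ('d Phi (U xi) v).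
  rewrite /G inner_suml.
  have -> : 'd Q (U xi) v = \sum_i inner v (dd i) * ('d Q (U xi) (b i) : R) :> R.
    by rewrite {1}(bE v) linear_sum; apply: eq_bigr => i _; exact: linearZ.
  have -> : 'd Phi (U xi) v = \sum_i inner v (dd i) *: 'd Phi (U xi) (b i).
    by rewrite {1}(bE v) linear_sum; apply: eq_bigr => i _; exact: linearZ.
  rewrite (innerC (P xi)) inner_suml -big_split/=; apply: eq_bigr => i _.
  by rewrite !innerZl /fi (innerC (dd i)); ring.
have cG : C1_on BP G.
  have c i : C1_on BP (fun xi => (fi i xi : R) *: dd i) by exact: C1_on_scaler.
  by have [] := C1_on_sum c oBP.
pose X xi := U xi + gamma *: G xi.
have cX : C1_on BP X.
  have [c1 _] := C1_on_linear_comp ( *:%R gamma : {linear Y -> Y}) oBP cG.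
  by have [] := C1_on_add cU c1 oBP.
have BP0 : BP 0 by change (B (P' 0)); rewrite (linear0 P').
have UN v : v \in N -> U v = u.
  by move=> vN; rewrite /U P'E [P v]orthproj_id// subrr.
(* On N the manifold point stays at [u] and only the multiplier varies, so [X] is affine there with
   linear part gamma. *)
have XN v : v \in N -> X v = u + gamma *: (y + v).
  move=> vN; rewrite /X UN//; congr (_ + _ *: _).
  apply: inner_inj => z; rewrite innerC GE UN// (nf_dQ nf) (nf_dPhi nf).
  by rewrite [P v]orthproj_id// -innerDl innerC.
have X0 : X 0 = u + gamma *: y by rewrite XN ?mem0v// addr0.
have [dX0 _] := cX 0 BP0; have [dU0 _] := cU 0 BP0.
pose tn (m : nat) : R := (m.+1%:R)^-1.
have t0 m : 0 < tn m by rewrite invr_gt0 ltr0n.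
have tc : tn @ \oo --> 0 by exact: cvg_harmonic.
have quot (F : Y -> Y) v : differentiable F 0 ->
    (tn m)^-1 *: (F (tn m *: v) - F 0) @[m --> \oo] --> 'd F 0 v.
  move=> dF; have cv : (fun _ : nat => v) @ \oo --> v by exact: cvg_cst.
  have := cvg_diff_quotient dF t0 tc cv.
  by under eq_fun do rewrite add0r.
have XLN v : v \in N -> 'd X 0 v = gamma *: v.
  move=> vN; have := quot X v dX0.
  have -> : (fun m => (tn m)^-1 *: (X (tn m *: v) - X 0)) = fun=> gamma *: v.
    apply/funext => m; rewrite X0 XN ?memvZ//.
    have -> : u + gamma *: (y + tn m *: v) - (u + gamma *: y) = tn m *: (gamma *: v) by hilbert_ring.
    by rewrite scalerK// gt_eqF.
  move=> H; apply/esym; apply: (cvg_unique _ _ H) => //; exact: cvg_cst.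
have dU v : v = P' v -> 'd U 0 v = v.
  have cPB : C1_on BP P' by exact: C1_on_linear.
  have [_ dUE] := C1_on_comp cPB cpsi (fun _ H => H) oBP.
  move=> vP'; apply: (etrans (dUE 0 v BP0)).
  by rewrite linear0 dpsi0 (diff_linear_fin P') -vP'.
have nearU : \forall xi \near (0 : Y), `|U xi - u| < d.
  have : U @ (0 : Y) --> U 0 by exact: differentiable_continuous.
  by rewrite U0 => /cvgrPdist_lt/(_ _ d0); apply: filterS => xi; rewrite distrC.
(* Coercivity on the orthogonal of N, read off difference quotients. The local bounds from [u] at U
   xi and from U xi at [u], both with multiplier 0, add up to monotonicity of the gradient up to 2
   rho |U xi - u|^2. *)
have coer v : v = P' v -> (1 - 2 * gamma * rho) * `|v| ^+ 2 <= inner ('d X 0 v) v.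
  move=> vP'.
  have q1 := quot X v dX0; have q2 := quot U v dU0.
  rewrite (dU v vP') in q2.
  have c1 : inner ((tn m)^-1 *: (X (tn m *: v) - X 0)) ((tn m)^-1 *: (U (tn m *: v) - U 0))
      @[m --> \oo] --> inner ('d X 0 v) v by exact: cvg_inner.
  have c2 : (1 - 2 * gamma * rho) * `|(tn m)^-1 *: (U (tn m *: v) - U 0)| ^+ 2 @[m --> \oo]
      --> (1 - 2 * gamma * rho) * `|v| ^+ 2.
    apply: cvgM; first exact: cvg_cst.
    rewrite -innerxx; under eq_fun do rewrite -innerxx.
    exact: cvg_inner.
  apply: (ler_cvg_to c2 c1).
  have tv0 : tn m *: v @[m --> \oo] --> (0 : Y) by rewrite -(scale0r v); exact: cvgZr_tmp.
  have nB : \forall xi \near (0 : Y), BP xi by exact: open_nbhs_nbhs.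
  have nU : \forall m \near \oo, `|U (tn m *: v) - u| < d by exact: (tv0 _ nearU).
  have nB' : \forall m \near \oo, BP (tn m *: v) by exact: (tv0 _ nB).
  apply: filterS2 nU nB' => m /= mU mB.
  set xi := tn m *: v in mU mB *; rewrite U0 X0.
  have Pxi : P xi = 0.
    by rewrite /xi linearZ/= vP' P'E linearB/= PP subrr scaler0.
  have Phxi : Phi (U xi) = P' xi by have [] := psiP _ mB.
  have i0 z : inner (0 : Y) z = 0 by rewrite inner0l.
  have K0 : linear_minorants h 0 by apply: minorant0; exact: nf_ge0 nf.
  have n0 : `|0 : Y| <= 1 by rewrite normr0.
  have uu : `|u - u| < d by rewrite subrr normr0.
  have hu : h (Phi u) = 0%E by rewrite (nf_Phi nf) sublinear0//; exact: nf_sublinear nf.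
  have hx : h (Phi (U xi)) = 0%E by rewrite Phxi hP'.
  have l1 := loc 0 (U xi) u K0 n0 mU uu hx (i0 _).
  have l2 := loc 0 u (U xi) K0 n0 uu mU hu (i0 _).
  rewrite (normal_form_value nf (UO _ mB) hx) lee_fin (nf_Q nf) (nf_dQ nf) i0 in l2.
  rewrite (normal_form_value nf Ou hu) lee_fin (nf_Q nf) i0 in l1.
  have GU : inner (G xi) (U xi - u) = - ('d Q (U xi) (u - U xi) : R).
    rewrite GE Pxi i0 addr0 -(opprB u); exact: linearN.
  rewrite innerZl innerZr normrZ exprMn.
  have tp : 0 < (tn m)^-1 by rewrite invr_gt0.
  rewrite (gtr0_norm tp) expr2 -!mulrA [leLHS]mulrC -!mulrA ler_pM2l// ler_pM2l//.
  have -> : X xi - (u + gamma *: y) = (U xi - u) + gamma *: (G xi - y) by rewrite /X; hilbert_ring.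
  rewrite innerDl innerxx innerZl innerBl GU.
  have : `|u - U xi| ^+ 2 = `|U xi - u| ^+ 2 by rewrite distrC.
  set a : R := 'd Q _ _ in l1 *; move=> nE; rewrite nE /= in l1.
  have : - (2 * rho * `|U xi - u| ^+ 2) <= - a - inner y (U xi - u) by lra.
  rewrite -(ler_pM2l g0); lra.
(* The differential maps P z to gamma P z, which is orthogonal to P' z; pairing with P' z therefore
   isolates the part that coercivity kills. *)
have Xinj z : 'd X 0 z = 0 -> z = 0.
  move=> Xz; have zE : z = P' z + P z by rewrite P'E subrK.
  have P'P' : P' z = P' (P' z) by rewrite !P'E linearB/= PP subrr subr0.
  have PN : P z \in N by exact: orthproj_in.
  have e1 : 'd X 0 (P' z) + gamma *: P z = 0.
    by rewrite -(XLN _ PN) -linearD -zE.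
  have : inner ('d X 0 (P' z)) (P' z) = 0.
    rewrite (_ : 'd X 0 (P' z) = - (gamma *: P z)); last by apply/eqP; rewrite -addr_eq0 e1.
    by rewrite innerNl innerZl orth// mulr0 oppr0.
  have := coer _ P'P' => /[swap] ->.
  rewrite pmulr_rle0 ?subr_gt0//.
  move=> n0; have : `|P' z| ^+ 2 == 0 by rewrite eq_le n0 sqr_ge0.
  rewrite sqrf_eq0 normr_eq0 => /eqP P'z0.
  move: e1; rewrite P'z0 linear0 add0r => /eqP; rewrite scaler_eq0 gt_eqF//= => /eqP Pz0.
  by rewrite [LHS]zE P'z0 add0r; exact: Pz0.
have [r r0 rP] : exists2 r : R, 0 < r & forall xi, `|xi - 0| < r -> BP xi /\ `|U xi - u| < d /\ `|xi| < e.
  apply/nbhs_normP; apply: filterI; first exact: open_nbhs_nbhs.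
  apply: filterI; first exact: nearU.
  by apply/nbhs_normP; exists e => // z; rewrite subr0.
pose O' := [set xi : Y | `|xi - 0| < r].
have oO' : open O'.
  have -> : O' = (fun xi : Y => `|xi - 0|) @^-1` [set s | s < r] by [].
  apply: open_comp; last exact: open_lt.
  by move=> z _; apply: cvg_norm; apply: cvgB; [exact: cvg_id|exact: cvg_cst].
have O'0 : O' 0 by rewrite /O'/= subrr normr0.
have cX' : C1_on O' X by apply: C1_on_sub cX => xi /rP[].
have [A' [B' [chi [[_ _ A'O'] [oB' B'0] cchi chiP _]]]] := inverse_function oO' O'0 cX' Xinj.
rewrite X0 in B'0.
exists B', (fun x => U (chi x)), (fun x => P (chi x)); split.
- exact: oB'.
- exact: B'0.
- have chiB x : B' x -> BP (chi x) by move=> /chiP[/A'O'/rP[]].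
  by have [] := C1_on_comp cchi cU chiB oB'.
- move=> x /chiP[/A'O'/rP[BPx [Ux xe]] _]; split=> //.
  + exact: orthproj_in.
  + apply: le_lt_trans xe.
    have : `|P (chi x)| ^+ 2 <= `|chi x| ^+ 2.
      rewrite -{2}(subrK (P (chi x)) (chi x)) normD_sqr innerC.
      by rewrite orthproj_orth ?orthproj_in// mulr0 addr0 lerDr sqr_ge0.
    by rewrite ler_pXn2r// nnegrE.
  + by have [_ ->] := psiP _ BPx; exact: hP'.
- move=> x /chiP[/A'O'/rP[BPx [Ux xe]] Xx]; split.
    by have [_ ->] := psiP _ BPx; rewrite orth// orthproj_in.
  move=> v; rewrite -{1}Xx /X addrC addKr innerZl GE.
  by [].
Qed.

(** The defects [rho] of the local bounds and [kap] of the global bound are kept apart so that the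
    convex case can set both to 0. Near [u] stationarity cancels the linear terms and the objective
    grows like (s - rho) |w - p x|^2; at distance at least [d] the global bound excludes
    minimizers. *)
Lemma prox_C1_of_ri (gamma d rho kap : R) : 0 < gamma -> 0 < d -> 0 <= rho ->
  2 * gamma * rho < 1 -> (forall z, `|z - u| < d -> O z) ->
  local_lower_bound g u Q Phi h d rho ->
  2 * gamma * kap < 1 ->
  (forall w, ((fine (g u) + inner y (w - u) - kap * `|w - u| ^+ 2)%:E <= g w)%E) ->
  ri (subdiff g u) y -> prox_C1_around gamma g (u + gamma *: y).
Proof.
move=> g0 d0 rho0 gr dO loc gk glob /(normal_form_ri nf)[r r0 rP].
have e0 : 0 < Num.min r 1 by rewrite lt_min r0 ltr01.
have [W [p [k [oW Wx cp pP kP]]]] := stationary_chart g0 d0 rho0 gr dO loc e0.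
have Ou := nf_in nf.
have hNy z : (-oo < h z)%E by exact: lt_le_trans (nf_ge0 nf z).
have hu : h (Phi u) = 0%E by rewrite (nf_Phi nf) sublinear0//; exact: nf_sublinear nf.
pose s := (2 * gamma)^-1; have s0 : 0 < s by rewrite invr_gt0 mulr_gt0.
have sg : 2 * gamma * s = 1 by rewrite mulfV// gt_eqF// mulr_gt0.
have sgE c : s * (2 * (gamma * c)) = c.
  have -> : s * (2 * (gamma * c)) = 2 * gamma * s * c by ring.
  by rewrite sg mul1r.
have sk : 0 < s - kap by rewrite -(pmulr_lgt0 _ (mulr_gt0 (ltr0n _ 2) g0)) mulrC mulrBr sg subr_gt0.
have sr : 0 < s - rho by rewrite -(pmulr_lgt0 _ (mulr_gt0 (ltr0n _ 2) g0)) mulrC mulrBr sg subr_gt0.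
pose x0 := u + gamma *: y.
(* Keeps the effect of x - x0 below the margin (s - kap) |w - u|^2 whenever |w - u| >= d. *)
pose eta := gamma * (s - kap) * d.
have eta0 : 0 < eta by rewrite !mulr_gt0.
pose W' := W `&` [set x | `|x - x0| < eta].
have oW' : open W'.
  apply: openI => //.
  have -> : [set x | `|x - x0| < eta] = (fun x : Y => `|x - x0|) @^-1` [set t | t < eta] by [].
  apply: open_comp; last exact: open_lt.
  by move=> z _; apply: cvg_norm; apply: cvgB; [exact: cvg_id|exact: cvg_cst].
exists W', p; split.
- by split=> //; split=> //=; rewrite subrr normr0.
- move=> x [Wx' xeta].
  have [pd kN ke hp] := pP x Wx'; have [kp st] := kP x Wx'.
  (* The relative interior enters here: small multipliers in N are minorants. *)
  have Kk : linear_minorants h (k x).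
    by apply: rP => //; apply: lt_le_trans ke _; rewrite ge_min lexx.
  have k1 : `|k x| <= 1 by apply: ltW; apply: lt_le_trans ke _; rewrite ge_min lexx orbT.
  have gp := normal_form_value nf (dO _ pd) hp.
  pose v0 : R := fine (g u) + Q (p x) + s * `|p x - x| ^+ 2.
  have objp : moreau_objective gamma g x (p x) = v0%:E.
    by rewrite /moreau_objective gp -EFinD.
  have near w : `|w - u| < d ->
      ((v0 + (s - rho) * `|w - p x| ^+ 2)%:E <= moreau_objective gamma g x w)%E.
    move=> wd; have := loc (k x) (p x) w Kk k1 pd wd hp kp.
    rewrite /moreau_objective -/s; case: (g w) => [t| |]; last 2 first.
    - by move=> _; rewrite addye// leey.
    - by rewrite leeNy_eq => /eqP.
    rewrite -EFinD !lee_fin => H.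
    have nE : `|w - x| ^+ 2 = `|w - p x| ^+ 2 - 2 * inner (x - p x) (w - p x) + `|p x - x| ^+ 2.
      have -> : w - x = (w - p x) - (x - p x) by hilbert_ring.
      by rewrite [LHS]normB_sqr (innerC (w - p x)) (distrC x).
    have stw := st (w - p x).
    rewrite nE /v0 stw.
    set a : R := 'd Q _ _ in H *; set b := inner (k x) _ in H *.
    have := sgE (a + b).
    lra.
  have far w : d <= `|w - u| -> (v0%:E < moreau_objective gamma g x w)%E.
    move=> dw; have := glob w; rewrite /moreau_objective -/s; case: (g w) => [t| |]; last 2 first.
    - by move=> _; rewrite addye// ltry.
    - by rewrite leeNy_eq => /eqP.
    rewrite -EFinD lee_fin lte_fin => H.
    have uu : `|u - u| < d by rewrite subrr normr0.
    have := near u uu; rewrite /moreau_objective -/s (normal_form_value nf Ou hu) (nf_Q nf) addr0.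
    rewrite -EFinD lee_fin => v0u.
    have {}v0u : v0 <= fine (g u) + s * `|u - x| ^+ 2.
      by apply: le_trans v0u; rewrite lerDl mulr_ge0 ?sqr_ge0// ltW.
    have nE : `|w - x| ^+ 2 = `|w - u| ^+ 2 - 2 * inner (w - u) (x - u) + `|u - x| ^+ 2.
      have -> : w - x = (w - u) - (x - u) by hilbert_ring.
      by rewrite [LHS]normB_sqr (distrC x).
    have xE : inner (w - u) (x - u) = gamma * inner y (w - u) + inner (w - u) (x - x0).
      by rewrite (innerC y) /x0 !innerE; ring.
    have i1 : inner (w - u) (x - x0) < `|w - u| * eta.
      apply: le_lt_trans (le_inner_norm _ _) _.
      by rewrite ltr_pM2l// (lt_le_trans d0).
    have i2 : `|w - u| * eta <= gamma * (s - kap) * `|w - u| ^+ 2.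
      have -> : `|w - u| * eta = gamma * (s - kap) * (d * `|w - u|) by rewrite /eta; ring.
      rewrite ler_pM2l ?mulr_gt0// expr2.
      by rewrite ler_wpM2r.
    have i3 : s * (2 * inner (w - u) (x - x0)) < (s - kap) * `|w - u| ^+ 2.
      have : s * (2 * inner (w - u) (x - x0)) < s * (2 * (gamma * (s - kap) * `|w - u| ^+ 2)).
        by rewrite !ltr_pM2l//; exact: lt_le_trans i1 i2.
      move=> /lt_le_trans; apply; rewrite le_eqVlt; apply/orP; left; apply/eqP.
      by rewrite -(mulrA gamma) sgE.
    have e1 : s * (2 * (gamma * inner y (w - u))) = inner y (w - u) by exact: sgE.
    rewrite nE xE; lra.
  apply/seteqP; split=> [w [wfin wmin]|_ ->] /=.
    have := wmin (p x); rewrite objp => wp.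
    have [wd|dw] := ltP `|w - u| d; last first.
      by have := lt_le_trans (far w dw) wp; rewrite ltxx.
    have := le_trans (near w wd) wp; rewrite lee_fin gerDl pmulr_rle0// => n0.
    have : `|w - p x| ^+ 2 == 0 by rewrite eq_le n0 sqr_ge0.
    by rewrite sqrf_eq0 normr_eq0 subr_eq0 => /eqP.
  split; first by rewrite -/(moreau_objective gamma g x (p x)) objp ltry.
  move=> w; rewrite objp; have [wd|/far/ltW//] := ltP `|w - u| d.
  apply: le_trans (near w wd); rewrite lee_fin lerDl mulr_ge0 ?sqr_ge0//.
  exact: ltW.
- by apply: C1_on_sub cp => x [].
Qed.

End ProxSmooth.

(** * Second order behavior of the envelope *)

Section EnvelopeSmooth.
Context {R : realType} {Y : finHilbertType R}.

Lemma is_derive_line (f : Y -> R^o) (x v : Y) (t : R) :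
  differentiable f (x + t *: v) ->
  is_derive t (1 : R) (fun s : R => f (x + s *: v) : R) ('d f (x + t *: v) v).
Proof.
move=> df.
have dp : is_diff t (fun s : R => x + s *: v) (fun s : R => s *: v).
  by apply: is_diff_eq; apply/funext => s; rewrite /= !fctE add0r.
have dfp : differentiable (f \o (fun s : R => x + s *: v)) t by apply: differentiable_comp.
apply: DeriveDef; first exact: diff_derivable.
rewrite deriveE// diff_comp//=.
by rewrite [X in 'd f _ X](_ : _ = v)// diff_val scale1r.
Qed.

(** One mean value step suffices: after subtraction of the quadratic, the derivative along the
    segment is within M s of 0. *)
Lemma taylor2_line (f : Y -> R^o) (x v : Y) (t a b M : R) : 0 < t ->
  (forall s, 0 <= s <= t -> differentiable f (x + s *: v)) ->
  (forall s, 0 <= s <= t -> `|('d f (x + s *: v) v : R) - (a + b * s)| <= M * s) ->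
  0 <= M ->
  `|(f (x + t *: v) : R) - f x - (a * t + b / 2 * t ^+ 2)| <= M * t ^+ 2.
Proof.
move=> t0 df dM M0.
pose phi (s : R) : R := (f (x + s *: v) : R) - (a * s + b / 2 * (s * s)).
have dphi s : 0 <= s <= t -> is_derive s (1 : R) phi ('d f (x + s *: v) v - (a + b * s)).
  move=> st; have d1 := is_derive_line (df s st).
  have d2 : is_derive s (1 : R) (fun s : R => a * s + b / 2 * (s * s)) (a + b * s).
    by apply: is_derive_eq; rewrite /GRing.scale/=; field.
  exact: is_deriveB.
have [s st E] : exists2 s : R, s \in `]0, t[ & phi t - phi 0 =
    ('d f (x + s *: v) v - (a + b * s)) * (t - 0).
  apply: MVT => // [s|].
    by rewrite in_itv/= => /andP[s0 s1]; apply: dphi; rewrite !ltW.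
  apply: derivable_within_continuous => s; rewrite in_itv/= => st.
  by have [] := dphi s st.
move: st; rewrite in_itv/= => /andP[s0 s1].
have -> : (f (x + t *: v) : R) - f x - (a * t + b / 2 * t ^+ 2) = phi t - phi 0.
  by rewrite /phi scale0r addr0; ring.
rewrite E subr0 normrM (gtr0_norm t0) expr2 mulrA; apply: ler_wpM2r; first exact: ltW.
apply: (le_trans (dM s _)); first by rewrite !ltW.
by apply: ler_wpM2l => //; exact: ltW.
Qed.

Variables (g : Y -> \bar R) (u y : Y) (O : set Y) (Q : Y -> R^o) (Phi : Y -> Y)
  (h : Y -> \bar R).
Hypothesis nf : normal_form g u y O Q Phi h.

(* Test points on the curve [Phi w = s n], with [s] proportional to [t]. *)
Lemma envelope_drop (gamma : R) (n : Y) : 0 < gamma -> h n = 0%E -> n != 0 ->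
  exists c d : R, [/\ 0 < c, 0 < d & forall t, 0 < t < d ->
    (envelope gamma g (u + gamma *: (y + t *: n))%R <=
      (fine (g u) + gamma / 2 * `|y + t *: n| ^+ 2 - c * t ^+ 2)%:E)%E].
Proof.
move=> g0 hn n0.
have oO := nf_open nf; have Ou := nf_in nf.
have [cQ _] := nf_C2Q nf; have [cPhi _] := nf_C2Phi nf.
have inj a : 'd Phi u a = 0 -> a = 0 by rewrite (nf_dPhi nf).
have [A [B [psi [[oA Au AO] [oB B0] cpsi psiP Apsi]]]] := inverse_function oO Ou cPhi inj.
rewrite (nf_Phi nf) in B0.
have psi0 : psi 0 = u by have [_ + _] := Apsi u Au; rewrite (nf_Phi nf).
have dpsi0 v : 'd psi 0 v = v.
  by have [_ _ /(_ v)] := Apsi u Au; rewrite (nf_Phi nf) (nf_dPhi nf).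
have [d1 [M [d10 M0 P1]]] := C2_on_remainder norming_real oO Ou (nf_C2Q nf).
have [dpsi _] := cpsi 0 B0.
have q0 : (0 : R) < 1 / 4 by rewrite divr_gt0.
have [d2 d20 P2] := diff_remainder dpsi q0.
have [d3 d30 P3] := open_norm_ball oB B0.
have np : 0 < `|n| by rewrite normr_gt0.
(* [K] collects the two quadratic costs, the remainder of [Q] and the proximal penalty. The choice
   of [ep] makes the cost bound 2 K (s |n|)^2 half of the guaranteed gain t s |n|^2 / 2, so a net
   drop c t^2 remains. *)
pose K : R := M + (2 * gamma)^-1.
have ig0 : 0 < (2 * gamma)^-1 by rewrite invr_gt0 mulr_gt0.
have K0 : 0 < K by rewrite addr_gt0.
pose ep : R := (8 * K)^-1; have ep0 : 0 < ep by rewrite invr_gt0 mulr_gt0.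
pose dd := Num.min d2 (Num.min d3 (d1 / 2)).
have dd0 : 0 < dd by rewrite !lt_min d20 d30 divr_gt0.
exists (ep * `|n| ^+ 2 / 4), (dd / `|n| / ep); split.
- by rewrite divr_gt0// mulr_gt0// exprn_gt0.
- by rewrite !divr_gt0.
move=> t /andP[t0 td].
pose s := ep * t; have s0 : 0 < s by rewrite mulr_gt0.
have snE : `|s *: n| = s * `|n| by rewrite normrZ gtr0_norm.
have : s * `|n| < dd by rewrite -ltr_pdivlMr// /s mulrC -ltr_pdivlMr.
rewrite !lt_min => /and3P[s1 s2 s3].
have Bs : B (s *: n) by apply: P3; rewrite subr0 snE.
have [Aw Phw] := psiP _ Bs; set w := psi (s *: n) in Aw Phw.
have := P2 (s *: n); rewrite snE add0r psi0 dpsi0 -/w => /(_ s1) rem.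
have wu : `|w - u| <= 5 / 4 * (s * `|n|).
  rewrite -(subrK (s *: n) (w - u)); apply: le_trans (ler_normD _ _) _.
  by rewrite snE; lra.
have sn0 : 0 < s * `|n| by rewrite mulr_gt0.
have wd : `|w - u| < d1 by apply: le_lt_trans wu _; lra.
have uu : `|u - u| < d1 by rewrite subrr normr0.
have := P1 w u wd uu; rewrite (nf_Q nf) subr0 => Qrem.
have {}Qrem : `|(Q w : R) - 'd Q u (w - u)| <= M * `|w - u| ^+ 2 by exact: Qrem.
rewrite (nf_dQ nf) ler_norml in Qrem; move: Qrem => /andP[_ Qrem].
have w2 : `|w - u| ^+ 2 <= 2 * (s * `|n|) ^+ 2.
  have : `|w - u| ^+ 2 <= (5 / 4 * (s * `|n|)) ^+ 2.
    by rewrite ler_pXn2r// nnegrE// mulr_ge0// ltW.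
  have : 0 <= (s * `|n|) ^+ 2 by exact: sqr_ge0.
  rewrite exprMn; lra.
have nw : s * `|n| ^+ 2 / 2 <= inner n (w - u).
  have : - (1 / 4 * (s * `|n|) * `|n|) <= inner n (w - u - s *: n).
    rewrite lerNl; apply: le_trans (ler_norm _) _; rewrite normrN.
    apply: le_trans (norm_inner_le _ _) _; rewrite mulrC ler_wpM2r//.
  rewrite innerBr innerZr innerxx.
  have : 0 <= s * `|n| ^+ 2 by rewrite mulr_ge0 ?sqr_ge0// ltW.
  have -> : 1 / 4 * (s * `|n|) * `|n| = 1 / 4 * (s * `|n| ^+ 2) by ring.
  lra.
apply: (le_trans (ereal_inf_lbound (S := range _) (ex_intro2 _ _ w I erefl))).
rewrite /moreau_objective (nf_eq nf (AO _ Aw)) Phw.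
have -> : h (s *: n) = 0%E by case: (nf_sublinear nf) => _ -> //; rewrite hn mule0.
rewrite adde0 -{1}(fineK (nf_fin nf)) -!EFinD lee_fin.
set z := y + t *: n.
have -> : `|w - (u + gamma *: z)| ^+ 2 = `|w - u| ^+ 2 - 2 * gamma * inner z (w - u) + gamma ^+ 2 * `|z| ^+ 2.
  have -> : w - (u + gamma *: z) = (w - u) - gamma *: z by hilbert_ring.
  by rewrite normB_sqr innerZr normrZ exprMn (gtr0_norm g0) (innerC (w - u)); ring.
have -> : (2 * gamma)^-1 * (`|w - u| ^+ 2 - 2 * gamma * inner z (w - u) + gamma ^+ 2 * `|z| ^+ 2) =
    (2 * gamma)^-1 * `|w - u| ^+ 2 - inner z (w - u) + gamma / 2 * `|z| ^+ 2.
  by field; rewrite gt_eqF.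
have zE : inner z (w - u) = inner y (w - u) + t * inner n (w - u) by rewrite innerDl innerZl.
have tn : t * (s * `|n| ^+ 2 / 2) <= t * inner n (w - u) by rewrite ler_pM2l.
have Kw : K * `|w - u| ^+ 2 <= K * (2 * (s * `|n|) ^+ 2) by rewrite ler_pM2l.
have KE : K * (2 * (s * `|n|) ^+ 2) = ep * `|n| ^+ 2 / 4 * t ^+ 2.
  by rewrite /s /ep; field; rewrite gt_eqF.
have tE : t * (s * `|n| ^+ 2 / 2) = 2 * (ep * `|n| ^+ 2 / 4 * t ^+ 2).
  by rewrite /s; field.
have KwE : K * `|w - u| ^+ 2 = M * `|w - u| ^+ 2 + (2 * gamma)^-1 * `|w - u| ^+ 2.
  by rewrite /K mulrDl.
rewrite zE; lra.
Qed.

(** The condition gamma r <= 1 makes [u] minimize the objective at u + gamma (y + k) for every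
    minorant [k] in the unit ball. The contradiction sets a Taylor expansion accurate to c t^2 / 2
    against a drop of c t^2. *)
Lemma ri_of_envelope_C2 (gamma r : R) : 0 < gamma -> gamma * r <= 1 ->
  (forall k w, linear_minorants h k -> `|k| <= 1 ->
    ((fine (g u) + inner (y + k) (w - u) - r / 2 * `|w - u| ^+ 2)%:E <= g w)%E) ->
  envelope_C2_around gamma g (u + gamma *: y) -> ri (subdiff g u) y.
Proof.
move=> g0 gr glob [W [[oW Wx] efin [ce c2e]]].
apply/(normal_form_ri nf).
apply: (minorants_ball (nf_lsc nf) (nf_sublinear nf) (nf_ge0 nf)) => n nN hn.
apply: contrapT => /eqP n0.
pose e (x : Y) : R^o := fine (envelope gamma g x).
pose x0 := u + gamma *: y.
pose sg : R := (2 * gamma)^-1.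
have sg0 : 0 < sg by rewrite invr_gt0 mulr_gt0.
have sgE : sg * (2 * gamma) = 1 by rewrite mulVf// gt_eqF// mulr_gt0.
have eE x : W x -> envelope gamma g x = (e x : R)%:E by move=> Wx'; rewrite /e fineK// efin.
have eub x : W x -> (e x : R) <= fine (g u) + sg * `|u - x| ^+ 2.
  move=> Wx'; rewrite -lee_fin -eE//.
  apply: (le_trans (ereal_inf_lbound (S := range _) (ex_intro2 _ _ u I erefl))).
  by rewrite /moreau_objective -{1}(fineK (nf_fin nf)) -EFinD.
(* Testing at [u] gives one inequality, the quadratic lower bound of slope y + k the other. *)
have eK k : linear_minorants h k -> `|k| <= 1 -> W (u + gamma *: (y + k)) ->
    (e (u + gamma *: (y + k)) : R) = fine (g u) + gamma / 2 * `|y + k| ^+ 2.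
  move=> Kk k1 Wk; apply/eqP; rewrite eq_le; apply/andP; split.
    apply: le_trans (eub _ Wk) _; rewrite opprD addNKr normrN normrZ exprMn (gtr0_norm g0).
    by rewrite lerD2l le_eqVlt; apply/orP; left; apply/eqP; rewrite /sg; field; rewrite gt_eqF.
  rewrite -lee_fin -eE//; apply: le_ereal_inf_tmp => _ [w _ <-].
  have := glob k w Kk k1; rewrite /moreau_objective; case: (g w) => [t| |]; last 2 first.
  - by move=> _; rewrite addye// leey.
  - by rewrite leeNy_eq => /eqP.
  rewrite -EFinD !lee_fin; set z := y + k => H.
  have -> : `|w - (u + gamma *: z)| ^+ 2 = `|w - u| ^+ 2 - 2 * gamma * inner z (w - u) + gamma ^+ 2 * `|z| ^+ 2.
    have -> : w - (u + gamma *: z) = (w - u) - gamma *: z by hilbert_ring.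
    by rewrite normB_sqr innerZr normrZ exprMn (gtr0_norm g0) (innerC (w - u)); ring.
  have -> : (2 * gamma)^-1 * (`|w - u| ^+ 2 - 2 * gamma * inner z (w - u) + gamma ^+ 2 * `|z| ^+ 2) =
      sg * `|w - u| ^+ 2 - inner z (w - u) + gamma / 2 * `|z| ^+ 2.
    by rewrite /sg; field; rewrite gt_eqF.
  have : r / 2 * `|w - u| ^+ 2 <= sg * `|w - u| ^+ 2.
    rewrite ler_wpM2r ?sqr_ge0// /sg -[leRHS]mul1r ler_pdivlMr ?mulr_gt0//.
    by rewrite (_ : r / 2 * (2 * gamma) = gamma * r)//; field.
  lra.
pose tn (m : nat) : R := (m.+1%:R)^-1.
have t0 m : 0 < tn m by rewrite invr_gt0 ltr0n.
have t1 m : tn m <= 1 by rewrite invf_le1 ?ltr0n// ler1n.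
have tc : tn @ \oo --> 0 by exact: cvg_harmonic.
have K0 : linear_minorants h 0 by apply: minorant0; exact: nf_ge0 nf.
(* The envelope touches from below the smooth function [x |-> obj_x(u)] at
   each point [u + gamma (y + k)], so their gradients agree there. *)
have grad k v : linear_minorants h k -> `|k| <= 1 -> W (u + gamma *: (y + k)) ->
    ('d e (u + gamma *: (y + k)) v : R) = inner (y + k) v.
  move=> Kk k1 Wk; set x := u + _ in Wk *.
  suff H v' : ('d e x v' : R) <= inner (y + k) v'.
    apply/eqP; rewrite eq_le H/= -lerN2 -innerNr.
    have -> : - ('d e x v : R) = 'd e x (- v) by apply/esym; exact: linearN.
    exact: H.
  have [de _] := ce x Wk.
  have cv : (fun _ : nat => v') @ \oo --> v' by exact: cvg_cst.
  have q1 := cvg_diff_quotient de t0 tc cv.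
  have q2 : inner (y + k) v' + tn m * (sg * `|v'| ^+ 2) @[m --> \oo] --> inner (y + k) v' + 0 * (sg * `|v'| ^+ 2).
    by apply: cvgD; [exact: cvg_cst|apply: cvgM; [exact: tc|exact: cvg_cst]].
  rewrite -[leRHS]addr0 -(mul0r (sg * `|v'| ^+ 2)).
  apply: (ler_cvg_to q1 q2).
  have tv0 : x + tn m *: v' @[m --> \oo] --> x.
    rewrite -[X in _ --> X]addr0 -(scale0r v').
    by apply: cvgD; [exact: cvg_cst|exact: cvgZr_tmp].
  have nW : \forall z \near x, W z by exact: open_nbhs_nbhs.
  have nW' : \forall m \near \oo, W (x + tn m *: v') by exact: (tv0 _ nW).
  apply: filterS nW' => m Wm.
  rewrite -[_ *: _]/((tn m)^-1 * _) ler_pdivrMl//.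
  have ex := eK k Kk k1 Wk; rewrite -/x in ex.
  have := eub _ Wm; change (e (x + tn m *: v') <= fine (g u) + sg * `|u - (x + tn m *: v')| ^+ 2 ->
    e (x + tn m *: v') - e x <= tn m * (inner (y + k) v' + tn m * (sg * `|v'| ^+ 2))).
  rewrite ex.
  have -> : `|u - (x + tn m *: v')| ^+ 2 = gamma ^+ 2 * `|y + k| ^+ 2 + 2 * gamma * tn m * inner (y + k) v' + tn m ^+ 2 * `|v'| ^+ 2.
    have -> : u - (x + tn m *: v') = - (gamma *: (y + k) + tn m *: v') by rewrite /x; hilbert_ring.
    set z := y + k; rewrite normrN normD_sqr !normrZ !exprMn (gtr0_norm g0) (gtr0_norm (t0 m)).
    by rewrite innerZl innerZr; ring.
  have -> : sg * (gamma ^+ 2 * `|y + k| ^+ 2 + 2 * gamma * tn m * inner (y + k) v' + tn m ^+ 2 * `|v'| ^+ 2) =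
      gamma / 2 * `|y + k| ^+ 2 + tn m * inner (y + k) v' + tn m ^+ 2 * (sg * `|v'| ^+ 2).
    by rewrite /sg; field; rewrite gt_eqF.
  rewrite expr2; lra.
have x0E : u + gamma *: (y + 0) = x0 by rewrite addr0.
have grad0 v : ('d e x0 v : R) = inner y v.
  have Wx0 : W (u + gamma *: (y + 0)) by rewrite x0E.
  by have := grad 0 v K0; rewrite normr0 ler01 x0E addr0 => /(_ isT Wx).
pose D := 'd (fun z => 'd e z n) x0.
have [dD _] := c2e n x0 Wx.
(* Multiples t k with 0 < t <= 1 are again minorants since h >= 0, so the gradient along the segment
   is y + t k and the difference quotients are eventually constant. *)
have DK k : linear_minorants h k -> (D (gamma *: k) : R) = inner k n.
  move=> Kk.
  have cv : (fun _ : nat => gamma *: k) @ \oo --> gamma *: k by exact: cvg_cst.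
  have q1 := cvg_diff_quotient dD t0 tc cv.
  apply: (cvg_unique _ q1); first exact: norm_hausdorff.
  have tk0 : x0 + tn m *: (gamma *: k) @[m --> \oo] --> x0.
    rewrite -[X in _ --> X]addr0 -(scale0r (gamma *: k)).
    by apply: cvgD; [exact: cvg_cst|exact: cvgZr_tmp].
  have nW : \forall z \near x0, W z by exact: open_nbhs_nbhs.
  have nW' : \forall m \near \oo, W (x0 + tn m *: (gamma *: k)) by exact: (tk0 _ nW).
  have tk1 : `|tn m *: k| @[m --> \oo] --> (0 : R).
    by rewrite -(normr0 Y) -(scale0r k); apply: cvg_norm; exact: cvgZr_tmp.
  have nk : \forall m \near \oo, `|tn m *: k| < 1 by apply: (cvgr_lt _ tk1); exact: ltr01.
  apply: cvg_near_cst; apply: filterS2 nW' nk => m Wm km.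
  have xE : x0 + tn m *: (gamma *: k) = u + gamma *: (y + tn m *: k) by rewrite /x0; hilbert_ring.
  have Kt : linear_minorants h (tn m *: k).
    move=> z; rewrite innerZl; have := Kk z; have := nf_ge0 nf z.
    case: (h z) => [s| |]//; last by move=> _ _; rewrite leey.
    by rewrite !lee_fin => s0 ks; have := t1 m; have := t0 m; nra.
  rewrite xE in Wm *; rewrite (grad _ n Kt (ltW km) Wm) grad0 innerDl addrAC subrr add0r innerZl.
  by rewrite -[_ *: _]/((tn m)^-1 * _) mulKf// gt_eqF.
have DN : (D (gamma *: n) : R) = `|n| ^+ 2.
  rewrite -innerxx.
  apply: (@lin_span_ind R Y (linear_minorants h) [set k | (D (gamma *: k) : R) = inner k n]) nN.
  - by rewrite /= scaler0 inner0l; exact: linear0.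
  - move=> a k k' /= Hk Hk'; rewrite innerDl innerZl -Hk -Hk'.
    have -> : gamma *: (a *: k + k') = a *: (gamma *: k) + gamma *: k' by hilbert_ring.
    exact: linearP.
  - by move=> k Kk; exact: DK.
have [c [d [c0 d0 drop]]] := envelope_drop g0 hn n0.
have np : 0 < `|n| by rewrite normr_gt0.
(* Tuned so that, with the factor gamma and |s v| = s gamma |n|, the error in the derivative is c s
   / 2. *)
pose e1 : R := c / 2 / (gamma ^+ 2 * `|n|).
have gn0 : 0 < gamma ^+ 2 * `|n| by rewrite mulr_gt0// exprn_gt0.
have e10 : 0 < e1 by rewrite !divr_gt0.
have [d1 d10 P1] := diff_remainder dD e10.
have [d2 d20 P2] := open_norm_ball oW Wx.
pose t := Num.min d (Num.min (d1 / (gamma * `|n|)) (d2 / (gamma * `|n|))) / 2.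
have gn : 0 < gamma * `|n| by rewrite mulr_gt0.
have t_gt0 : 0 < t by rewrite divr_gt0// !lt_min d0 !divr_gt0.
have : t < Num.min d (Num.min (d1 / (gamma * `|n|)) (d2 / (gamma * `|n|))).
  by rewrite /t ltr_pdivrMr// ltr_pMr ?ltr1n// !lt_min d0 !divr_gt0.
rewrite !lt_min => /and3P[td td1 td2].
rewrite ltr_pdivlMr// in td1; rewrite ltr_pdivlMr// in td2.
clearbody t; pose v := gamma *: n.
have nv s : 0 <= s <= t -> `|s *: v| = s * (gamma * `|n|).
  by move=> /andP[s0 _]; rewrite !normrZ ger0_norm// gtr0_norm.
have sle s : 0 <= s <= t -> s * (gamma * `|n|) <= t * (gamma * `|n|).
  by move=> /andP[_ s1]; rewrite ler_wpM2r// ltW.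
have Ws s : 0 <= s <= t -> W (x0 + s *: v).
  move=> st; apply: P2; rewrite addrC addKr nv//.
  exact: le_lt_trans (sle s st) td2.
have ts : (0 <= t <= t)%R by rewrite lexx ltW.
have dv x : ('d e x v : R) = gamma * ('d e x n : R) by exact: linearZ.
have := @taylor2_line e x0 v t (gamma * inner y n) (gamma * `|n| ^+ 2) (c / 2) t_gt0 (fun s st => proj1 (ce _ (Ws s st))).
have H s : 0 <= s <= t -> `|('d e (x0 + s *: v) v : R) - (gamma * inner y n + gamma * `|n| ^+ 2 * s)| <= c / 2 * s.
  move=> st; rewrite dv.
  have sd1 : `|s *: v| < d1 by rewrite nv//; exact: le_lt_trans (sle s st) td1.
  have H := P1 _ sd1.
  have {}H : `|('d e (x0 + s *: v) n : R) - ('d e x0 n : R) - (D (s *: v) : R)| <= e1 * `|s *: v| by exact: H.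
  have Ds : (D (s *: v) : R) = s * `|n| ^+ 2 by rewrite -DN; exact: linearZ.
  rewrite Ds grad0 nv// in H.
  have -> : gamma * ('d e (x0 + s *: v) n : R) - (gamma * inner y n + gamma * `|n| ^+ 2 * s) =
    gamma * (('d e (x0 + s *: v) n : R) - inner y n - s * `|n| ^+ 2) by ring.
  rewrite normrM (gtr0_norm g0).
  have -> : c / 2 * s = gamma * (e1 * (s * (gamma * `|n|))).
    by rewrite /e1; field; rewrite !gt_eqF.
  by rewrite ler_pM2l.
have c20 : 0 <= c / 2 by rewrite divr_ge0// ltW.
move=> /(_ H c20); rewrite ler_norml => /andP[lo _].
have tdd : 0 < t < d by rewrite t_gt0.
have := drop t tdd.
have xtE : u + gamma *: (y + t *: n) = x0 + t *: v by rewrite /x0 /v; hilbert_ring.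
rewrite xtE eE; last exact: Ws.
rewrite lee_fin.
have e0E : (e x0 : R) = fine (g u) + gamma / 2 * `|y| ^+ 2.
  have := eK 0 K0; rewrite normr0 ler01 x0E addr0 => /(_ isT Wx); exact.
move: lo; rewrite e0E normD_sqr normrZ exprMn (gtr0_norm t_gt0) innerZr.
have ct : 0 < c * t ^+ 2 by rewrite mulr_gt0// exprn_gt0.
set E : R := e _; move=> lo up.
have : E <= fine (g u) + gamma / 2 * `|y| ^+ 2 + (gamma * inner y n * t + gamma * `|n| ^+ 2 / 2 * t ^+ 2) - c * t ^+ 2.
  apply: le_trans up _; rewrite le_eqVlt; apply/orP; left; apply/eqP.
  by field.
lra.
Qed.

End EnvelopeSmooth.

(** * The convex case and the equivalences *)

Section Assembly.
Context {R : realType} {Y : finHilbertType R}.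
Implicit Types (g h : Y -> \bar R) (u y : Y).

Lemma prox_bounded_gtNy g w : prox_bounded g -> (-oo < g w)%E.
Proof. by case=> al [m /(_ w)]; case: (g w) => //= ?; rewrite ltNyr. Qed.

(** Convexity gives the local and the global bound with defect 0, so the smallness conditions on
    gamma in [prox_C1_of_ri] become trivial. *)
Lemma convex_prox_C1_of_ri g u y (O : set Y) (Q : Y -> R^o) (Phi : Y -> Y) h (d rho gamma : R) :
  normal_form g u y O Q Phi h -> 0 < d -> (forall z, `|z - u| < d -> O z) ->
  local_lower_bound g u Q Phi h d rho -> convex_ereal_fun g -> 0 < gamma ->
  ri (subdiff g u) y -> prox_C1_around gamma g (u + gamma *: y).
Proof.
move=> nf d0 dO loc cg g0 riy.
have lb := convex_lower_bound nf d0 dO loc cg.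
have lt01 (a : R) : a * 0 < 1 by rewrite mulr0.
apply: (prox_C1_of_ri nf g0 d0 (lexx 0) (lt01 _) dO _ (lt01 _)) => //.
  by move=> k v w Kk k1 vd _ hv kv; rewrite mul0r subr0; exact: lb.
move=> w; rewrite mul0r subr0.
have K0 : linear_minorants h 0 by apply: minorant0; exact: nf_ge0 nf.
have := lb 0 u w K0; rewrite normr0 ler01 subrr normr0 d0 (nf_Phi nf) !inner0l (nf_Q nf) (nf_dQ nf) !addr0.
have hNy z : (-oo < h z)%E by apply: lt_le_trans (nf_ge0 nf z); rewrite ltNyr.
by move=> /(_ isT isT (sublinear0 hNy (nf_sublinear nf)) erefl).
Qed.

End Assembly.

Theorem theorem5p11 (R : realType) (Y : finHilbertType R) (g : Y -> \bar R)
    (ubar ybar : Y) (gph : subdiff g ubar ybar)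
    (U : set Y) (nbhsU : nbhs ubar U)
    (decU : forall u, (U `&` dom g) u -> reliably_C2_decomposable g u)
    (pbg : prox_bounded g) :
  ([<-> ri (subdiff g ubar) ybar;
        exists r : R, 0 < r /\ forall gamma : R, 0 < gamma < r^-1 ->
          prox_C1_around gamma g (ubar + gamma *: ybar);
        exists r : R, 0 < r /\ forall gamma : R, 0 < gamma < r^-1 ->
          envelope_C2_around gamma g (ubar + gamma *: ybar)])
  /\
  (convex_ereal_fun g ->
   [<-> ri (subdiff g ubar) ybar;
        forall gamma : R, 0 < gamma ->
          prox_C1_around gamma g (ubar + gamma *: ybar);
        forall gamma : R, 0 < gamma ->
          envelope_C2_around gamma g (ubar + gamma *: ybar)]).
Proof.
have gNy w : (-oo < g w)%E by exact: prox_bounded_gtNy.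
have dec : reliably_C2_decomposable g ubar.
  apply: decU; split; first exact: nbhs_singleton.
  by case: gph => gfin _; rewrite /dom/= ltey_eq gfin.
have [ O [Q [Phi [h nf]]]] := normal_form_ex dec gph.
have [d [rho [d0 rho0 dO loc]]] := local_lower_bound_ex nf.
have [r rr glob] := global_lower_bound nf d0 rho0 loc pbg.
have r0 : 0 < r by apply: lt_le_trans rr; rewrite mulr_gt0.
have K0 : linear_minorants h 0 by apply: minorant0; exact: nf_ge0 nf.
split=> [|cg]; tfae.
- move=> riy; exists r; split=> // gamma /andP[g0 gr].
  have {}gr : gamma * r < 1 by rewrite -ltr_pdivlMr// div1r.
  (* Both conditions reduce to gamma r < 1, the local one through 2 rho <= r. *)
  apply: (prox_C1_of_ri nf g0 d0 (ltW rho0) _ dO loc (kap := r / 2)) => //.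
  + by apply: le_lt_trans gr; rewrite -mulrA mulrCA ler_pM2l.
  + by rewrite (_ : 2 * gamma * (r / 2) = gamma * r)//; field.
  + by move=> w; have := glob 0 w K0; rewrite normr0 addr0; apply.
- move=> [s [s0 sP]]; exists s; split=> // gamma gs; have /andP[g0 _] := gs.
  by apply: prox_C1_envelope_C2 => //; exact: sP.
- move=> [s [s0 sP]].
  (* A single step size is enough: (r + s)^-1 is below s^-1, where the hypothesis applies, and
     satisfies gamma r <= 1. *)
  have m0 : 0 < r + s by exact: addr_gt0.
  have i0 : 0 < (r + s)^-1 by rewrite invr_gt0.
  apply: (ri_of_envelope_C2 nf i0 _ glob); first by rewrite mulrC ler_pdivrMr// mul1r lerDl ltW.
  by apply: sP; rewrite i0 ltf_pV2// ltrDr.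
- by move=> riy gamma g0; exact: (convex_prox_C1_of_ri nf d0 dO loc).
- by move=> proxP gamma g0; apply: prox_C1_envelope_C2 => //; exact: proxP.
(* Every gamma is available here, so r^-1 can be chosen, for which gamma r = 1. *)
- move=> envP; have i0 : 0 < r^-1 by rewrite invr_gt0.
  by apply: (ri_of_envelope_C2 nf i0 _ glob); [rewrite mulVf// gt_eqF|exact: envP].
Qed.
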